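(* Given an undirected path $P=(V,A)$ with $V=\{v_1,\dots,v_n\}$ and edges $\{v_i,v_{i+1}\}$, $1\le i<n$, a function $t:V\to\mathbb{R}$, and a real $\gamma\ge 0$, the $\gamma$-Lipschitz unimodal regression of $t$ on $P$ can be found in $O(n\log^2 n)$ time.
   Context: For each $i$, let $P_i$ be the directed graph on $V$ in which every edge of $P$ is oriented towards $v_i$ (arcs $(v_j,v_{j+1})$ for $j<i$ and $(v_j,v_{j-1})$ for $j>i$). Let $\Gamma_i$ be the set of $s:V\to\mathbb{R}$ with $s(u)\le s(w)\le s(u)+\gamma$ for every arc $(u,w)$ of $P_i$, and let $\sigma_i=\arg\min_{s\in\Gamma_i}\sum_{v\in V}(s(v)-t(v))^2$. The $\gamma$-Lipschitz unimodal regression of $t$ on $P$ is $\sigma_\kappa$ where $\kappa=\arg\min_i\sum_{v\in V}(\sigma_i(v)-t(v))^2$. *)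

(* Defs.v *)
From HB Require Import structures.
From mathcomp Require Import all_boot all_order all_algebra.
From mathcomp Require Import all_classical all_reals all_analysis.

Set Implicit Arguments.
Unset Strict Implicit.
Unset Printing Implicit Defensive.

Import Order.TTheory GRing.Theory Num.Theory.
Import numFieldNormedType.Exports.

Local Open Scope classical_set_scope.
Local Open Scope ring_scope.

Definition is_argmin (R : realType) (X : Type) (D : set X) (f : X -> R)
    (x : X) : Prop :=
  D x /\ forall y, D y -> f x <= f y.

(* The path has vertex set 'I_n; its j-th vertex is the ordinal j.-1. *)
Definition path_towards (n : nat) (i : 'I_n) : rel 'I_n := fun u w =>
  [|| (u < i)%N && (w == u.+1 :> nat) | (i < u)%N && (w.+1 == u :> nat)].

Definition lipschitz_isotonic (R : realType) (V : Type) (arc : rel V)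
    (gamma : R) : set (V -> R) :=
  [set s | forall u w, arc u w -> s u <= s w <= s u + gamma].

Definition sqerr (R : realType) (V : finType) (t s : V -> R) : R :=
  \sum_(v : V) (s v - t v) ^+ 2.

(* Different minimizers kappa may give different functions; each of these is
   a regression. *)
Definition unimodal_regression (R : realType) (n : nat) (gamma : R)
    (t s : 'I_n -> R) : Prop :=
  exists (sigma : 'I_n -> 'I_n -> R) (kappa : 'I_n),
    [/\ forall i, is_argmin (lipschitz_isotonic (path_towards i) gamma)
                            (sqerr t) (sigma i),
        is_argmin [set: 'I_n] (fun i => sqerr t (sigma i)) kappa
      & s = sigma kappa].

(* A real RAM.  A memory has numbered banks of word cells and numbered banks
   of real cells.  Bank numbers are literals of the program, so a program uses
   finitely many banks; the index within a bank is computed, which gives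
   indirect addressing.  Words have w bits.  The operations on reals are
   the field operations and comparison: there is no rounding to words, and
   the only real constants are those obtained from words. *)
Inductive wexp : Type :=
| WLit of nat
| WGet of nat & wexp
| WAdd of wexp & wexp
| WSub of wexp & wexp
| WMul of wexp & wexp
| WDiv of wexp & wexp.

Inductive rexp : Type :=
| ROfWord of wexp
| RGet of nat & wexp
| RAdd of rexp & rexp
| RSub of rexp & rexp
| RMul of rexp & rexp
| RDiv of rexp & rexp.

Inductive bexp : Type :=
| BWordLe of wexp & wexp
| BRealLe of rexp & rexp
| BNot of bexp
| BAnd of bexp & bexp.

Inductive cmd : Type :=
| CSkip
| CWSet of nat & wexp & wexp
| CRSet of nat & wexp & rexp
| CSeq of cmd & cmd
| CIf of bexp & cmd & cmd
| CWhile of bexp & cmd.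

Record memory (R : Type) := Memory {
  wmem : nat -> nat -> nat;
  rmem : nat -> nat -> R }.

Definition update (A : Type) (m : nat -> nat -> A) (b k : nat) (a : A) :
    nat -> nat -> A :=
  fun b' k' => if (b' == b) && (k' == k) then a else m b' k'.

(* Addition and multiplication wrap around modulo 2 ^ w; subtraction is
   truncated at 0, and division is integer division. *)
Fixpoint weval (R : Type) (w : nat) (m : memory R) (e : wexp) : nat :=
  match e with
  | WLit k => k %% 2 ^ w
  | WGet b e1 => wmem m b (weval w m e1)
  | WAdd e1 e2 => (weval w m e1 + weval w m e2) %% 2 ^ w
  | WSub e1 e2 => weval w m e1 - weval w m e2
  | WMul e1 e2 => (weval w m e1 * weval w m e2) %% 2 ^ w
  | WDiv e1 e2 => weval w m e1 %/ weval w m e2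
  end%N.

Fixpoint reval (R : realType) (w : nat) (m : memory R) (e : rexp) : R :=
  match e with
  | ROfWord e1 => (weval w m e1)%:R
  | RGet b e1 => rmem m b (weval w m e1)
  | RAdd e1 e2 => reval w m e1 + reval w m e2
  | RSub e1 e2 => reval w m e1 - reval w m e2
  | RMul e1 e2 => reval w m e1 * reval w m e2
  | RDiv e1 e2 => reval w m e1 / reval w m e2
  end.

Fixpoint beval (R : realType) (w : nat) (m : memory R) (e : bexp) : bool :=
  match e with
  | BWordLe e1 e2 => (weval w m e1 <= weval w m e2)%N
  | BRealLe e1 e2 => reval w m e1 <= reval w m e2
  | BNot e1 => ~~ beval w m e1
  | BAnd e1 e2 => beval w m e1 && beval w m e2
  end.

(* The evaluation time of an expression: one step per operation. *)
Fixpoint wcost (e : wexp) : nat :=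
  match e with
  | WLit _ => 1
  | WGet _ e1 => (wcost e1).+1
  | WAdd e1 e2 | WSub e1 e2 | WMul e1 e2 | WDiv e1 e2 =>
      (wcost e1 + wcost e2).+1
  end%N.

Fixpoint rcost (e : rexp) : nat :=
  match e with
  | ROfWord e1 | RGet _ e1 => (wcost e1).+1
  | RAdd e1 e2 | RSub e1 e2 | RMul e1 e2 | RDiv e1 e2 =>
      (rcost e1 + rcost e2).+1
  end%N.

Fixpoint bcost (e : bexp) : nat :=
  match e with
  | BWordLe e1 e2 => (wcost e1 + wcost e2).+1
  | BRealLe e1 e2 => (rcost e1 + rcost e2).+1
  | BNot e1 => (bcost e1).+1
  | BAnd e1 e2 => (bcost e1 + bcost e2).+1
  end%N.

(* exec w c m m' k: with w-bit words, c started in m halts in m' after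
   exactly k steps. *)
Inductive exec (R : realType) (w : nat) :
    cmd -> memory R -> memory R -> nat -> Prop :=
| ExecSkip m : exec w CSkip m m 1
| ExecWSet b i e m :
    exec w (CWSet b i e) m
      (Memory (update (wmem m) b (weval w m i) (weval w m e)) (rmem m))
      (wcost i + wcost e).+1
| ExecRSet b i e m :
    exec w (CRSet b i e) m
      (Memory (wmem m) (update (rmem m) b (weval w m i) (reval w m e)))
      (wcost i + rcost e).+1
| ExecSeq c1 c2 m m1 m2 k1 k2 :
    exec w c1 m m1 k1 -> exec w c2 m1 m2 k2 ->
    exec w (CSeq c1 c2) m m2 (k1 + k2)
| ExecIf b c1 c2 m m1 k :
    exec w (if beval w m b then c1 else c2) m m1 k ->
    exec w (CIf b c1 c2) m m1 (bcost b + k).+1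
| ExecWhileDone b c m :
    ~~ beval w m b ->
    exec w (CWhile b c) m m (bcost b).+1
| ExecWhileStep b c m m1 m2 k1 k2 :
    beval w m b ->
    exec w c m m1 k1 -> exec w (CWhile b c) m1 m2 k2 ->
    exec w (CWhile b c) m m2 (bcost b + k1 + k2).+1.

Lemma exec_deterministic (R : realType) (w : nat) (c : cmd)
    (m m1 m2 : memory R) (k1 k2 : nat) :
  exec w c m m1 k1 -> exec w c m m2 k2 -> m1 = m2 /\ k1 = k2.
Proof.
move=> H1; elim: H1 m2 k2 => {c m m1 k1}.
- by move=> m m2 k2 H; inversion H.
- by move=> b i e m m2 k2 H; inversion H.
- by move=> b i e m m2 k2 H; inversion H.
- move=> c1 c2 m m1 m2 k1 k2 _ IH1 _ IH2 m3 k3 H.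
  inversion H as [| | |? ? ? ? ? ? ? E1 E2| | |]; subst.
  by have [? ?] := IH1 _ _ E1; subst; have [-> ->] := IH2 _ _ E2.
- move=> b c1 c2 m m1 k _ IH m3 k3 H.
  inversion H as [| | | |? ? ? ? ? ? E| |]; subst.
  by have [-> ->] := IH _ _ E.
- move=> b c m /negP Hb m3 k3 H.
  by inversion H; subst.
- move=> b c m m1 m2 k1 k2 Hb _ IH1 _ IH2 m3 k3 H.
  inversion H as [| | | | |? ? ? N|? ? ? ? ? ? ? N E1 E2]; subst.
    by rewrite Hb in N.
  by have [? ?] := IH1 _ _ E1; subst; have [-> ->] := IH2 _ _ E2.
Qed.

(* Input: n in word bank 0, t in real bank 0 (in path order), gamma in real
   bank 1; every other cell is 0. *)
Definition input_memory (R : realType) (n : nat) (t : 'I_n -> R) (gamma : R) :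
    memory R :=
  Memory
    (fun b k => if (b == 0%N) && (k == 0%N) then n else 0%N)
    (fun b k => match b, k with
                | 0%N, _ => oapp t 0 (insub k)
                | 1%N, 0%N => gamma
                | _, _ => 0
                end).

(* Output: real bank 2, in path order. *)
Definition output (R : realType) (n : nat) (m : memory R) : 'I_n -> R :=
  fun v => rmem m 2 v.
Arguments output {R} n m _.

(* c times the number of bits of n, for n > 0. *)
Definition word_size (c n : nat) : nat := (c * (trunc_log 2 n).+1)%N.

(* Main.v *)
Require Import Defs.
From HB Require Import structures.
From mathcomp Require Import all_boot all_order all_algebra.
From mathcomp Require Import all_classical all_reals all_analysis.
From mathcomp Require Import zify ring lra.

Set Implicit Arguments.
Unset Strict Implicit.
Unset Printing Implicit Defensive.

Import Order.TTheory GRing.Theory Num.Theory.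
Import numFieldNormedType.Exports.

Local Open Scope classical_set_scope.
Local Open Scope ring_scope.

(* A chain of values below a peak value x, cut at vertex k, has a least cost
   A_k(x) with A_(k+1)(x) = min {F_k(y) | x - g <= y <= x} and
   F_k(y) = A_k(y) + (y - u_k)^2.  F_k is convex, so the minimum is attained at
   the clamp of its minimizer m_k to [x - g, x].  A_k is piecewise quadratic:
   it is sum_(j < k) (x - u_j)^2 plus finitely many hinges e (x - p)_+^2, and
   passing from A_k to A_(k+1) shifts the hinges with p > m_k by g and adds
   hinges at m_k and m_k + g with opposite weights -c and c, where c is the
   leading coefficient of F_k at m_k.  The hinges are kept in a persistent
   balanced tree whose nodes store the sums of e p^j, j <= 2, of their subtree,
   so that A_k is evaluated in O(log n) time and its minimizer is found in
   O(log^2 n) time, by comparing the slope with 0 at the hinges on a branch.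
   A pass from each end of the path gives all A_k for both sides.  The cost of
   the peak i is then the minimum of A_i(x) + A'_(n-1-i)(x) + (x - t_i)^2, which
   the same search finds by descending the two trees one after the other. *)

(** * Running programs of the machine *)

(** On the piece containing m_k, F_k(y) = c (y - m_k)^2 + const. The hinge of weight -c at m_k makes
    this constant on [m_k, m_k + g], and the hinge of weight c at m_k + g resumes the parabola
    shifted by g; hence the opposite weights. The pairs of trees that meet at the peaks involve
    every version, so no version may be overwritten, yet a shift concerns all hinges above m_k.
    Positions relative to the parent reconcile the two demands: a shift changes one offset per
    copied node of a branch. Only the cost and the peak value are computed for each i; the
    regression itself is traced once, outwards from the best peak, by clamping with the stored m_k.
    Optimality rests on subgradient inequalities for half derivatives, so that nothing is ever
    differentiated. *)

Notation "c1 ;; c2" := (CSeq c1 c2) (at level 61, right associativity).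

Definition wr b := WGet b (WLit 0).
Definition rr b := RGet b (WLit 0).
Definition setw b e := CWSet b (WLit 0) e.
Definition setr b e := CRSet b (WLit 0) e.
Definition rzero := ROfWord (WLit 0).

Section Semantics.
Variables (R : realType) (w : nat).
Implicit Types (m : memory R) (c : cmd) (Q : memory R -> Prop).

(** The value over unbounded naturals. It agrees with [weval] as long as nothing wraps around, which
    is what [wsafe] records. *)
Fixpoint wval m (e : wexp) : nat :=
  match e with
  | WLit k => k
  | WGet b e1 => wmem m b (wval m e1)
  | WAdd e1 e2 => wval m e1 + wval m e2
  | WSub e1 e2 => wval m e1 - wval m e2
  | WMul e1 e2 => wval m e1 * wval m e2
  | WDiv e1 e2 => wval m e1 %/ wval m e2
  end%N.

Fixpoint rval m (e : rexp) : R :=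
  match e with
  | ROfWord e1 => (wval m e1)%:R
  | RGet b e1 => rmem m b (wval m e1)
  | RAdd e1 e2 => rval m e1 + rval m e2
  | RSub e1 e2 => rval m e1 - rval m e2
  | RMul e1 e2 => rval m e1 * rval m e2
  | RDiv e1 e2 => rval m e1 / rval m e2
  end.

Fixpoint bval m (e : bexp) : bool :=
  match e with
  | BWordLe e1 e2 => (wval m e1 <= wval m e2)%N
  | BRealLe e1 e2 => rval m e1 <= rval m e2
  | BNot e1 => ~~ bval m e1
  | BAnd e1 e2 => bval m e1 && bval m e2
  end.

(** Literals are limited to 0 and 1, which fit in words of any positive size. *)
Fixpoint wsafe m (e : wexp) : Prop :=
  match e with
  | WLit k => (k <= 1)%N
  | WGet _ e1 => wsafe m e1
  | WAdd e1 e2 =>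
      [/\ wsafe m e1, wsafe m e2 & (wval m e1 + wval m e2 < 2 ^ w)%N]
  | WMul e1 e2 =>
      [/\ wsafe m e1, wsafe m e2 & (wval m e1 * wval m e2 < 2 ^ w)%N]
  | WSub e1 e2 | WDiv e1 e2 => wsafe m e1 /\ wsafe m e2
  end.

Fixpoint rsafe m (e : rexp) : Prop :=
  match e with
  | ROfWord e1 | RGet _ e1 => wsafe m e1
  | RAdd e1 e2 | RSub e1 e2 | RMul e1 e2 | RDiv e1 e2 =>
      rsafe m e1 /\ rsafe m e2
  end.

Fixpoint bsafe m (e : bexp) : Prop :=
  match e with
  | BWordLe e1 e2 => wsafe m e1 /\ wsafe m e2
  | BRealLe e1 e2 => rsafe m e1 /\ rsafe m e2
  | BNot e1 => bsafe m e1
  | BAnd e1 e2 => bsafe m e1 /\ bsafe m e2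
  end.

Hypothesis w_gt0 : (0 < w)%N.

Lemma weval_safe m e : wsafe m e -> weval w m e = wval m e.
Proof.
elim: e => /= [k le1|b e IH|e IH e' IH'|e IH e' IH'|e IH e' IH'|e IH e' IH'].
- by rewrite modn_small // (leq_ltn_trans le1) // -{1}(expn0 2) ltn_exp2l.
- by move=> /IH ->.
- by case=> /IH -> /IH' -> lt; rewrite modn_small.
- by case=> /IH -> /IH' ->.
- by case=> /IH -> /IH' -> lt; rewrite modn_small.
- by case=> /IH -> /IH' ->.
Qed.

Lemma reval_safe m e : rsafe m e -> reval w m e = rval m e.
Proof.
elim: e => /= [e|b e|e IH e' IH'|e IH e' IH'|e IH e' IH'|e IH e' IH'].
- by move=> /weval_safe ->.
- by move=> /weval_safe ->.
- by case=> /IH -> /IH' ->.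
- by case=> /IH -> /IH' ->.
- by case=> /IH -> /IH' ->.
- by case=> /IH -> /IH' ->.
Qed.

Lemma beval_safe m e : bsafe m e -> beval w m e = bval m e.
Proof.
elim: e => /= [e e'|e e'|e IH|e IH e' IH'].
- by case=> /weval_safe -> /weval_safe ->.
- by case=> /reval_safe -> /reval_safe ->.
- by move=> /IH ->.
- by case=> /IH -> /IH' ->.
Qed.

(** The time [k] is an upper bound, unlike the exact time in [exec], so that the branches of a test
    can share one bound. *)
Definition runs c m Q (k : nat) : Prop :=
  exists m' k', [/\ exec w c m m' k', (k' <= k)%N & Q m'].

Lemma runs_weaken c m Q Q' k k' :
  runs c m Q k -> (forall m', Q m' -> Q' m') -> (k <= k')%N ->
  runs c m Q' k'.
Proof.
move=> [m' [j [E lejk Qm']]] QQ' lekk'; exists m', j.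
by split; [|exact: leq_trans lejk lekk'|exact: QQ'].
Qed.

Lemma runs_seq c1 c2 m Q k1 k2 :
  runs c1 m (fun m1 => runs c2 m1 Q k2) k1 -> runs (CSeq c1 c2) m Q (k1 + k2).
Proof.
move=> [m1 [j1 [E1 le1 [m2 [j2 [E2 le2 Qm2]]]]]].
by exists m2, (j1 + j2)%N; split; [exact: ExecSeq E1 E2|exact: leq_add|].
Qed.

Lemma runs_if b c1 c2 m Q k1 k2 :
  bsafe m b -> (bval m b -> runs c1 m Q k1) -> (~~ bval m b -> runs c2 m Q k2) ->
  runs (CIf b c1 c2) m Q (bcost b + maxn k1 k2).+1.
Proof.
move=> sb r1 r2.
have [m' [j [E lej Qm']]] : runs (if bval m b then c1 else c2) m Q (maxn k1 k2).
  case: ifP => [/r1|/negbT/r2] r; apply: runs_weaken r _ _ => //.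
    exact: leq_maxl.
  exact: leq_maxr.
exists m', (bcost b + j).+1; split => //.
  by apply: ExecIf; rewrite beval_safe.
by rewrite ltnS leq_add2l.
Qed.

Lemma runs_while_done b c m Q :
  bsafe m b -> ~~ bval m b -> Q m -> runs (CWhile b c) m Q (bcost b).+1.
Proof.
move=> sb nb Qm; exists m, (bcost b).+1; split => //.
by apply: ExecWhileDone; rewrite beval_safe.
Qed.

Lemma runs_while_step b c m Q k1 k2 :
  bsafe m b -> bval m b ->
  runs c m (fun m1 => runs (CWhile b c) m1 Q k2) k1 ->
  runs (CWhile b c) m Q (bcost b + k1 + k2).+1.
Proof.
move=> sb bb [m1 [j1 [E1 le1 [m2 [j2 [E2 le2 Qm2]]]]]].
exists m2, (bcost b + j1 + j2).+1; split => //.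
  by apply: ExecWhileStep E1 E2; rewrite beval_safe.
by rewrite ltnS leq_add // leq_add.
Qed.

(** The counter is a ghost index that no cell has to hold, so the rule also covers loops that count
    down. *)
Lemma runs_for b c (inv : nat -> memory R -> Prop) n i m k :
  (forall j m1, (j <= n)%N -> inv j m1 -> bsafe m1 b /\ bval m1 b = (j < n)%N) ->
  (forall j m1, (j < n)%N -> inv j m1 -> runs c m1 (inv j.+1) k) ->
  (i <= n)%N -> inv i m ->
  runs (CWhile b c) m (inv n)
    ((n - i) * (bcost b + k).+1 + (bcost b).+1).
Proof.
move=> Hb Hc; move: {2}(n - i)%N (erefl (n - i)%N) => d.
elim: d i m => [|d IH] i m Ed lein Im.
  have ein : i = n by lia.
  rewrite ein in Im Ed *; rewrite Ed mul0n.
  have [sb bb] := Hb _ _ (leqnn n) Im.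
  by apply: runs_while_done; rewrite ?bb ?ltnn.
have ltin : (i < n)%N by lia.
have [sb bb] := Hb _ _ lein Im.
apply: runs_weaken; first apply: runs_while_step (sb) _ _; first by rewrite bb.
- apply: runs_weaken (Hc _ _ ltin Im) _ (leqnn _) => m1.
  by move=> /IH; apply=> //; lia.
- by [].
- by have -> : (n - i = (n - i.+1).+1)%N by [lia]; rewrite mulSn; lia.
Qed.

(** Weakest preconditions of loop-free code only. Loops are handled by [runs_for] or by induction on
    the tree or stack that they traverse. *)
Fixpoint wp c Q m : Prop :=
  match c with
  | CSkip => Q m
  | CWSet b i e =>
      [/\ wsafe m i, wsafe m e &
        Q (Memory (update (wmem m) b (wval m i) (wval m e)) (rmem m))]
  | CRSet b i e =>
      [/\ wsafe m i, rsafe m e &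
        Q (Memory (wmem m) (update (rmem m) b (wval m i) (rval m e)))]
  | CSeq c1 c2 => wp c1 (wp c2 Q) m
  | CIf b c1 c2 =>
      [/\ bsafe m b, bval m b -> wp c1 Q m & ~~ bval m b -> wp c2 Q m]
  | CWhile _ _ => False
  end.

(** A loop counts 0 here; the time bounds of programs with loops add separate terms for them. *)
Fixpoint cost c : nat :=
  match c with
  | CSkip => 1
  | CWSet _ i e => (wcost i + wcost e).+1
  | CRSet _ i e => (wcost i + rcost e).+1
  | CSeq c1 c2 => cost c1 + cost c2
  | CIf b c1 c2 => (bcost b + maxn (cost c1) (cost c2)).+1
  | CWhile _ _ => 0
  end%N.

Lemma runs_wp c m Q : wp c Q m -> runs c m Q (cost c).
Proof.
elim: c m Q => [|b i e|b i e|c1 IH1 c2 IH2|b c1 IH1 c2 IH2|b c IH] m Q //=.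
- by move=> Qm; exists m, 1%N; split => //; exact: ExecSkip.
- move=> [si se Qm]; eexists _, _; split; [exact: ExecWSet|exact: leqnn|].
  by rewrite !weval_safe.
- move=> [si se Qm]; eexists _, _; split; [exact: ExecRSet|exact: leqnn|].
  by rewrite weval_safe ?reval_safe.
- move=> /IH1 r; apply: runs_seq; apply: runs_weaken r _ (leqnn _) => m1.
  exact: IH2.
- by move=> [sb w1 w2]; apply: runs_if => // [/w1/IH1|/w2/IH2].
Qed.

Lemma runs_wp_seq c1 c2 m Q k :
  wp c1 (fun m1 => runs c2 m1 Q k) m -> runs (CSeq c1 c2) m Q (cost c1 + k).
Proof. by move=> /runs_wp; exact: runs_seq. Qed.

Fixpoint wbanks c : seq nat :=
  match c with
  | CWSet b _ _ => [:: b]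
  | CSeq c1 c2 | CIf _ c1 c2 => wbanks c1 ++ wbanks c2
  | CWhile _ c1 => wbanks c1
  | _ => [::]
  end.

Fixpoint rbanks c : seq nat :=
  match c with
  | CRSet b _ _ => [:: b]
  | CSeq c1 c2 | CIf _ c1 c2 => rbanks c1 ++ rbanks c2
  | CWhile _ c1 => rbanks c1
  | _ => [::]
  end.

(** Banks play the role of variables: by [exec_same_off], code preserves every bank that it does not
    assign syntactically. This is the frame rule. *)
Definition same_off (ws rs : seq nat) m m' : Prop :=
  (forall b k, b \notin ws -> wmem m' b k = wmem m b k) /\
  (forall b k, b \notin rs -> rmem m' b k = rmem m b k).

Lemma same_off_sub ws rs ws' rs' m m' :
  {subset ws <= ws'} -> {subset rs <= rs'} ->
  same_off ws rs m m' -> same_off ws' rs' m m'.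
Proof.
move=> sw sr [hw hr]; split=> b k nb; [apply: hw|apply: hr];
  by apply: contra nb => /sw || apply: contra nb => /sr.
Qed.

Lemma same_off_trans ws rs m m1 m2 :
  same_off ws rs m m1 -> same_off ws rs m1 m2 -> same_off ws rs m m2.
Proof.
by move=> [w1 r1] [w2 r2]; split=> b k nb; rewrite ?w2 ?w1 ?r2 ?r1.
Qed.

Lemma same_off_seq c1 c2 m m1 m2 :
  same_off (wbanks c1) (rbanks c1) m m1 ->
  same_off (wbanks c2) (rbanks c2) m1 m2 ->
  same_off (wbanks (c1 ;; c2)) (rbanks (c1 ;; c2)) m m2.
Proof.
move=> h1 h2; apply: (@same_off_trans _ _ _ m1).
  by apply: same_off_sub h1 => b; rewrite mem_cat => ->.
by apply: same_off_sub h2 => b; rewrite mem_cat => ->; rewrite orbT.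
Qed.

Lemma exec_same_off c m m' k :
  exec w c m m' k -> same_off (wbanks c) (rbanks c) m m'.
Proof.
elim=> {c m m' k} //=.
- move=> b i e m; split=> //= b' k; rewrite inE => /negbTE nb.
  by rewrite /update nb.
- move=> b i e m; split=> //= b' k; rewrite inE => /negbTE nb.
  by rewrite /update nb.
- by move=> c1 c2 m m1 m2 k1 k2 _ h1 _ h2; exact: same_off_seq h1 h2.
- move=> b c1 c2 m m1 k _; case: ifP => _; apply: same_off_sub => b';
    by rewrite mem_cat => ->; rewrite ?orbT.
- by move=> b c m m1 m2 k1 k2 _ _ h1 _ h2; exact: same_off_trans h1 h2.
Qed.

Lemma runs_frame c m Q k :
  runs c m Q k ->
  runs c m (fun m' => Q m' /\ same_off (wbanks c) (rbanks c) m m') k.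
Proof.
move=> [m' [j [E le Qm']]]; exists m', j; split => //; split => //.
exact: exec_same_off E.
Qed.

Lemma runs_seq_frame c1 c2 m (Q1 Q : memory R -> Prop) k1 k2 :
  runs c1 m Q1 k1 ->
  (forall m1, Q1 m1 -> same_off (wbanks c1) (rbanks c1) m m1 -> runs c2 m1 Q k2) ->
  runs (c1 ;; c2) m Q (k1 + k2).
Proof.
move=> r1 r2; apply: runs_seq; apply: runs_weaken (runs_frame r1) _ (leqnn _).
by move=> m1 [q s]; exact: r2.
Qed.

Lemma wp_seq c1 c2 (Q : memory R -> Prop) m :
  wp c1 (wp c2 Q) m -> wp (c1 ;; c2) Q m.
Proof. by []. Qed.

Lemma wp_skip (Q : memory R -> Prop) m : Q m -> wp CSkip Q m.
Proof. by []. Qed.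

Lemma wp_eta c (Q : memory R -> Prop) m :
  wp c Q (Memory (wmem m) (rmem m)) -> wp c Q m.
Proof. by case: m. Qed.

Lemma wp_wset b i e (Q : memory R -> Prop) f h k v :
  let m := Memory f h in
  wval m i = k -> wval m e = v -> wsafe m i -> wsafe m e ->
  Q (Memory (update f b k v) h) -> wp (CWSet b i e) Q m.
Proof. by move=> m <- <-. Qed.

Lemma wp_rset b i e (Q : memory R -> Prop) f h k v :
  let m := Memory f h in
  wval m i = k -> rval m e = v -> wsafe m i -> rsafe m e ->
  Q (Memory f (update h b k v)) -> wp (CRSet b i e) Q m.
Proof. by move=> m <- <-. Qed.

Lemma wp_if b c1 c2 (Q : memory R -> Prop) m v :
  bval m b = v -> bsafe m b ->
  (v -> wp c1 Q m) -> (~~ v -> wp c2 Q m) -> wp (CIf b c1 c2) Q m.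
Proof. by move=> <-. Qed.

Lemma runs_wset b e c f h v (Q : memory R -> Prop) k :
  wval (Memory f h) e = v -> wsafe (Memory f h) e ->
  runs c (Memory (update f b 0 v) h) Q k ->
  runs (setw b e ;; c) (Memory f h) Q (cost (setw b e) + k).
Proof. by move=> <- s r; apply: runs_wp_seq. Qed.

Lemma runs_rset b e c f h v (Q : memory R -> Prop) k :
  rval (Memory f h) e = v -> rsafe (Memory f h) e ->
  runs c (Memory f (update h b 0 v)) Q k ->
  runs (setr b e ;; c) (Memory f h) Q (cost (setr b e) + k).
Proof. by move=> <- s r; apply: runs_wp_seq. Qed.

End Semantics.

Ltac ev := rewrite /update /=; reflexivity.
Ltac sf := rewrite /update /=; do ?split; try by [].
Ltac wps := rewrite ?/setw ?/setr; lazymatch goal with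
  | |- wp _ (CSeq _ _) _ _ => apply: wp_seq; wps
  | |- wp _ (CWSet _ _ _) _ _ => eapply wp_wset; [ev|ev|sf|sf|]
  | |- wp _ (CRSet _ _ _) _ _ => eapply wp_rset; [ev|ev|sf|sf|]
  end.

Ltac args := let hw := fresh in let hr := fresh in
  move=> ? [hw hr]; rewrite /= ?hw // ?hr //; split; split.

(** * Cost functions of chains *)

Definition clamp (R : realFieldType) (g m y : R) : R :=
  if m <= y - g then y - g else if y <= m then y else m.

Section Chain.
Variables (R : realFieldType) (g : R) (u m : nat -> R).

Fixpoint cost_to k x : R :=
  if k is k'.+1 then
    let y := clamp g (m k') x in cost_to k' y + (y - u k') ^+ 2
  else 0.

(** Half the derivative of [cost_to]. At an end of the interval the clamp differs from x by a
    constant, and the chain rule applies; at y = m_k the half derivative of F_k is zero, as it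
    should be on the flat part. *)
Fixpoint slope_to k x : R :=
  if k is k'.+1 then let y := clamp g (m k') x in slope_to k' y + (y - u k')
  else 0.

Hypothesis g_ge0 : 0 <= g.

Definition roots_below k :=
  forall j, (j < k)%N -> slope_to j (m j) + (m j - u j) = 0.

Lemma roots_belowW k : roots_below k.+1 -> roots_below k.
Proof. by move=> h j ltjk; apply: h; exact: ltnW. Qed.

Lemma clamp_itv k y : y - g <= clamp g (m k) y <= y.
Proof.
by rewrite /clamp; case: (leP (m k) (y - g)) => ?; last case: (leP y (m k)) => ?;
  apply/andP; split; move: g_ge0; lra.
Qed.

(** Convexity of A_k. The square in F_k contributes the extra term (b - a)^2. The minimum over
    [y - g, y] is handled by the sign of the half derivative of F_k at the clamp: nonnegative at the
    left end, nonpositive at the right end, zero inside. *)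
Lemma cost_to_subgradient k z y : roots_below k ->
  cost_to k z + 2 * slope_to k z * (y - z) <= cost_to k y.
Proof.
elim: k z y => [|k IH] z y hk /=; first by lra.
have {}IH a b := IH a b (roots_belowW hk).
have IH' a b : cost_to k a + (a - u k) ^+ 2
    + 2 * (slope_to k a + (a - u k)) * (b - a) + (b - a) ^+ 2
    <= cost_to k b + (b - u k) ^+ 2 by have := IH a b; lra.
set cz := clamp g (m k) z; set cy := clamp g (m k) y.
have mono a b : a <= b ->
    slope_to k a + (a - u k) <= slope_to k b + (b - u k).
  rewrite le_eqVlt => /predU1P[->//|ltab].
  rewrite leNgt; apply/negP => lt1; have := IH a b; have := IH b a.
  by have : 0 < (b - a) * (slope_to k a - slope_to k b + (a - b));
    [apply: mulr_gt0; lra|have := sqr_ge0 (b - a); lra].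
(* If the half derivative at [cz] is positive, the offset [cz - z] is -g, the least possible one; if
   it is negative, the offset is 0, the greatest possible one. *)
have key : 0 <= (slope_to k cz + (cz - u k)) * ((cy - y) - (cz - z)).
  have /andP[cy1 cy2] := clamp_itv k y; rewrite -/cy in cy1 cy2.
  have root := hk k (ltnSn k).
  rewrite /cz /clamp; case: ifP => [le1|_]; last case: ifP => [le2|_].
  - by have := mono _ _ le1; rewrite root => ?; apply: mulr_ge0; lra.
  - by have := mono _ _ le2; rewrite root => ?; rewrite -mulrNN; apply: mulr_ge0; lra.
  - by rewrite root mul0r.
have := IH' cz cy; have := sqr_ge0 (cy - cz); lra.
Qed.

Lemma slope_to_mono k x y : roots_below k -> x <= y -> slope_to k x <= slope_to k y.
Proof.
move=> hk; rewrite le_eqVlt => /predU1P[->//|ltxy].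
rewrite leNgt; apply/negP => lt1.
have := cost_to_subgradient x y hk; have := cost_to_subgradient y x hk.
by have : 0 < (y - x) * (slope_to k x - slope_to k y);
  [apply: mulr_gt0; lra|lra].
Qed.

(** Clamping only lowers the argument of an increasing slope. Consequently the slope is nonpositive
    at the mean of the targets, which gives the search a starting point. *)
Lemma slope_to_le k x : roots_below k -> slope_to k x <= \sum_(j < k) (x - u j).
Proof.
case: k => [|k]; first by rewrite big_ord0.
elim: k => [|k IH] /= in x * => hk.
  by rewrite big_ord1; have := clamp_itv 0 x; lra.
rewrite big_ord_recr /=; have /andP[_ le1] := clamp_itv k.+1 x.
have hk' := roots_belowW hk.
have := slope_to_mono hk' le1; have := IH x hk'; rewrite /=; lra.
Qed.

(** By induction: s_k is a feasible point of the interval below s_(k+1), on which the convex F_k is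
    least at the clamp. *)
Lemma cost_to_le (s : nat -> R) k : roots_below k ->
  (forall j, (j < k)%N -> s j <= s j.+1 <= s j + g) ->
  cost_to k (s k) <= \sum_(j < k) (s j - u j) ^+ 2.
Proof.
elim: k => [|k IH] hk hs; first by rewrite big_ord0.
have hk' := roots_belowW hk.
rewrite big_ord_recr /=.
have {}IH := IH hk' (fun j ltjk => hs j (ltnW ltjk)).
have /andP[h1 h2] := hs k (ltnSn k).
apply: le_trans (lerD IH (lexx _)).
set y := s k.+1 in h1 h2 *; set c := clamp g (m k) y.
have sg := cost_to_subgradient c (s k) hk'.
have : 0 <= (slope_to k c + (c - u k)) * (s k - c).
  have root := hk k (ltnSn k).
  have mono x' y' := @slope_to_mono k x' y' hk'.
  rewrite /c /clamp; case: ifP => [le1|_]; last case: ifP => [le2|_].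
  - by have := mono _ _ le1 => ?; apply: mulr_ge0; lra.
  - by have := mono _ _ le2 => ?; rewrite -mulrNN; apply: mulr_ge0; lra.
  - by rewrite root mul0r.
have := sqr_ge0 (s k - c); lra.
Qed.

Lemma cost_to_trace (s : nat -> R) k :
  (forall j, (j < k)%N -> s j = clamp g (m j) (s j.+1)) ->
  cost_to k (s k) = \sum_(j < k) (s j - u j) ^+ 2.
Proof.
elim: k => [|k IH] hs; first by rewrite big_ord0.
rewrite big_ord_recr /= -hs // IH // => j ltjk.
by apply: hs; exact: ltnW.
Qed.

End Chain.

(** * Piecewise quadratic functions as sums of hinges *)

Section Hinges.
Variable R : realFieldType.
Implicit Types (L : seq (R * R)) (x y z g : R).

(* A pair (p, e) stands for the hinge x |-> e * (x - p)_+ ^ 2; the hinges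
   active at x sum up to M0 x ^ 2 - 2 M1 x + M2, where Mj = moment j L x. *)
Definition moment (j : nat) L x : R :=
  \sum_(b <- L | b.1 <= x) b.2 * b.1 ^+ j.

Lemma moment_cat j L1 L2 x : moment j (L1 ++ L2) x = moment j L1 x + moment j L2 x.
Proof. exact: big_cat. Qed.

Definition hinge_insert z g e L : seq (R * R) :=
  [seq b <- L | b.1 <= z] ++
  [:: (z, - e), (z + g, e) & [seq (b.1 + g, b.2) | b <- L & z < b.1]].

Lemma moment_hinge_insert j z g e L x :
  moment j (hinge_insert z g e L) x =
  \sum_(b <- L | (b.1 <= z) && (b.1 <= x)) b.2 * b.1 ^+ j
  + ((z <= x)%R%:R * (- e * z ^+ j) + ((z + g <= x)%R%:R * (e * (z + g) ^+ j)
  + \sum_(b <- L | (z < b.1) && (b.1 <= x - g)) b.2 * (b.1 + g) ^+ j)).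
Proof.
rewrite /moment big_cat /= big_filter_cond; congr (_ + _).
rewrite !big_cons /= big_map big_filter_cond /=.
under [in RHS]eq_bigl do rewrite lerBrDr.
by do 2 case: (_ <= x); rewrite ?mul1r ?mul0r ?add0r.
Qed.

Section Represents.
Variables (g : R) (u m : nat -> R) (k : nat).

(** The squares without a hinge sum up to base 0 x^2 - 2 base 1 x + base 2. *)
Definition base (j l : nat) : R := \sum_(i < l) u i ^+ j.

Definition represents (l : nat) L := forall x,
  slope_to g u m l x =
    (base 0 l + moment 0 L x) * x - (base 1 l + moment 1 L x) /\
  cost_to g u m l x =
    (base 0 l + moment 0 L x) * x ^+ 2 - 2 * (base 1 l + moment 1 L x) * x
    + (base 2 l + moment 2 L x).

Lemma represents_nil : represents 0 [::].
Proof. by move=> x; rewrite /base /moment !big_ord0 !big_nil /=; split; ring. Qed.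

Lemma baseS j l : base j l.+1 = base j l + u l ^+ j.
Proof. by rewrite /base big_ord_recr. Qed.

Hypothesis g_ge0 : 0 <= g.

(** The hypotheses say that [c0] is the leading coefficient of F_k at m_k and that the slope
    vanishes there. Below m_k no new hinge is active and A_(k+1) = F_k; on [m_k, m_k + g) the hinge
    of weight -c0 leaves the constant F_k(m_k); from m_k + g on the value is F_k(x - g). *)
Lemma represents_step L c0 :
  c0 = base 0 k.+1 + moment 0 L (m k) ->
  c0 * m k = base 1 k.+1 + moment 1 L (m k) ->
  represents k L -> represents k.+1 (hinge_insert (m k) g c0 L).
Proof.
move: g_ge0; set z := m k => g0 E0 Ec rep x.
set L' := hinge_insert _ _ _ _.
have [rd rc] := rep (clamp g z x).
rewrite /= -/z {}rd {}rc.
rewrite !baseS in E0 Ec.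
have EM0 : moment 0 L z = c0 - base 0 k - u k ^+ 0 by rewrite E0; ring.
have EM1 : moment 1 L z = c0 * z - base 1 k - u k ^+ 1 by rewrite Ec; ring.
have [ltxz|lezx] := ltP x z.
  have zx : (z <= x) = false by rewrite leNgt ltxz.
  have zgx : (z + g <= x) = false by apply/negbTE; rewrite -ltNge; lra.
  have E j : moment j L' x = moment j L x.
    rewrite moment_hinge_insert zx zgx !mul0r !add0r.
    rewrite [X in _ + X]big_pred0 ?addr0.
      by apply: eq_bigl => b; apply: andb_idl => ?; lra.
    by move=> b; apply/negbTE/negP => /andP[? ?]; lra.
  have -> : clamp g z x = x.
    by rewrite /clamp leNgt (ltW ltxz) ifF //; apply/negbTE; lra.
  by rewrite !E !baseS; split; ring.
have E1 j : \sum_(b <- L | (b.1 <= z) && (b.1 <= x)) b.2 * b.1 ^+ j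
    = moment j L z.
  by apply: eq_bigl => b; apply: andb_idr => ?; lra.
have [ltxg|lezxg] := ltP (x - g) z.
  have zgx : (z + g <= x) = false by apply/negbTE; rewrite -ltNge; lra.
  have E j : moment j L' x = moment j L z - c0 * z ^+ j.
    rewrite moment_hinge_insert E1 lezx zgx !mul0r !add0r.
    rewrite [X in _ + (_ + X)]big_pred0 ?addr0; first by rewrite mul1r mulNr.
    by move=> b; apply/negbTE/negP => /andP[? ?]; lra.
  have -> : clamp g z x = z.
    rewrite /clamp leNgt ltxg /=; case: ifP => // ?; lra.
  rewrite !E !baseS EM0 EM1.
  by split; ring.
have zgx : z + g <= x by lra.
have clx : clamp g z x = x - g by rewrite /clamp lezxg.
(* The hinges between m_k and x - g are the shifted ones that are active at x. Their shifted moments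
   are expanded binomially in terms of [N]. *)
pose N j := \sum_(b <- L | (z < b.1) && (b.1 <= x - g)) b.2 * b.1 ^+ j.
have EN j : moment j L (x - g) = moment j L z + N j.
  rewrite /moment (bigID (fun b : R * R => b.1 <= z)) /=; congr (_ + _).
    by apply: eq_bigl => b; apply: andb_idl => ?; lra.
  by apply: eq_bigl => b; rewrite -ltNge andbC.
have E j : moment j L' x = moment j L z - c0 * z ^+ j + c0 * (z + g) ^+ j
    + \sum_(b <- L | (z < b.1) && (b.1 <= x - g)) b.2 * (b.1 + g) ^+ j.
  by rewrite moment_hinge_insert E1 lezx zgx !mul1r; ring.
have N0 : \sum_(b <- L | (z < b.1) && (b.1 <= x - g)) b.2 * (b.1 + g) ^+ 0 = N 0.
  by apply: eq_bigr => b _; rewrite !expr0.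
have N1 : \sum_(b <- L | (z < b.1) && (b.1 <= x - g)) b.2 * (b.1 + g) ^+ 1
    = N 1 + g * N 0.
  rewrite mulr_sumr -big_split /=; apply: eq_bigr => b _; ring.
have N2 : \sum_(b <- L | (z < b.1) && (b.1 <= x - g)) b.2 * (b.1 + g) ^+ 2
    = N 2 + 2 * g * N 1 + g ^+ 2 * N 0.
  rewrite !mulr_sumr -!big_split /=; apply: eq_bigr => b _; ring.
rewrite clx !E N0 N1 N2 !EN !baseS EM0 EM1.
by split; ring.
Qed.

End Represents.

Lemma seq_argmin (P : pred (R * R)) L :
  has P L -> exists2 b, (b \in L) && P b & {in L, forall a, P a -> b.1 <= a.1}.
Proof.
elim: L => //= b L IH; case: (boolP (has P L)) => [/IH[a /andP[aL Pa] amin] _|nh].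
  case: (boolP (P b && (b.1 <= a.1))) => [/andP[Pb leba]|nPb].
    exists b; first by rewrite mem_head.
    move=> d; rewrite inE => /predU1P[->//|dL Pd].
    exact: le_trans leba (amin _ dL Pd).
  exists a; first by rewrite inE aL orbT.
  move=> d; rewrite inE => /predU1P[->|]; last exact: amin.
  by move=> Pb; move: nPb; rewrite Pb /= -ltNge => /ltW.
rewrite orbF => Pb; exists b; first by rewrite mem_head.
move=> d; rewrite inE => /predU1P[->//|dL Pd].
by move/hasPn: nh => /(_ _ dL); rewrite Pd.
Qed.

Lemma eq_moment L x y : x <= y ->
  {in L, forall b, b.1 <= y -> b.1 <= x} ->
  forall j, moment j L y = moment j L x.
Proof.
move=> lexy h j; rewrite /moment big_seq_cond [RHS]big_seq_cond.
apply: eq_bigl => b; case: (boolP (b \in L)) => //= bL.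
by apply/idP/idP => [/h->//|/le_trans]; exact.
Qed.

(** * The zero of an increasing piecewise affine slope *)

Section Root.
Variables (b0 b1 : R) (L : seq (R * R)) (lo : R).

Let D x := (b0 + moment 0 L x) * x - (b1 + moment 1 L x).

Hypothesis D_mono : forall x y, x <= y -> y - x <= D y - D x.
Hypothesis D_lo : D lo <= 0.
Hypothesis D_above : {in L, forall b, lo < b.1 -> 0 < D b.1}.

Let c0 := b0 + moment 0 L lo.
Let z := (b1 + moment 1 L lo) / c0.

(** From [lo] to the next hinge D is affine with slope [c0]. The zero [z] of this affine function
    lies before the next hinge, because D is positive there, so a single division finds the zero of
    D. *)
Lemma moment_root : [/\ 1 <= c0, D z = 0 & forall j, moment j L z = moment j L lo].
Proof.
have c0_ge1 : 1 <= c0.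
  (* A point beyond [lo] with no hinge in between, from which the slope [c0] is read off: half way
     to the next hinge, or lo + 1 if there is none. *)
  have [y ltloy hy] : exists2 y, lo < y & {in L, forall b, b.1 <= y -> b.1 <= lo}.
    case: (boolP (has (fun b : R * R => lo < b.1) L)) => [|/hasPn nh].
      move=> /seq_argmin[q /andP[qL ltq] qmin].
      exists ((lo + q.1) / 2); first by lra.
      move=> b bL leb; rewrite leNgt; apply/negP => ltb.
      by have := qmin _ bL ltb; lra.
    exists (lo + 1); first by lra.
    by move=> b bL _; rewrite leNgt; exact: nh.
  have := D_mono (ltW ltloy); rewrite /D !(eq_moment (ltW ltloy) hy) -/c0.
  have -> : c0 * y - (b1 + moment 1 L lo) - (c0 * lo - (b1 + moment 1 L lo))
    = c0 * (y - lo) by ring.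
  by rewrite -[X in X <= _]mul1r ler_pM2r // subr_gt0.
have c0_gt0 : 0 < c0 by exact: lt_le_trans c0_ge1.
have Ez : c0 * z = b1 + moment 1 L lo by rewrite /z mulrC divfK ?gt_eqF.
have lelo : lo <= z by rewrite ler_pdivlMr // mulrC -subr_le0.
have hz : {in L, forall b, b.1 <= z -> b.1 <= lo}.
  move=> b bL lebz; rewrite leNgt; apply/negP => ltb.
  have /seq_argmin[q /andP[qL ltq] qmin] :
      has (fun b : R * R => lo < b.1) L by apply/hasP; exists b.
  have leqz : q.1 <= z by exact: le_trans (qmin _ bL ltb) lebz.
  have := D_above qL ltq; rewrite ltNge => /negP[].
  (* Hinges located exactly at [q.1] contribute nothing to D there, so the affine piece that starts
     at [lo] still gives the value. *)
  have -> : D q.1 = c0 * q.1 - (b1 + moment 1 L lo).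
    have E : moment 0 L q.1 * q.1 - moment 1 L q.1
        = moment 0 L lo * q.1 - moment 1 L lo.
      rewrite /moment !mulr_suml -!sumrB.
      rewrite big_seq_cond [RHS]big_seq_cond.
      rewrite (bigID (fun a : R * R => a.1 <= lo)) /=.
      rewrite [X in _ + X]big1 ?addr0.
        by apply: eq_bigl => a; rewrite -andbA; congr (_ && _); lra.
      move=> a /andP[/andP[aL leaq] nle].
      have -> : a.1 = q.1.
        by apply/eqP; rewrite eq_le leaq qmin // ltNge.
      ring.
    by rewrite /D /c0; lra.
  by rewrite -Ez subr_le0 ler_pM2l.
have Em := eq_moment lelo hz.
split=> //; rewrite /D !Em -/c0 Ez subrr //.
Qed.

End Root.

End Hinges.

(** * Balanced trees of hinges *)

Section Trees.
Variable R : realFieldType.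
Implicit Types (p e x z g : R).

Inductive tree : Type := Leaf | Node of tree & R & R & tree.
Implicit Types (T l r : tree).

Fixpoint height T : nat :=
  if T is Node l _ _ r then (maxn (height l) (height r)).+1 else 0.

Fixpoint points T : seq (R * R) :=
  if T is Node l p e r then points l ++ (p, e) :: points r else [::].

Fixpoint translate g T : tree :=
  if T is Node l p e r then Node (translate g l) (p + g) e (translate g r) else Leaf.

(** The single and double rotations of AVL trees. Inside an unbalanced case, the branches that
    return [Node l p e r] cannot occur: the taller subtree is not empty, and neither is an inner
    grandchild taller than the outer one. *)
Definition balance l p e r : tree :=
  if ((height r).+1 < height l)%N then
    if l is Node a q f b then
      if (height b <= height a)%N then Node a q f (Node b p e r)
      else if b is Node b1 q' f' b2 then
        Node (Node a q f b1) q' f' (Node b2 p e r)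
      else Node l p e r
    else Node l p e r
  else if ((height l).+1 < height r)%N then
    if r is Node b q f a then
      if (height b <= height a)%N then Node (Node l p e b) q f a
      else if b is Node b1 q' f' b2 then
        Node (Node l p e b1) q' f' (Node b2 q f a)
      else Node l p e r
    else Node l p e r
  else Node l p e r.

(** The threshold [z] is kept apart from the position [p], because the hinge at z + g also goes
    right after the points at most z, while the points beyond are shifted by [g] in the same
    descent. *)
Fixpoint insert z p e g T : tree :=
  if T is Node l q f r then
    if q <= z then balance l q f (insert z p e g r)
    else balance (insert z p e g l) (q + g) f (translate g r)
  else Node Leaf p e Leaf.

Lemma points_translate g T : points (translate g T) = [seq (b.1 + g, b.2) | b <- points T].
Proof. by elim: T => //= l -> p e r ->; rewrite map_cat. Qed.

Lemma height_translate g T : height (translate g T) = height T.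
Proof. by elim: T => //= l -> p e r ->. Qed.

Lemma points_balance l p e r :
  points (balance l p e r) = points l ++ (p, e) :: points r.
Proof.
rewrite /balance; case: ifP => _.
  case: l => //= a q f b; case: ifP => _ /=; first by rewrite -catA.
  by case: b => //= b1 q' f' b2; rewrite -!catA /= -!catA.
case: ifP => _ //; case: r => //= b q f a; case: ifP => _ /=; first by rewrite -catA.
by case: b => //= b1 q' f' b2; rewrite -!catA.
Qed.

Fixpoint avl T : bool :=
  if T is Node l _ _ r then
    [&& (height l <= (height r).+1)%N, (height r <= (height l).+1)%N, avl l & avl r]
  else true.

Lemma avl_translate g T : avl (translate g T) = avl T.
Proof. by elim: T => //= l -> p e r ->; rewrite !height_translate. Qed.

Lemma avl_balance l p e r : avl l -> avl r ->
  (height l <= (height r).+2)%N -> (height r <= (height l).+2)%N ->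
  avl (balance l p e r) /\
  (maxn (height l) (height r) <= height (balance l p e r)
    <= (maxn (height l) (height r)).+1)%N.
Proof.
rewrite /balance => al ar lr rl; case: ifP => [h1|].
  case: l al lr rl h1 => //= a q f b /and4P[h2 h3 aa ab].
  case: ifP => [h4|/negbT].
    by rewrite /= aa ab ar => *; split; lia.
  case: b h2 h3 ab => [|b1 q' f' b2] /=; first by lia.
  by move=> h2 h3 /and4P[h4 h5 ab1 ab2]; rewrite /= aa ab1 ab2 ar => *; split; lia.
move/negbT => h0; case: ifP => [h1|/negbT h1] /=; last first.
  by rewrite al ar; split; lia.
case: r ar lr rl h0 h1 => //= b q f a /and4P[h2 h3 ab aa].
case: ifP => [h4|/negbT].
  by rewrite /= aa ab al => *; split; lia.
case: b h2 h3 ab => [|b1 q' f' b2] /=; first by lia.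
by move=> h2 h3 /and4P[h4 h5 ab1 ab2]; rewrite /= aa ab1 ab2 al => *; split; lia.
Qed.

Lemma balance_id l p e r : (height l <= (height r).+1)%N ->
  (height r <= (height l).+1)%N -> balance l p e r = Node l p e r.
Proof. by move=> h1 h2; rewrite /balance !ltnNge h1 h2. Qed.

Lemma avl_insert z p e g T : avl T ->
  avl (insert z p e g T) /\
  (height T <= height (insert z p e g T) <= (height T).+1)%N.
Proof.
elim: T => //= l IHl q f r IHr /and4P[h1 h2 al ar]; case: ifP => _.
  have [a1 /andP[h3 h4]] := IHr ar.
  have [||a2 /andP[h5 h6]] := avl_balance q f al a1; [lia|lia|].
  split=> //; case: (leqP (height (insert z p e g r)) (height l).+1) => h7.
    by rewrite balance_id //=; lia.
  by lia.
have [a1 /andP[h3 h4]] := IHl al.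
have a2 : avl (translate g r) by rewrite avl_translate.
have [||a3 /andP[]] := avl_balance (q + g) f a1 a2; rewrite ?height_translate; [lia|lia|].
move=> h5 h6; split=> //.
case: (leqP (height (insert z p e g l)) (height r).+1) => h7.
  by rewrite balance_id /= ?height_translate //; lia.
by lia.
Qed.

(** Both subtrees of a balanced tree of height h have height at least h - 2, so the bound doubles
    every two levels. The sharper Fibonacci bound would only improve the constant. *)
Lemma avl_size T : avl T -> (2 ^ (height T)./2 <= (size (points T)).+1)%N.
Proof.
elim: T => //= l IHl p e r IHr /and4P[h1 h2 /IHl il /IHr ir].
rewrite size_cat /=.
set h := maxn _ _; case Eh : h => [|h'] //=.
have le1 (k : nat) : (h' <= k)%N -> (2 ^ h'./2 <= 2 ^ k./2)%N.
  by move=> lek; rewrite leq_pexp2l // half_leq.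
have := le1 (height l); have := le1 (height r).
have -> : (2 ^ (h'./2).+1 = 2 ^ h'./2 + 2 ^ h'./2)%N by rewrite expnS; lia.
by lia.
Qed.

Definition sorted_pts (L : seq (R * R)) :=
  pairwise (fun a b : R * R => a.1 <= b.1) L.

Lemma sorted_node l p e r : sorted_pts (points (Node l p e r)) ->
  [/\ sorted_pts (points l), sorted_pts (points r),
      {in points l, forall b, b.1 <= p} & {in points r, forall b, p <= b.1}].
Proof.
rewrite /sorted_pts /= pairwise_cat /= => /and3P[/allrelP h sl /andP[/allP hr sr]].
by split=> // b bl; exact: (h b (p, e) bl (mem_head _ _)).
Qed.

Lemma points_insert z p e g T : sorted_pts (points T) ->
  points (insert z p e g T) =
  [seq b <- points T | b.1 <= z] ++
  (p, e) :: [seq (b.1 + g, b.2) | b <- points T & z < b.1].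
Proof.
elim: T => //= l IHl q f r IHr /sorted_node[sl sr hl hr].
rewrite !filter_cat /= ltNge; case: ifP => [leqz|/negbT]; rewrite points_balance.
  have -> : [seq b <- points l | b.1 <= z] = points l.
    by apply/all_filterP/allP => b /hl h; exact: le_trans h leqz.
  have -> : [seq b <- points l | z < b.1] = [::].
    rewrite -(filter_pred0 (points l)); apply: eq_in_filter => b /hl h.
    by apply/negbTE; rewrite -leNgt; exact: le_trans h leqz.
  by rewrite IHr //= -catA.
rewrite -ltNge => ltzq.
have -> : [seq b <- points r | b.1 <= z] = [::].
  rewrite -(filter_pred0 (points r)); apply: eq_in_filter => b /hr h.
  by apply/negbTE; rewrite -ltNge; exact: lt_le_trans ltzq h.
have -> : [seq b <- points r | z < b.1] = points r.
  by apply/all_filterP/allP => b /hr h; exact: lt_le_trans ltzq h.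
by rewrite IHl //= cats0 points_translate map_cat /= -catA.
Qed.

Lemma sorted_hinge_insert z g e L : 0 <= g -> sorted_pts L ->
  sorted_pts (hinge_insert z g e L).
Proof.
move=> g0 sL; rewrite /sorted_pts /hinge_insert pairwise_cat /= -/(sorted_pts _).
apply/and4P; split.
- apply/allrelP => a b; rewrite mem_filter => /andP[leaz _].
  rewrite !inE => /or3P[/eqP->|/eqP->|/mapP[d + ->]] //=; first by lra.
  by rewrite mem_filter => /andP[ltd _] /=; lra.
- by rewrite /sorted_pts pairwise_filter.
- rewrite lerDl g0 /=; apply/allP => b /mapP[d + ->] /=.
  by rewrite mem_filter => /andP[ltd _]; lra.
apply/andP; split.
  by apply/allP => b /mapP[d + ->] /=; rewrite mem_filter => /andP[ltd _]; lra.
rewrite pairwise_map; apply: sub_pairwise (pairwise_filter _ sL) => a b /=.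
by rewrite lerD2r.
Qed.

(** The shift is left to the second insertion, where the point just placed at [z] counts among those
    at most [z] and does not move. *)
Definition insert_hinge z g e T : tree := insert z (z + g) e g (insert z z (- e) 0 T).

Lemma points_insert_hinge z g e T : 0 <= g -> sorted_pts (points T) ->
  points (insert_hinge z g e T) = hinge_insert z g e (points T).
Proof.
move=> g0 sT; rewrite /insert_hinge /hinge_insert.
have E1 : points (insert z z (- e) 0 T) = [seq b <- points T | b.1 <= z] ++
    (z, - e) :: [seq b <- points T | z < b.1].
  rewrite points_insert //; congr (_ ++ _ :: _).
  by rewrite -[RHS]map_id; apply: eq_map => -[a b] /=; rewrite addr0.
have sT1 : sorted_pts (points (insert z z (- e) 0 T)).
  rewrite E1 /sorted_pts pairwise_cat /= !pairwise_filter // !andbT.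
  apply/andP; split.
    apply/allrelP => a b; rewrite mem_filter => /andP[leaz _].
    by rewrite inE mem_filter => /predU1P[->//|/andP[/ltW h _]]; exact: le_trans leaz h.
  by apply/allP => b; rewrite mem_filter => /andP[/ltW].
rewrite points_insert // E1 !filter_cat /= lexx ltxx -!filter_predI.
rewrite -catA; congr (_ ++ _).
  by apply: eq_filter => b /=; rewrite andbb.
have -> : [seq b <- points T | predI (fun b => b.1 <= z) (fun b : R * R => z < b.1) b] = [::].
  rewrite -(filter_pred0 (points T)); apply: eq_filter => b /=.
  by rewrite ltNge andbN.
have -> : [seq b <- points T | predI (fun b => z < b.1) (fun b : R * R => b.1 <= z) b] = [::].
  rewrite -(filter_pred0 (points T)); apply: eq_filter => b /=.
  by rewrite ltNge andNb.
rewrite /=; congr [:: _, _ & map _ _].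
by apply: eq_filter => b /=; rewrite andbb.
Qed.

Definition sums (j : nat) T : R := \sum_(b <- points T) b.2 * b.1 ^+ j.

Lemma sums_node j l p e r : sums j (Node l p e r) = sums j l + e * p ^+ j + sums j r.
Proof. by rewrite /sums /= big_cat big_cons /= addrA. Qed.

(** A moment read along one branch: left subtrees enter as a whole, through sums that the nodes
    store in memory. *)
Fixpoint prefix_sum (j : nat) x T : R :=
  if T is Node l p e r then
    if p <= x then sums j l + e * p ^+ j + prefix_sum j x r
    else prefix_sum j x l
  else 0.

Lemma prefix_sumE j x T : sorted_pts (points T) ->
  prefix_sum j x T = moment j (points T) x.
Proof.
elim: T => [|l IHl p e r IHr] /=; first by rewrite /moment big_nil.
move=> /sorted_node[sl sr hl hr]; rewrite moment_cat /moment big_cons /= -!/(moment _ _ _).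
case: ifP => [lepx|/negbT]; last rewrite -ltNge => ltxp.
  rewrite IHr // -addrA; congr (_ + _).
  rewrite /sums /moment big_seq [RHS]big_seq_cond; apply: eq_bigl => b.
  by case: (boolP (b \in points l)) => //= /hl h; rewrite (le_trans h lepx).
rewrite IHl // [X in _ = _ + X](_ : _ = 0) ?addr0 //.
rewrite /moment big_seq_cond big_pred0 // => b.
apply/negbTE/negP => /andP[/hr h1 h2].
by have := lt_le_trans ltxp (le_trans h1 h2); rewrite ltxx.
Qed.

(** [lo] is a running maximum of points where [P] holds. Comparing it with [p] matters for the
    second tree, whose search starts from the result of the first. *)
Fixpoint search (P : R -> bool) T lo : R :=
  if T is Node l p _ r then
    if P p then search P r (if lo <= p then p else lo) else search P l lo
  else lo.

Lemma search_correct (P : R -> bool) T lo : sorted_pts (points T) ->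
  (forall x y, x <= y -> P y -> P x) -> P lo ->
  [/\ lo <= search P T lo, P (search P T lo) &
      {in points T, forall b, search P T lo < b.1 -> ~~ P b.1}].
Proof.
move=> + mono; elim: T lo => [|l IHl p e r IHr] lo; first by split.
rewrite [search _ _ _]/= [points _]/=.
move=> /sorted_node[sl sr hl hr] Plo; case: ifP => [Pp|nPp].
  set lo' := if _ then _ else _.
  have lelo : lo <= lo' by rewrite /lo'; case: ifP.
  have lepo : p <= lo' by rewrite /lo'; case: (leP lo p) => // /ltW.
  have [|h1 h2 h3] := IHr lo' sr; first by rewrite /lo'; case: ifP.
  split=> //; first exact: le_trans h1.
  move=> b; rewrite mem_cat inE => /or3P[bl|/eqP->|br] ltb; last exact: h3.
  - have := le_trans (hl _ bl) (le_trans lepo h1).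
    by rewrite leNgt ltb.
  - by have := le_trans lepo h1; rewrite leNgt ltb.
have [h1 h2 h3] := IHl lo sl Plo; split=> //.
move=> b; rewrite mem_cat inE => /or3P[bl|/eqP->|br] ltb; first exact: h3.
  by rewrite /= nPp.
by apply/negP => /(mono _ _ (hr _ br)); rewrite nPp.
Qed.

Lemma size_insert_hinge z g e T : 0 <= g -> sorted_pts (points T) ->
  size (points (insert_hinge z g e T)) = (size (points T)).+2.
Proof.
move=> g0 sT; rewrite points_insert_hinge // /hinge_insert size_cat /= size_map !size_filter.
rewrite !addnS; congr _.+2.
rewrite -(count_predC (fun b : R * R => b.1 <= z) (points T)); congr (_ + _)%N.
by apply: eq_count => b /=; rewrite ltNge.
Qed.

End Trees.
Arguments Leaf {R}.

(** * The minimizers and the optimal peak *)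

Section RootFinding.
Variable R : realFieldType.
Implicit Types (g b x z : R) (T : tree R).

Definition accum j b T1 T2 x : R := b + prefix_sum j x T1 + prefix_sum j x T2.

Definition below b0 b1 T1 T2 x : bool :=
  accum 0 b0 T1 T2 x * x <= accum 1 b1 T1 T2 x.

(** The start b1 / b0 is the mean of the targets, where the slope is nonpositive. After both
    searches, no hinge of either tree above the result has a nonpositive slope, as [moment_root]
    requires. *)
Definition lower b0 b1 T1 T2 : R :=
  search (below b0 b1 T1 T2) T2 (search (below b0 b1 T1 T2) T1 (b1 / b0)).

Definition minimizer b0 b1 T1 T2 : R :=
  let x := lower b0 b1 T1 T2 in accum 1 b1 T1 T2 x / accum 0 b0 T1 T2 x.

Section Trees.
Variables (g : R) (u : nat -> R).

(** The base sums run up to [k] while the tree has index k - 1, since F_(k-1) already includes the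
    square of u_(k-1). *)
Fixpoint trees k : tree R :=
  if k is k'.+1 then
    let b0 := base u 0 k in let b1 := base u 1 k in let T := trees k' in
    insert_hinge (minimizer b0 b1 T Leaf) g (accum 0 b0 T Leaf (lower b0 b1 T Leaf)) T
  else Leaf.

Definition minimizers k : R := minimizer (base u 0 k.+1) (base u 1 k.+1) (trees k) Leaf.

End Trees.

(** Two chains meet at a vertex of target v; a single chain is the case k' = 0 with an empty second
    tree. With c0, c1, c2 the coefficients at the zero, c0 z = c1 reduces c0 z^2 - 2 c1 z + c2 to c2
    - c1 z, which is the last equation. *)
Lemma root_correct g u m k u' m' k' v T1 T2 (b : nat -> R) :
    0 <= g -> sorted_pts (points T1) -> sorted_pts (points T2) ->
    represents g u m k (points T1) -> represents g u' m' k' (points T2) ->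
    roots_below g u m k -> roots_below g u' m' k' ->
    (forall j, b j = base u j k + v ^+ j + base u' j k') ->
  let x := lower (b 0) (b 1) T1 T2 in
  let z := minimizer (b 0) (b 1) T1 T2 in
  [/\ slope_to g u m k z + slope_to g u' m' k' z + (z - v) = 0,
      forall j, moment j (points T1 ++ points T2) z = prefix_sum j x T1 + prefix_sum j x T2 &
      accum 2 (b 2) T1 T2 x - accum 1 (b 1) T1 T2 x * z
      = cost_to g u m k z + cost_to g u' m' k' z + (z - v) ^+ 2].
Proof.
move=> g0 s1 s2 r1 r2 h1 h2 Eb x z.
pose L := points T1 ++ points T2.
pose D y := (b 0 + moment 0 L y) * y - (b 1 + moment 1 L y).
have Et j y : accum j (b j) T1 T2 y = b j + moment j L y.
  by rewrite /accum !prefix_sumE // moment_cat addrA.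
have DE y : D y = slope_to g u m k y + slope_to g u' m' k' y + (y - v).
  have [-> _] := r1 y; have [-> _] := r2 y.
  by rewrite /D !Eb /L !moment_cat; ring.
have Dmono y y' : y <= y' -> y' - y <= D y' - D y.
  move=> le; rewrite !DE; have := slope_to_mono g0 h1 le.
  by have := slope_to_mono g0 h2 le; lra.
have base01 (w : nat -> R) y l : \sum_(j < l) (y - w j) = base w 0 l * y - base w 1 l.
  rewrite sumrB /base; congr (_ - _).
  by rewrite mulr_suml; apply: eq_bigr => i _; rewrite expr0 mul1r.
have base0 (w : nat -> R) l : 0 <= base w 0 l.
  by apply: sumr_ge0 => i _; rewrite expr0.
have b0 : 0 < b 0 by rewrite Eb expr0; have := base0 u k; have := base0 u' k'; lra.
have Dle y : D y <= b 0 * y - b 1.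
  have := slope_to_le g0 y h1; have := slope_to_le g0 y h2.
  by rewrite DE !base01 !Eb; lra.
have bE y : below (b 0) (b 1) T1 T2 y = (D y <= 0).
  by rewrite /below !Et /D subr_le0.
have Pmono y y' : y <= y' -> below (b 0) (b 1) T1 T2 y' -> below (b 0) (b 1) T1 T2 y.
  by rewrite !bE => le; have := Dmono _ _ le; lra.
have P0 : below (b 0) (b 1) T1 T2 (b 1 / b 0).
  by rewrite bE; apply: le_trans (Dle _) _; rewrite mulrC divfK ?gt_eqF // subrr.
have [_ P1 A1] := search_correct s1 Pmono P0.
have [le2 P2 A2] := search_correct s2 Pmono P1.
rewrite -/x -/(lower _ _ _ _) in le2 P2 A2.
have A : {in L, forall a, x < a.1 -> 0 < D a.1}.
  move=> a; rewrite mem_cat => /orP[/A1|/A2] h lt; rewrite ltNge -bE; apply: h => //.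
  exact: le_lt_trans lt.
have Dx : D x <= 0 by rewrite -bE.
have [c0 + Em] := moment_root Dmono Dx A.
have -> : (b 1 + moment 1 L x) / (b 0 + moment 0 L x) = z by rewrite /z /minimizer !Et.
rewrite -/(D z) => Dz.
have Ez : (b 1 + moment 1 L x) / (b 0 + moment 0 L x) = z by rewrite /z /minimizer !Et.
rewrite Ez in Em.
split; first by rewrite -DE.
  by move=> j; rewrite -/L Em /L moment_cat !prefix_sumE.
have [_ ->] := r1 z; have [_ ->] := r2 z.
have Dzz : D z * z = 0 by rewrite Dz mul0r.
rewrite !Et -!Em /L !moment_cat; move: Dzz; rewrite /D /L !moment_cat !Eb; lra.
Qed.

(** One joint induction: m_k is a zero of the slope because the tree represents A_k, and the next
    tree represents A_(k+1) because m_k is such a zero. *)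
Lemma trees_correct g u k : 0 <= g ->
  [/\ sorted_pts (points (trees g u k)), avl (trees g u k),
      size (points (trees g u k)) = k.*2,
      represents g u (minimizers g u) k (points (trees g u k)) &
      roots_below g u (minimizers g u) k.+1].
Proof.
move=> g0.
have next l : sorted_pts (points (trees g u l)) ->
    represents g u (minimizers g u) l (points (trees g u l)) ->
    roots_below g u (minimizers g u) l ->
    slope_to g u (minimizers g u) l (minimizers g u l) + (minimizers g u l - u l) = 0 /\
    forall j, moment j (points (trees g u l)) (minimizers g u l) =
      prefix_sum j (lower (base u 0 l.+1) (base u 1 l.+1) (trees g u l) Leaf) (trees g u l).
  move=> sl rl hl.
  have nil0 : represents g u (minimizers g u) 0 (points (@Leaf R)) by exact: represents_nil.
  have hnil : roots_below g u (minimizers g u) 0 by [].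
  have [] := @root_correct g u (minimizers g u) l u (minimizers g u) 0 (u l) (trees g u l)
    Leaf (base u ^~ l.+1) g0 sl isT rl nil0 hl hnil.
    by move=> j; rewrite baseS /base big_ord0 addr0.
  rewrite /= addr0 -/(minimizers g u l) => E1 E2 _; split=> // j.
  by have := E2 j; rewrite cats0 addr0.
elim: k => [|k [sk ak zk rk hk]].
  have s0 : sorted_pts (points (trees g u 0)) by [].
  have r0 : represents g u (minimizers g u) 0 (points (trees g u 0)) by exact: represents_nil.
  have h0 : roots_below g u (minimizers g u) 0 by [].
  by split=> // j; rewrite ltnS leqn0 => /eqP->; have [] := next 0%N s0 r0 h0.
have [Ek Mk] := next k sk rk (roots_belowW hk).
have -> : trees g u k.+1 = insert_hinge (minimizers g u k) g
    (base u 0 k.+1 + moment 0 (points (trees g u k)) (minimizers g u k)) (trees g u k).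
  by rewrite Mk /= /accum /= addr0.
set c0 := _ + moment _ _ _; set T' := insert_hinge _ _ _ _.
have sk' : sorted_pts (points T').
  by rewrite /T' points_insert_hinge //; exact: sorted_hinge_insert.
have rk' : represents g u (minimizers g u) k.+1 (points T').
  rewrite /T' points_insert_hinge //; apply: represents_step => //.
  have [E _] := rk (minimizers g u k); move: Ek; rewrite E /c0 !baseS; lra.
split=> //.
- by rewrite /T' /insert_hinge; do 2 apply: (avl_insert _ _ _ _ _).1.
- by rewrite /T' size_insert_hinge // zk.
have ET : trees g u k.+1 = T' by rewrite /T' /c0 Mk /= /accum /= addr0.
move=> j; rewrite ltnS leq_eqVlt => /predU1P[->|]; last exact: hk.
by have [] := next k.+1; rewrite ?ET.
Qed.

End RootFinding.

(** * Optimality of the traced functions and of the best peak *)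

Section Optimality.
Variables (R : realType) (n : nat) (t : 'I_n -> R) (g : R).
Hypothesis g_ge0 : 0 <= g.

(** The same expression as the content of real bank 0 in the input, including the value 0 beyond the
    path. *)
Definition target (j : nat) : R := oapp t 0 (insub j).
Definition target_rev (j : nat) : R := target (n.-1 - j).

(** The square of the peak itself belongs to neither tree; it enters through the base sums, which
    run over all n vertices. *)
Definition peak_value (i : nat) : R :=
  minimizer (base target 0 n) (base target 1 n)
    (trees g target i) (trees g target_rev (n.-1 - i)).

Definition peak_cost (i : nat) : R :=
  cost_to g target (minimizers g target) i (peak_value i)
  + cost_to g target_rev (minimizers g target_rev) (n.-1 - i) (peak_value i)
  + (peak_value i - target i) ^+ 2.

(** The values are determined outwards from the peak. On the right, vertex j + 1 has position n - 1
    - (j + 1) on the reversed path. *)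
Definition traced (i : nat) (s : nat -> R) : Prop :=
  [/\ s i = peak_value i,
      forall j, (j < i)%N -> s j = clamp g (minimizers g target j) (s j.+1) &
      forall j, (i <= j)%N -> (j.+1 < n)%N ->
        s j.+1 = clamp g (minimizers g target_rev (n.-1 - j.+1)) (s j)].

Lemma traced_exists i : exists s, traced i s.
Proof.
(* Both sides are defined by recursion on the distance [d] from the peak. *)
pose left := fix f d : R := if d is d'.+1
  then clamp g (minimizers g target (i - d)) (f d') else peak_value i.
pose right := fix f d : R := if d is d'.+1
  then clamp g (minimizers g target_rev (n.-1 - (i + d))) (f d') else peak_value i.
exists (fun j => if (j <= i)%N then left (i - j)%N else right (j - i)%N).
split=> [|j ltji|j leij ltj]; first by rewrite leqnn subnn.
  rewrite ltji (ltnW ltji) (_ : (i - j = (i - j.+1).+1)%N); last by lia.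
  by rewrite /= (_ : (i - (i - j.+1).+1 = j)%N) //; lia.
rewrite ltnNge leij /= (_ : (j.+1 - i = (j - i).+1)%N); last by lia.
rewrite /= (_ : (i + (j - i).+1 = j.+1)%N); last by lia.
case: ifP => // le; have -> : j = i by lia.
by rewrite subnn.
Qed.

Lemma sum_split (F : nat -> R) i : (i < n)%N ->
  \sum_(v < n) F v = \sum_(j < i) F j + F i + \sum_(j < n.-1 - i) F (n.-1 - j)%N.
Proof.
move=> ltin; rewrite -(big_mkord xpredT F) (@big_cat_nat _ _ _ i) //=; last exact: ltnW.
rewrite big_mkord (@big_ltn _ _ _ i n) // addrA; congr (_ + _).
rewrite big_nat_rev /= -{1}(add0n i.+1) big_addn big_mkord.
by rewrite (_ : (n - i.+1 = n.-1 - i)%N); [apply: eq_bigr => j _; congr F; lia|lia].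
Qed.

Lemma targetE (v : 'I_n) : target v = t v.
Proof. by rewrite /target valK. Qed.

Lemma peak_correct i : (i < n)%N ->
  slope_to g target (minimizers g target) i (peak_value i)
  + slope_to g target_rev (minimizers g target_rev) (n.-1 - i) (peak_value i)
  + (peak_value i - target i) = 0 /\
  let T1 := trees g target i in let T2 := trees g target_rev (n.-1 - i) in
  let x := lower (base target 0 n) (base target 1 n) T1 T2 in
  accum 2 (base target 2 n) T1 T2 x - accum 1 (base target 1 n) T1 T2 x * peak_value i
  = peak_cost i.
Proof.
move=> ltin.
have [s1 _ _ r1 /roots_belowW h1] := trees_correct target i g_ge0.
have [s2 _ _ r2 /roots_belowW h2] := trees_correct target_rev (n.-1 - i) g_ge0.
have [] := root_correct (v := target i) (b := base target ^~ n) g_ge0 s1 s2 r1 r2 h1 h2.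
  by move=> j; rewrite [LHS](sum_split (fun v => target v ^+ j) ltin).
by move=> E1 _ E2.
Qed.

Lemma traced_cost i s : (i < n)%N -> traced i s ->
  sqerr t (fun v => s v) = peak_cost i.
Proof.
move=> ltin [si sl sr]; rewrite /sqerr.
under eq_bigr do rewrite -targetE.
rewrite (sum_split (fun v => (s v - target v) ^+ 2) ltin) /peak_cost -si.
rewrite -(cost_to_trace target sl) -addrA [X in _ + X]addrC addrA; congr (_ + _ + _).
have := @cost_to_trace _ g target_rev (minimizers g target_rev)
  (fun j => s (n.-1 - j)%N) (n.-1 - i)%N.
rewrite subKn; last by lia.
move=> -> // j ltj; have := sr (n.-1 - j.+1)%N.
have -> : ((n.-1 - j.+1).+1 = n.-1 - j)%N by lia.
rewrite (_ : (n.-1 - (n.-1 - j) = j)%N); last by lia.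
by apply; lia.
Qed.

Lemma traced_lipschitz i s (lt : (i < n)%N) : traced i s ->
  lipschitz_isotonic (path_towards (Ordinal lt)) g (fun v : 'I_n => s v).
Proof.
move=> [si sl sr] u w /=; rewrite /path_towards /= => /orP[] /andP[lt1 /eqP E].
  rewrite E (sl _ lt1); have := clamp_itv (minimizers g target) g_ge0 u (s u.+1); lra.
have ltw : (w.+1 < n)%N by rewrite E.
rewrite -E sr //; last by lia.
have := clamp_itv (minimizers g target_rev) g_ge0 (n.-1 - w.+1) (s w).
rewrite E; lra.
Qed.

(** Each side costs at least its chain cost at s_i, by [cost_to_le]. In the subgradient inequalities
    at [peak_value], added to the expansion of the peak term, the linear terms cancel because the
    slopes sum to zero. *)
Lemma peak_cost_le i s (lt : (i < n)%N) :
  lipschitz_isotonic (path_towards (Ordinal lt)) g s -> peak_cost i <= sqerr t s.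
Proof.
move=> hs; pose s' (j : nat) : R := oapp s 0 (insub j).
have s'E (v : 'I_n) : s' v = s v by rewrite /s' valK.
have arc j k : (j < n)%N -> (k < n)%N -> [|| (j < i)%N && (k == j.+1) | (i < j)%N && (k.+1 == j)] ->
    s' j <= s' k <= s' j + g.
  move=> ltj ltk h; rewrite -[j]/(nat_of_ord (Ordinal ltj)) -[k]/(nat_of_ord (Ordinal ltk)).
  by rewrite !s'E; apply: hs.
have -> : sqerr t s = \sum_(v < n) (s' v - target v) ^+ 2.
  by apply: eq_bigr => v _; rewrite s'E targetE.
rewrite (sum_split (fun v => (s' v - target v) ^+ 2) lt).
have [_ _ _ _ /roots_belowW h1] := trees_correct target i g_ge0.
have [_ _ _ _ /roots_belowW h2] := trees_correct target_rev (n.-1 - i) g_ge0.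
have le1 : cost_to g target (minimizers g target) i (s' i)
    <= \sum_(j < i) (s' j - target j) ^+ 2.
  by apply: cost_to_le => // j ltj; apply: arc; lia.
have le2 : cost_to g target_rev (minimizers g target_rev) (n.-1 - i) (s' i)
    <= \sum_(j < n.-1 - i) (s' (n.-1 - j)%N - target (n.-1 - j)%N) ^+ 2.
  have := @cost_to_le _ g target_rev (minimizers g target_rev) g_ge0
    (fun j => s' (n.-1 - j)%N) (n.-1 - i)%N h2.
  rewrite subKn; last by lia.
  by apply=> j ltj; apply: arc; lia.
have [root0 _] := peak_correct lt.
have sg1 := cost_to_subgradient g_ge0 (peak_value i) (s' i) h1.
have sg2 := cost_to_subgradient g_ge0 (peak_value i) (s' i) h2.
apply: le_trans (lerD (lerD le1 (lexx _)) le2); rewrite /peak_cost.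
move: root0 sg1 sg2; set z := peak_value i; set y := s' i.
set d1 := slope_to _ _ _ _ _; set d2 := slope_to _ _ _ _ _ => root0 sg1 sg2.
have -> : (y - target i) ^+ 2 = (z - target i) ^+ 2
  + 2 * (z - target i) * (y - z) + (y - z) ^+ 2 by ring.
have : (d1 + d2 + (z - target i)) * (y - z) = 0 by rewrite root0 mul0r.
have := sqr_ge0 (y - z); lra.
Qed.

(** A regression asks for a minimizer for every i, while the program produces one function only. The
    others are supplied by choice; all that is needed of them is their cost. *)
Lemma traced_regression k s (ltk : (k < n)%N) : traced k s ->
  (forall i, (i < n)%N -> peak_cost k <= peak_cost i) ->
  unimodal_regression g t (fun v => s v).
Proof.
move=> trs kmin; have [f hf] := choice (fun i : nat => traced_exists i).
pose S (i : nat) := if i == k then s else f i.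
have hS i : traced i (S i) by rewrite /S; case: eqP => [->|].
exists (fun i v : 'I_n => S i v), (Ordinal ltk); split.
- move=> i; have e : i = Ordinal (ltn_ord i) by exact: val_inj.
  rewrite [X in path_towards X]e; split; first exact: traced_lipschitz.
  by move=> y /peak_cost_le; rewrite (traced_cost (ltn_ord i) (hS i)).
- split=> // i _; rewrite !(traced_cost _ (hS _)) //; exact: kmin.
- by rewrite /S /= eqxx.
Qed.

End Optimality.

(** * Trees in memory *)

(* Heap: the node at address q, 0 < q < HP, has children LP q and RP q, height
   HT q, and a hinge of weight EE q at PP q; Sj q is the sum of e p^j over its
   subtree.  Positions under LP q are relative to LO q and those under RP q to
   RO q, so that a subtree is shifted without copying it and versions share
   subtrees.  Address 0 is the empty tree. *)
Notation HP := 1%N (only parsing).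
Notation RES := 2%N (only parsing).
Notation AL := 3%N (only parsing).
Notation AR := 4%N (only parsing).
Notation LP := 10%N (only parsing).
Notation RP := 11%N (only parsing).
Notation HT := 12%N (only parsing).

Notation ALO := 3%N (only parsing).
Notation ARO := 4%N (only parsing).
Notation AP := 5%N (only parsing).
Notation AE := 6%N (only parsing).
Notation PP := 10%N (only parsing).
Notation EE := 11%N (only parsing).
Notation LO := 12%N (only parsing).
Notation RO := 13%N (only parsing).
Notation S0 := 14%N (only parsing).
Notation S1 := 15%N (only parsing).
Notation S2 := 16%N (only parsing).

(** The moments of the subtree at [q] moved by [o], expanded binomially. The term 2 o S1 appears as
    two equal terms, which avoids the literal 2. *)
Definition sum0 q := RGet S0 q.
Definition sum1 q o := RAdd (RGet S1 q) (RMul o (RGet S0 q)).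
Definition sum2 q o := RAdd (RAdd (RGet S2 q) (RMul o (RGet S1 q)))
  (RAdd (RMul o (RGet S1 q)) (RMul (RMul o o) (RGet S0 q))).

(** The maximum of the heights a and b is written a + (b - a) with truncated subtraction. The new
    node has offset 0, the offsets of its children being stored in it. *)
Definition mk_node : cmd :=
  CWSet LP (wr HP) (wr AL) ;;
  CWSet RP (wr HP) (wr AR) ;;
  CRSet LO (wr HP) (rr ALO) ;;
  CRSet RO (wr HP) (rr ARO) ;;
  CRSet PP (wr HP) (rr AP) ;;
  CRSet EE (wr HP) (rr AE) ;;
  CWSet HT (wr HP) (WAdd (WAdd (WGet HT (wr AL))
    (WSub (WGet HT (wr AR)) (WGet HT (wr AL)))) (WLit 1)) ;;
  CRSet S2 (wr HP) (RAdd (RAdd (sum2 (wr AL) (rr ALO))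
    (RMul (rr AE) (RMul (rr AP) (rr AP)))) (sum2 (wr AR) (rr ARO))) ;;
  CRSet S1 (wr HP) (RAdd (RAdd (sum1 (wr AL) (rr ALO))
    (RMul (rr AE) (rr AP))) (sum1 (wr AR) (rr ARO))) ;;
  CRSet S0 (wr HP) (RAdd (RAdd (sum0 (wr AL)) (rr AE)) (sum0 (wr AR))) ;;
  setw RES (wr HP) ;;
  setw HP (WAdd (wr HP) (WLit 1)).

Definition mk_with l lo p e r ro : cmd :=
  setw AL l ;; setr ALO lo ;; setr AP p ;; setr AE e ;; setw AR r ;;
  setr ARO ro ;; mk_node.

Notation BL := 8%N (only parsing).
Notation BR := 9%N (only parsing).
Notation INNER := 13%N (only parsing).
Notation SAVED := 14%N (only parsing).
Notation BLO := 8%N (only parsing).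
Notation BRO := 9%N (only parsing).
Notation INNER_OFF := 17%N (only parsing).
Notation BP := 18%N (only parsing).
Notation BE := 19%N (only parsing).

Definition left_of q := WGet LP q.
Definition right_of q := WGet RP q.
Definition left_off q o := RAdd o (RGet LO q).
Definition right_off q o := RAdd o (RGet RO q).
Definition point_of q o := RAdd (RGet PP q) o.

(** A rotation allocates two or three new nodes and alters none. [SAVED] keeps the first half of a
    double rotation while [RES] receives the second. *)
Definition rotate_right : cmd :=
  (setw INNER (right_of (wr BL)) ;;
  setr INNER_OFF (right_off (wr BL) (rr BLO))) ;;
  CIf (BWordLe (WGet HT (wr INNER)) (WGet HT (left_of (wr BL))))
    (mk_with (wr INNER) (rr INNER_OFF) (rr BP) (rr BE) (wr BR) (rr BRO) ;;
     mk_with (left_of (wr BL)) (left_off (wr BL) (rr BLO))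
       (point_of (wr BL) (rr BLO)) (RGet EE (wr BL)) (wr RES) rzero)
    (mk_with (left_of (wr BL)) (left_off (wr BL) (rr BLO))
       (point_of (wr BL) (rr BLO)) (RGet EE (wr BL))
       (left_of (wr INNER)) (left_off (wr INNER) (rr INNER_OFF)) ;;
     setw SAVED (wr RES) ;;
     mk_with (right_of (wr INNER)) (right_off (wr INNER) (rr INNER_OFF)) (rr BP) (rr BE)
       (wr BR) (rr BRO) ;;
     mk_with (wr SAVED) rzero (point_of (wr INNER) (rr INNER_OFF)) (RGet EE (wr INNER))
       (wr RES) rzero).

Definition rotate_left : cmd :=
  (setw INNER (left_of (wr BR)) ;;
  setr INNER_OFF (left_off (wr BR) (rr BRO))) ;;
  CIf (BWordLe (WGet HT (wr INNER)) (WGet HT (right_of (wr BR))))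
    (mk_with (wr BL) (rr BLO) (rr BP) (rr BE) (wr INNER) (rr INNER_OFF) ;;
     mk_with (wr RES) rzero (point_of (wr BR) (rr BRO)) (RGet EE (wr BR))
       (right_of (wr BR)) (right_off (wr BR) (rr BRO)))
    (mk_with (wr BL) (rr BLO) (rr BP) (rr BE)
       (left_of (wr INNER)) (left_off (wr INNER) (rr INNER_OFF)) ;;
     setw SAVED (wr RES) ;;
     mk_with (right_of (wr INNER)) (right_off (wr INNER) (rr INNER_OFF))
       (point_of (wr BR) (rr BRO)) (RGet EE (wr BR))
       (right_of (wr BR)) (right_off (wr BR) (rr BRO)) ;;
     mk_with (wr SAVED) rzero (point_of (wr INNER) (rr INNER_OFF)) (RGet EE (wr INNER))
       (wr RES) rzero).

Definition balance_code : cmd :=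
  CIf (BWordLe (WGet HT (wr BL)) (WAdd (WGet HT (wr BR)) (WLit 1)))
    (CIf (BWordLe (WGet HT (wr BR)) (WAdd (WGet HT (wr BL)) (WLit 1)))
       (mk_with (wr BL) (rr BLO) (rr BP) (rr BE) (wr BR) (rr BRO))
       rotate_left)
    rotate_right.

Section Refinement.
Variables (R : realType) (w : nat).
Hypothesis w_gt0 : (0 < w)%N.
Implicit Types (m : memory R) (T l r : tree R).

Definition sums_at m T q o : Prop :=
  [/\ rmem m S0 q = sums 0 T, rmem m S1 q + o * rmem m S0 q = sums 1 T &
      rmem m S2 q + o * rmem m S1 q + (o * rmem m S1 q + o * o * rmem m S0 q)
      = sums 2 T].

(* q is the address of T, whose points are stored minus o. *)
Fixpoint rep m T (q : nat) (o : R) : Prop :=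
  if T is Node l p e r then
    [/\ (0 < q < wmem m HP 0)%N /\ sums_at m T q o,
        rmem m PP q + o = p, rmem m EE q = e,
        wmem m HT q = height T &
        rep m l (wmem m LP q) (o + rmem m LO q) /\
        rep m r (wmem m RP q) (o + rmem m RO q)]
  else q = 0%N.

(** Cell 0 reads as a tree of height 0 with zero sums, so the data of a child are fetched without
    testing whether it is empty. *)
Definition nil_ok m : Prop :=
  [/\ (0 < wmem m HP 0)%N, wmem m HT 0 = 0%N,
      rmem m S0 0 = 0, rmem m S1 0 = 0 & rmem m S2 0 = 0].

(** Persistence: allocated nodes never change, so by [rep_grows] every earlier version of a tree
    stays valid. *)
Definition grows m m' : Prop :=
  [/\ (wmem m HP 0 <= wmem m' HP 0)%N,
      forall b k, b \in [:: LP; RP; HT] -> (k < wmem m HP 0)%N ->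
        wmem m' b k = wmem m b k &
      forall b k, b \in [:: PP; EE; LO; RO; S0; S1; S2] -> (k < wmem m HP 0)%N ->
        rmem m' b k = rmem m b k].

Lemma grows_refl m : grows m m. Proof. by split. Qed.

Lemma grows_trans m m1 m2 : grows m m1 -> grows m1 m2 -> grows m m2.
Proof.
move=> [h1 w1 r1] [h2 w2 r2]; split; first exact: leq_trans h2.
  by move=> b k bb kk; rewrite (w2 _ _ bb (leq_trans kk h1)) w1.
by move=> b k bb kk; rewrite (r2 _ _ bb (leq_trans kk h1)) r1.
Qed.

Lemma grows_same ws rs m m' : same_off ws rs m m' ->
  ~~ has [in ws] [:: HP; LP; RP; HT] ->
  ~~ has [in rs] [:: PP; EE; LO; RO; S0; S1; S2] ->
  grows m m' /\ wmem m' HP 0 = wmem m HP 0.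
Proof.
move=> [hw hr] /hasPn nw /hasPn nr.
have e : wmem m' HP 0 = wmem m HP 0 by rewrite hw // nw // inE.
split=> //; split=> [|b k bb _|b k bb _]; rewrite ?e // ?hw ?hr //.
  by apply: nw; rewrite inE bb orbT.
exact: nr.
Qed.

Lemma nil_ok_grows m m' : nil_ok m -> grows m m' -> nil_ok m'.
Proof.
move=> [h0 h1 h2 h3 h4] [g0 gw gr].
by split; rewrite ?(gw HT) ?gr //; exact: leq_trans g0.
Qed.

Lemma rep_grows m m' T q o : grows m m' -> rep m T q o -> rep m' T q o.
Proof.
move=> g; elim: T q o => //= l IHl p e r IHr q o.
have [g0 gw gr] := g.
move=> [[/andP[q0 lq] [s0 s1 s2]] Ep Ee Eh [/IHl hl /IHr hr]].
rewrite /sums_at (gw LP) // (gw RP) // (gw HT) // !gr //; split=> //; split=> //.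
by rewrite q0 (leq_trans lq).
Qed.

Lemma sums_translate (g : R) T : [/\ sums 0 (translate g T) = sums 0 T,
  sums 1 (translate g T) = sums 1 T + g * sums 0 T &
  sums 2 (translate g T) = sums 2 T + 2 * g * sums 1 T + g * g * sums 0 T].
Proof.
rewrite /sums points_translate !big_map /=; split.
- by apply: eq_bigr => b _; rewrite !expr0.
- by rewrite mulr_sumr -big_split /=; apply: eq_bigr => b _; ring.
- by rewrite !mulr_sumr -!big_split /=; apply: eq_bigr => b _; ring.
Qed.

(** A shift costs nothing: the address is the same and only the offset at which it is read
    changes. *)
Lemma rep_translate m T q o (g : R) : rep m T q o -> rep m (translate g T) q (o + g).
Proof.
elim: T q o => //= l IHl p e r IHr q o.
move=> [[hq [s0 s1 s2]] Ep Ee Eh [/IHl hl /IHr hr]].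
have [e0 e1 e2] := sums_translate g (Node l p e r).
rewrite !height_translate; split=> //.
- split=> //; rewrite -/(translate g (Node l p e r)) /sums_at e0 e1 e2 -s0 -s1 -s2.
  by split=> //; ring.
- by rewrite -Ep addrA.
- by split; rewrite addrAC.
Qed.

Lemma rep_height m T q o : nil_ok m -> rep m T q o -> wmem m HT q = height T.
Proof. by move=> [_ h0 _ _ _]; case: T => [->//|l p e r []]. Qed.

Lemma rep_sums m T q o : nil_ok m -> rep m T q o -> sums_at m T q o.
Proof.
move=> [_ _ h0 h1 h2]; case: T => [->|l p e r [[]//]].
by rewrite /sums_at /sums !big_nil h0 h1 h2 !mulr0 !addr0.
Qed.

Lemma mk_node_runs m l r p e :
  nil_ok m -> rep m l (wmem m AL 0) (rmem m ALO 0) ->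
  rep m r (wmem m AR 0) (rmem m ARO 0) -> rmem m AP 0 = p -> rmem m AE 0 = e ->
  ((wmem m HP 0).+1 < 2 ^ w)%N -> ((maxn (height l) (height r)).+1 < 2 ^ w)%N ->
  runs w mk_node m (fun m' =>
    [/\ grows m m', rep m' (Node l p e r) (wmem m' RES 0) 0 &
        wmem m' HP 0 = (wmem m HP 0).+1]) (cost mk_node).
Proof.
move=> ok hl hr Ep Ee ltw lth; apply: (runs_wp w_gt0); apply: wp_eta.
rewrite /mk_node.
have eq_h := rep_height ok hl; have eq_h' := rep_height ok hr.
have [hl0 hl1 hl2] := rep_sums ok hl; have [hr0 hr1 hr2] := rep_sums ok hr.
do 6 wps.
wps; first by rewrite eq_h eq_h'; lia.
  by rewrite eq_h eq_h'; lia.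
do 4 wps; wps; first by rewrite addn1.
set m' := Memory _ _.
have gr : grows m m'.
  split=> [|b k|b k]; first by rewrite /m' /update /= addn1.
    by rewrite !inE => /or3P[]/eqP-> lt; rewrite /m' /update /= ?(ltn_eqF lt).
  by rewrite !inE; do 6 (case/orP; first by
    move/eqP-> => lt; rewrite /m' /update /= ?(ltn_eqF lt));
    move/eqP-> => lt; rewrite /m' /update /= ?(ltn_eqF lt).
split=> //; last by rewrite /m' /update /= addn1.
have := rep_grows gr hl; have := rep_grows gr hr.
rewrite [rep _ (Node _ _ _ _)]/= /sums_at !sums_node /m' /update /= !eqxx !add0r.
have [hp0 _ _ _ _] := ok.
rewrite addn1 ltnSn hp0 -hl0 -hl1 -hl2 -hr0 -hr1 -hr2 !mul0r !addr0 eq_h eq_h' Ep Ee.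
move=> hr' hl'; split=> //; last by rewrite addn1; congr _.+1; lia.
by split=> //; split=> //; ring.
Qed.

Lemma same_off_refl ws rs m : same_off ws rs m m.
Proof. by []. Qed.

Lemma same_off_wset ws rs m f h b k v : b \in ws ->
  same_off ws rs m (Memory f h) -> same_off ws rs m (Memory (update f b k v) h).
Proof.
move=> bw [hw hr]; split=> //= b' k' nb; rewrite /update -hw //.
by case: eqP => // e; rewrite -e (negbTE nb) in bw.
Qed.

Lemma same_off_rset ws rs m f h b k v : b \in rs ->
  same_off ws rs m (Memory f h) -> same_off ws rs m (Memory f (update h b k v)).
Proof.
move=> br [hw hr]; split=> //= b' k' nb; rewrite /update -hr //.
by case: eqP => // e; rewrite -e (negbTE nb) in br.
Qed.

(** The argument registers are filled one after the other, so each argument must keep its value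
    while the others are being overwritten. *)
Definition mk_args_ok m el elo ep ee er ero ql ol p e qr or :=
  forall m1, same_off [:: AL; AR] [:: ALO; AP; AE; ARO] m m1 ->
  [/\ [/\ wval m1 el = ql, rval m1 elo = ol & rval m1 ep = p],
      [/\ rval m1 ee = e, wval m1 er = qr & rval m1 ero = or],
      [/\ wsafe w m1 el, rsafe w m1 elo & rsafe w m1 ep] &
      [/\ rsafe w m1 ee, wsafe w m1 er & rsafe w m1 ero]].

Lemma mk_with_runs m el elo ep ee er ero ql ol p e qr or l r :
  mk_args_ok m el elo ep ee er ero ql ol p e qr or ->
  nil_ok m -> rep m l ql ol -> rep m r qr or ->
  ((wmem m HP 0).+1 < 2 ^ w)%N -> ((maxn (height l) (height r)).+1 < 2 ^ w)%N ->
  runs w (mk_with el elo ep ee er ero) m (fun m' =>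
    [/\ grows m m', rep m' (Node l p e r) (wmem m' RES 0) 0 &
        wmem m' HP 0 = (wmem m HP 0).+1]) (cost (mk_with el elo ep ee er ero)).
Proof.
case: m => f h args ok hl hr lth ltw.
eapply runs_weaken; [|by move=> ?; exact: id|shelve].
have s0 := same_off_refl [:: AL; AR] [:: ALO; AP; AE; ARO] (Memory f h).
have [[E1 _ _] _ [F1 _ _] _] := args _ s0; apply: (runs_wset w_gt0 E1 F1).
have {}s0 := same_off_wset 0 ql (isT : AL \in [:: AL; AR]) s0.
have [[_ E2 _] _ [_ F2 _] _] := args _ s0; apply: (runs_rset w_gt0 E2 F2).
have {}s0 := same_off_rset 0 ol (isT : ALO \in [:: ALO; AP; AE; ARO]) s0.
have [[_ _ E3] _ [_ _ F3] _] := args _ s0; apply: (runs_rset w_gt0 E3 F3).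
have {}s0 := same_off_rset 0 p (isT : AP \in [:: ALO; AP; AE; ARO]) s0.
have [_ [E4 _ _] _ [F4 _ _]] := args _ s0; apply: (runs_rset w_gt0 E4 F4).
have {}s0 := same_off_rset 0 e (isT : AE \in [:: ALO; AP; AE; ARO]) s0.
have [_ [_ E5 _] _ [_ F5 _]] := args _ s0; apply: (runs_wset w_gt0 E5 F5).
have {}s0 := same_off_wset 0 qr (isT : AR \in [:: AL; AR]) s0.
have [_ [_ _ E6] _ [_ _ F6]] := args _ s0; apply: (runs_rset w_gt0 E6 F6).
have {}s0 := same_off_rset 0 or (isT : ARO \in [:: ALO; AP; AE; ARO]) s0.
have [//|//|gr Ehp] := grows_same s0.
apply: runs_weaken; [apply: (@mk_node_runs _ l r p e)| |exact: leqnn] => //.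
- exact: rep_grows gr hl.
- exact: rep_grows gr hr.
- by move=> m' [g1 rm E]; split=> //; exact: grows_trans gr g1.
Unshelve.
exact: leqnn.
Qed.

Lemma rotate_right_runs m a q f b r p e :
  nil_ok m -> rep m (Node a q f b) (wmem m BL 0) (rmem m BLO 0) ->
  rep m r (wmem m BR 0) (rmem m BRO 0) -> rmem m BP 0 = p -> rmem m BE 0 = e ->
  ((wmem m HP 0 + 3) < 2 ^ w)%N ->
  (height (Node a q f b) + 3 < 2 ^ w)%N -> (height r + 3 < 2 ^ w)%N ->
  ((height r).+1 < height (Node a q f b))%N ->
  runs w rotate_right m (fun m' =>
    [/\ grows m m', rep m' (balance (Node a q f b) p e r) (wmem m' RES 0) 0 &
        (wmem m' HP 0 <= wmem m HP 0 + 3)%N]) (cost rotate_right).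
Proof.
move=> ok hl hr Ep Ee ltw lth1 lth2 hlt; rewrite /balance hlt.
eapply runs_weaken; [|by move=> ?; exact: id|shelve].
eapply runs_seq_frame; first apply: (@runs_wp _ _ w_gt0 _ _ (fun m1 =>
  wmem m1 INNER 0 = wmem m RP (wmem m BL 0) /\
  rmem m1 INNER_OFF 0 = rmem m BLO 0 + rmem m RO (wmem m BL 0))).
  by apply: wp_eta; wps; wps; rewrite /update /=.
move=> m1 [Ey Eyo] s1.
have [//|//|g1 Eh1] := grows_same s1; have [w1 r1] := s1.
have ok1 := nil_ok_grows ok g1.
have hl1 := rep_grows g1 hl; have hr1 := rep_grows g1 hr.
have [[hq _] Eq Ef _ [ha hb]] := hl.
have [[hq1 _] Eq1 Ef1 _ [ha1 hb1]] := hl1.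
have hb' := rep_grows g1 hb; rewrite -Ey -Eyo in hb'.
apply: runs_if => //.
- rewrite /= (rep_height ok1 hb') (w1 BL) // (rep_height ok1 ha1) => le; rewrite le.
  eapply runs_seq_frame; first apply: (@mk_with_runs _ _ _ _ _ _ _ _ _ p e _ _ b r _ ok1 hb' hr1).
  + by args => //; rewrite ?w1 ?r1.
  + by rewrite Eh1; lia.
  + by move: lth1 => /=; lia.
  move=> m2 [g2 rm2 Eh2] [w2 r2].
  have ok2 := nil_ok_grows ok1 g2.
  have [_ Eq2 Ef2 _ [ha2 _]] := rep_grows g2 hl1.
  apply: runs_weaken; [apply: (@mk_with_runs _ _ _ _ _ _ _ _ _ q f _ _ a _ _ ok2 ha2 rm2)|
    |exact: leqnn].
  + by args => //; rewrite ?(w2 BL) ?(w1 BL) ?(r2 BLO) ?(r1 BLO).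
  + by rewrite Eh2 Eh1; lia.
  + by move: lth1 => /=; lia.
  move=> m3 [g3 rm3 Eh3]; split=> //; last by rewrite Eh3 Eh2 Eh1; lia.
  exact: grows_trans g1 (grows_trans g2 g3).
rewrite /= (rep_height ok1 hb') (w1 BL) // (rep_height ok1 ha1) => /negbTE le; rewrite le.
case: b hl hlt lth1 hl1 hb hb1 hb' le => [|b1 q' f' b2] hl hlt lth1 hl1 hb hb1 hb' le.
  by rewrite leq0n in le.
have [_ _ _ _ [hb1' hb2']] := hb'.
eapply runs_seq_frame; first apply: (@mk_with_runs _ _ _ _ _ _ _ _ _ q f _ _ a b1 _ ok1 ha1 hb1').
+ by args => //; rewrite ?(w1 BL) ?(r1 BLO).
+ by rewrite Eh1; lia.
+ by move: lth1 => /=; lia.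
move=> m2 [g2 rm2 Eh2] [w2 r2].
eapply runs_seq_frame; first apply: (@runs_wp _ _ w_gt0 _ _ (fun m3 =>
  wmem m3 SAVED 0 = wmem m2 RES 0)).
  by apply: wp_eta; wps.
move=> m3 Et1 s3; have [//|//|g3 Eh3] := grows_same s3; have [w3 r3] := s3.
have g13 := grows_trans g2 g3; have ok3 := nil_ok_grows ok1 g13.
have [_ _ _ _ [_ hb23]] := rep_grows g13 hb'.
have hr3 := rep_grows g13 hr1.
eapply runs_seq_frame; first apply: (@mk_with_runs _ _ _ _ _ _ _ _ _ p e _ _ b2 r _ ok3 hb23 hr3).
+ by args => //; rewrite ?(w3 INNER) ?(w2 INNER) ?(r3 INNER_OFF) ?(r2 INNER_OFF) ?(w3 BR) ?(w2 BR) ?(w1 BR)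
     ?(r3 BRO) ?(r2 BRO) ?(r1 BRO) ?(r3 BP) ?(r2 BP) ?(r1 BP) ?(r3 BE) ?(r2 BE) ?(r1 BE).
+ by rewrite Eh3 Eh2 Eh1; lia.
+ by move: lth1 => /=; lia.
move=> m4 [g4 rm4 Eh4] [w4 r4].
have ok4 := nil_ok_grows ok3 g4.
have rm4' := rep_grows g4 (rep_grows g3 rm2); rewrite -Et1 in rm4'.
have [_ Eq4 Ef4 _ _] := rep_grows g4 (rep_grows g13 hb').
apply: runs_weaken; [apply: (@mk_with_runs _ _ _ _ _ _ _ _ _ q' f' _ _ _ _ _ ok4 rm4' rm4)|
  |exact: leqnn].
+ by args => //; rewrite ?(w4 INNER) ?(w3 INNER) ?(w2 INNER) ?(r4 INNER_OFF) ?(r3 INNER_OFF) ?(r2 INNER_OFF) ?(w4 SAVED).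
+ by rewrite Eh4 Eh3 Eh2 Eh1; lia.
+ by move: lth1 lth2 => /=; lia.
move=> m5 [g5 rm5 Eh5]; split=> //; last by rewrite Eh5 Eh4 Eh3 Eh2 Eh1; lia.
exact: grows_trans g1 (grows_trans g13 (grows_trans g4 g5)).
Unshelve.
exact: leqnn.
Qed.

Lemma rotate_left_runs m a q f b l p e :
  nil_ok m -> rep m l (wmem m BL 0) (rmem m BLO 0) ->
  rep m (Node b q f a) (wmem m BR 0) (rmem m BRO 0) ->
  rmem m BP 0 = p -> rmem m BE 0 = e ->
  ((wmem m HP 0 + 3) < 2 ^ w)%N ->
  (height l + 3 < 2 ^ w)%N -> (height (Node b q f a) + 3 < 2 ^ w)%N ->
  ((height l).+1 < height (Node b q f a))%N ->
  runs w rotate_left m (fun m' =>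
    [/\ grows m m', rep m' (balance l p e (Node b q f a)) (wmem m' RES 0) 0 &
        (wmem m' HP 0 <= wmem m HP 0 + 3)%N]) (cost rotate_left).
Proof.
move=> ok hl hr Ep Ee ltw lth1 lth2 hlt.
have -> : balance l p e (Node b q f a) =
    if (height b <= height a)%N then Node (Node l p e b) q f a
    else if b is Node b1 q' f' b2 then
      Node (Node l p e b1) q' f' (Node b2 q f a) else Node l p e (Node b q f a).
  by rewrite /balance ltnNge (leq_trans (leqnSn _) (leq_trans (ltnW hlt) (leqnSn _))) /= hlt.
eapply runs_weaken; [|by move=> ?; exact: id|shelve].
eapply runs_seq_frame; first apply: (@runs_wp _ _ w_gt0 _ _ (fun m1 =>
  wmem m1 INNER 0 = wmem m LP (wmem m BR 0) /\
  rmem m1 INNER_OFF 0 = rmem m BRO 0 + rmem m LO (wmem m BR 0))).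
  by apply: wp_eta; wps; wps; rewrite /update /=.
move=> m1 [Ey Eyo] s1.
have [//|//|g1 Eh1] := grows_same s1; have [w1 r1] := s1.
have ok1 := nil_ok_grows ok g1.
have hl1 := rep_grows g1 hl; have hr1 := rep_grows g1 hr.
have [[hq _] Eq Ef _ [hb ha]] := hr.
have [[hq1 _] Eq1 Ef1 _ [hb1 ha1]] := hr1.
have hb' := rep_grows g1 hb; rewrite -Ey -Eyo in hb'.
apply: runs_if => //.
- rewrite /= (rep_height ok1 hb') (w1 BR) // (rep_height ok1 ha1) => le; rewrite le.
  eapply runs_seq_frame; first apply: (@mk_with_runs _ _ _ _ _ _ _ _ _ p e _ _ l b _ ok1 hl1 hb').
  + by args => //; rewrite ?w1 ?r1.
  + by rewrite Eh1; lia.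
  + by move: lth1 lth2 => /=; lia.
  move=> m2 [g2 rm2 Eh2] [w2 r2].
  have ok2 := nil_ok_grows ok1 g2.
  have [_ Eq2 Ef2 _ [_ ha2]] := rep_grows g2 hr1.
  apply: runs_weaken; [apply: (@mk_with_runs _ _ _ _ _ _ _ _ _ q f _ _ _ a _ ok2 rm2 ha2)|
    |exact: leqnn].
  + by args => //; rewrite ?(w2 BR) ?(w1 BR) ?(r2 BRO) ?(r1 BRO).
  + by rewrite Eh2 Eh1; lia.
  + by move: lth1 lth2 => /=; lia.
  move=> m3 [g3 rm3 Eh3]; split=> //; last by rewrite Eh3 Eh2 Eh1; lia.
  exact: grows_trans g1 (grows_trans g2 g3).
rewrite /= (rep_height ok1 hb') (w1 BR) // (rep_height ok1 ha1) => /negbTE le; rewrite le.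
case: b hr hlt lth2 hr1 hb hb1 hb' le => [|b1 q' f' b2] hr hlt lth2 hr1 hb hb1 hb' le.
  by rewrite leq0n in le.
have [_ _ _ _ [hb1' hb2']] := hb'.
eapply runs_seq_frame; first apply: (@mk_with_runs _ _ _ _ _ _ _ _ _ p e _ _ l b1 _ ok1 hl1 hb1').
+ by args => //; rewrite ?w1 ?r1.
+ by rewrite Eh1; lia.
+ by move: lth1 lth2 => /=; lia.
move=> m2 [g2 rm2 Eh2] [w2 r2].
eapply runs_seq_frame; first apply: (@runs_wp _ _ w_gt0 _ _ (fun m3 =>
  wmem m3 SAVED 0 = wmem m2 RES 0)).
  by apply: wp_eta; wps.
move=> m3 Et1 s3; have [//|//|g3 Eh3] := grows_same s3; have [w3 r3] := s3.
have g13 := grows_trans g2 g3; have ok3 := nil_ok_grows ok1 g13.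
have [_ _ _ _ [_ hb23]] := rep_grows g13 hb'.
have [_ Eq3 Ef3 _ [_ ha3]] := rep_grows g13 hr1.
eapply runs_seq_frame; first apply: (@mk_with_runs _ _ _ _ _ _ _ _ _ q f _ _ b2 a _ ok3 hb23 ha3).
+ by args => //; rewrite ?(w3 INNER) ?(w2 INNER) ?(r3 INNER_OFF) ?(r2 INNER_OFF) ?(w3 BR) ?(w2 BR) ?(w1 BR)
     ?(r3 BRO) ?(r2 BRO) ?(r1 BRO).
+ by rewrite Eh3 Eh2 Eh1; lia.
+ by move: lth2 => /=; lia.
move=> m4 [g4 rm4 Eh4] [w4 r4].
have ok4 := nil_ok_grows ok3 g4.
have rm4' := rep_grows g4 (rep_grows g3 rm2); rewrite -Et1 in rm4'.
have [_ Eq4 Ef4 _ _] := rep_grows g4 (rep_grows g13 hb').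
apply: runs_weaken; [apply: (@mk_with_runs _ _ _ _ _ _ _ _ _ q' f' _ _ _ _ _ ok4 rm4' rm4)|
  |exact: leqnn].
+ by args => //; rewrite ?(w4 INNER) ?(w3 INNER) ?(w2 INNER) ?(r4 INNER_OFF) ?(r3 INNER_OFF) ?(r2 INNER_OFF) ?(w4 SAVED).
+ by rewrite Eh4 Eh3 Eh2 Eh1; lia.
+ by move: lth1 lth2 => /=; lia.
move=> m5 [g5 rm5 Eh5]; split=> //; last by rewrite Eh5 Eh4 Eh3 Eh2 Eh1; lia.
exact: grows_trans g1 (grows_trans g13 (grows_trans g4 g5)).
Unshelve.
exact: leqnn.
Qed.

Lemma balance_runs m l r p e :
  nil_ok m -> rep m l (wmem m BL 0) (rmem m BLO 0) ->
  rep m r (wmem m BR 0) (rmem m BRO 0) -> rmem m BP 0 = p -> rmem m BE 0 = e ->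
  ((wmem m HP 0 + 3) < 2 ^ w)%N ->
  (height l + 3 < 2 ^ w)%N -> (height r + 3 < 2 ^ w)%N ->
  runs w balance_code m (fun m' =>
    [/\ grows m m', rep m' (balance l p e r) (wmem m' RES 0) 0 &
        (wmem m' HP 0 <= wmem m HP 0 + 3)%N]) (cost balance_code).
Proof.
move=> ok hl hr Ep Ee ltw lth1 lth2.
have Hl := rep_height ok hl; have Hr := rep_height ok hr.
have sum_lt k : (k + 3 < 2 ^ w)%N -> (k + 1 < 2 ^ w)%N by lia.
rewrite /balance_code; apply: runs_if => //.
- by rewrite /= Hr; split=> //; split=> //; exact: sum_lt.
- rewrite /= Hl Hr addn1 => le1; apply: runs_if => //.
  + by rewrite /= Hl; split=> //; split=> //; exact: sum_lt.
  + rewrite /= Hl Hr addn1 => le2; rewrite balance_id //.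
    apply: runs_weaken; [apply: (@mk_with_runs _ _ _ _ _ _ _ _ _ p e _ _ _ _ _ ok hl hr)|
      |exact: leqnn].
    * by args.
    * by lia.
    * by lia.
    by move=> m' [g' rm ->]; split=> //; lia.
  rewrite /= Hl Hr addn1 -ltnNge => lt2.
  case: r hr lth2 Hr le1 lt2 => [|b q f a] // hr lth2 Hr le1 lt2.
  exact: rotate_left_runs.
rewrite /= Hl Hr addn1 -ltnNge => lt2.
case: l hl lth1 Hl lt2 => [|a q f b] // hl lth1 Hl lt2.
exact: rotate_right_runs.
Qed.

End Refinement.

(** * Searching for a minimizer *)

Notation NODE := 5%N (only parsing).
Notation SP := 6%N (only parsing).
Notation RA := 15%N (only parsing).
Notation RB := 16%N (only parsing).
Notation PROBE := 17%N (only parsing).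
Notation STK := 18%N (only parsing).
Notation NODE_OFF := 7%N (only parsing).
Notation B0 := 20%N (only parsing).
Notation B1 := 21%N (only parsing).
Notation B2 := 22%N (only parsing).
Notation C0 := 23%N (only parsing).
Notation C1 := 24%N (only parsing).
Notation C2 := 25%N (only parsing).
Notation AT := 26%N (only parsing).
Notation LOW := 27%N (only parsing).
Notation ROOT := 28%N (only parsing).
Notation PROBE_OFF := 29%N (only parsing).
Notation STKO := 30%N (only parsing).
Notation IP := 31%N (only parsing).
Notation IE := 32%N (only parsing).
Notation IG := 33%N (only parsing).

Definition nonzero b := BNot (BWordLe (wr b) (WLit 0)).

Definition go_left q o : cmd :=
  setr o (left_off (wr q) (rr o)) ;; setw q (left_of (wr q)).
Definition go_right q o : cmd :=
  setr o (right_off (wr q) (rr o)) ;; setw q (right_of (wr q)).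

(** One level of [prefix_sum], for the three moments at once. *)
Definition eval_body : cmd :=
  CIf (BRealLe (point_of (wr NODE) (rr NODE_OFF)) (rr AT))
    (setr C2 (RAdd (rr C2) (RAdd
       (sum2 (left_of (wr NODE)) (left_off (wr NODE) (rr NODE_OFF)))
       (RMul (RGet EE (wr NODE)) (RMul (point_of (wr NODE) (rr NODE_OFF)) (point_of (wr NODE) (rr NODE_OFF)))))) ;;
     setr C1 (RAdd (rr C1) (RAdd
       (sum1 (left_of (wr NODE)) (left_off (wr NODE) (rr NODE_OFF)))
       (RMul (RGet EE (wr NODE)) (point_of (wr NODE) (rr NODE_OFF))))) ;;
     setr C0 (RAdd (rr C0) (RAdd (sum0 (left_of (wr NODE))) (RGet EE (wr NODE)))) ;;
     go_right NODE NODE_OFF)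
    (go_left NODE NODE_OFF).

Definition eval_loop : cmd := CWhile (nonzero NODE) eval_body.

Definition eval_cost := (bcost (nonzero NODE) + cost eval_body).+1.

Definition eval_both : cmd :=
  (setr C0 (rr B0) ;; setr C1 (rr B1) ;; setr C2 (rr B2) ;;
   setw NODE (wr RA) ;; setr NODE_OFF rzero) ;;
  eval_loop ;;
  (setw NODE (wr RB) ;; setr NODE_OFF rzero) ;;
  eval_loop.

Definition search_move : cmd :=
  CIf (BRealLe (RMul (rr C0) (rr AT)) (rr C1))
    (CIf (BRealLe (rr LOW) (rr AT)) (setr LOW (rr AT)) CSkip ;; go_right PROBE PROBE_OFF)
    (go_left PROBE PROBE_OFF).

(** Each probe evaluates the slope anew from both roots, in time linear in the height; a search
    along a branch thus takes the square of the height. *)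
Definition search_body : cmd :=
  setr AT (point_of (wr PROBE) (rr PROBE_OFF)) ;; eval_both ;; search_move.

Definition search_loop : cmd := CWhile (nonzero PROBE) search_body.

Definition find_code : cmd :=
  (setr LOW (RDiv (rr B1) (rr B0)) ;; setw PROBE (wr RA) ;; setr PROBE_OFF rzero) ;;
  search_loop ;;
  (setw PROBE (wr RB) ;; setr PROBE_OFF rzero) ;;
  search_loop ;;
  setr AT (rr LOW) ;;
  eval_both ;;
  setr ROOT (RDiv (rr C1) (rr C0)).

Section Searching.
Variables (R : realType) (w : nat).
Hypothesis w_gt0 : (0 < w)%N.
Implicit Types (m : memory R) (T l r : tree R).

Lemma eval_loop_runs m T :
  nil_ok m -> rep m T (wmem m NODE 0) (rmem m NODE_OFF 0) ->
  runs w eval_loop m (fun m' =>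
    [/\ rmem m' C0 0 = rmem m C0 0 + prefix_sum 0 (rmem m AT 0) T,
        rmem m' C1 0 = rmem m C1 0 + prefix_sum 1 (rmem m AT 0) T &
        rmem m' C2 0 = rmem m C2 0 + prefix_sum 2 (rmem m AT 0) T])
    ((height T).+1 * eval_cost).
Proof.
elim: T m => [|l IHl p e r IHr] m ok /=.
  move=> q0; apply: runs_weaken; [apply: runs_while_done|move=> m'; exact: id|].
  - exact: w_gt0.
  - by split.
  - by rewrite /= q0.
  - by split; rewrite addr0.
  - by rewrite mul1n ltnS leq_addr.
move=> [[/andP[q0 _] _] Ep Ee _ [hl hr]].
apply: runs_weaken; last first.
- rewrite mulSn /eval_cost addSn; exact: leqnn.
- by move=> m'; exact: id.
apply: (runs_while_step w_gt0) => //; first by rewrite /= -ltnNge.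
apply: runs_weaken; [apply: runs_frame| |exact: leqnn].
  apply: (@runs_wp _ _ w_gt0 _ _ (fun m1 =>
   if p <= rmem m AT 0 then
     [/\ rmem m1 C0 0 = rmem m C0 0 + (sums 0 l + e * p ^+ 0),
         rmem m1 C1 0 = rmem m C1 0 + (sums 1 l + e * p ^+ 1),
         rmem m1 C2 0 = rmem m C2 0 + (sums 2 l + e * p ^+ 2),
         wmem m1 NODE 0 = wmem m RP (wmem m NODE 0) &
         rmem m1 NODE_OFF 0 = rmem m NODE_OFF 0 + rmem m RO (wmem m NODE 0)]
   else
     [/\ rmem m1 C0 0 = rmem m C0 0, rmem m1 C1 0 = rmem m C1 0,
         rmem m1 C2 0 = rmem m C2 0,
         wmem m1 NODE 0 = wmem m LP (wmem m NODE 0) &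
         rmem m1 NODE_OFF 0 = rmem m NODE_OFF 0 + rmem m LO (wmem m NODE 0)])).
  have [s0 s1 s2] := rep_sums ok hl.
  apply: wp_eta; eapply wp_if; [ev|sf| |].
  - rewrite Ep /go_right => ->; do 5 wps; rewrite /update /= Ep Ee -s0 -s1 -s2.
    by split=> //; ring.
  - by rewrite Ep /go_left => /negbTE->; do 2 wps; rewrite /update /=.
move=> m1 [hif s1]; have [//|//|g1 _] := grows_same s1.
have ok1 := nil_ok_grows ok g1; have [_ r1] := s1; have Ex := r1 AT 0%N isT.
move: hif; case: ifP => _ [E0 E1 E2 Eq Eo].
  apply: runs_weaken; [apply: IHr ok1 _| |].
  - by rewrite Eq Eo; exact: rep_grows g1 hr.
  - by move=> m'; rewrite E0 E1 E2 Ex => -[-> -> ->]; split; rewrite !addrA.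
  - by rewrite leq_mul2r ltnS leq_maxr orbT.
apply: runs_weaken; [apply: IHl ok1 _| |].
- by rewrite Eq Eo; exact: rep_grows g1 hl.
- by move=> m'; rewrite E0 E1 E2 Ex.
- by rewrite leq_mul2r ltnS leq_maxl orbT.
Qed.

Definition both_cost H := (cost eval_both + 2 * (H.+1 * eval_cost))%N.

Lemma eval_both_runs m T1 T2 H :
  nil_ok m -> rep m T1 (wmem m RA 0) 0 -> rep m T2 (wmem m RB 0) 0 ->
  (height T1 <= H)%N -> (height T2 <= H)%N ->
  runs w eval_both m (fun m' =>
    [/\ rmem m' C0 0 = accum 0 (rmem m B0 0) T1 T2 (rmem m AT 0),
        rmem m' C1 0 = accum 1 (rmem m B1 0) T1 T2 (rmem m AT 0) &
        rmem m' C2 0 = accum 2 (rmem m B2 0) T1 T2 (rmem m AT 0)])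
    (both_cost H).
Proof.
move=> ok h1 h2 le1 le2.
eapply runs_weaken; [|by move=> ?; exact: id|shelve].
eapply runs_seq_frame; first apply: (@runs_wp _ _ w_gt0 _ _ (fun m1 =>
  [/\ [/\ rmem m1 C0 0 = rmem m B0 0, rmem m1 C1 0 = rmem m B1 0 &
      rmem m1 C2 0 = rmem m B2 0], wmem m1 NODE 0 = wmem m RA 0 & rmem m1 NODE_OFF 0 = 0])).
  by apply: wp_eta; do 5 wps.
move=> m1 [[E0 E1 E2] Eq Eo] s1; have [//|//|g1 _] := grows_same s1.
have ok1 := nil_ok_grows ok g1; have [w1 r1] := s1.
eapply runs_seq_frame; first apply: (@eval_loop_runs _ T1 ok1).
  by rewrite Eq Eo; exact: rep_grows g1 h1.
move=> m2; rewrite E0 E1 E2 (r1 AT) // => -[F0 F1 F2] s2.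
have [//|//|g2 _] := grows_same s2.
have ok2 := nil_ok_grows ok1 g2; have [w2 r2] := s2.
eapply runs_seq_frame; first apply: (@runs_wp _ _ w_gt0 _ _ (fun m3 =>
  wmem m3 NODE 0 = wmem m2 RB 0 /\ rmem m3 NODE_OFF 0 = 0)).
  by apply: wp_eta; do 2 wps.
move=> m3 [Eq3 Eo3] s3; have [//|//|g3 _] := grows_same s3.
have ok3 := nil_ok_grows ok2 g3; have [w3 r3] := s3.
apply: runs_weaken; [apply: (@eval_loop_runs _ T2 ok3)| |exact: leqnn].
  rewrite Eq3 Eo3 (w2 RB) // (w1 RB) //.
  exact: rep_grows (grows_trans g1 (grows_trans g2 g3)) h2.
move=> m4; rewrite (r3 C0) // (r3 C1) // (r3 C2) // F0 F1 F2.
by rewrite (r3 AT) // (r2 AT) // (r1 AT).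
Unshelve.
rewrite /both_cost.
have := leq_mul (le1 : (height T1).+1 <= H.+1)%N (leqnn eval_cost).
have := leq_mul (le2 : (height T2).+1 <= H.+1)%N (leqnn eval_cost).
move: eval_cost => K /=; lia.
Qed.

Definition search_cost H :=
  (bcost (nonzero PROBE) + (cost search_body + both_cost H)).+1.

Section Find.
Variables (T1 T2 : tree R) (H : nat).
Hypotheses (leH1 : (height T1 <= H)%N) (leH2 : (height T2 <= H)%N).

(** [T] is the subtree still to be probed, whereas the slope is always evaluated on the full trees
    [T1] and [T2]. *)
Lemma search_loop_runs m T :
  nil_ok m -> rep m T1 (wmem m RA 0) 0 -> rep m T2 (wmem m RB 0) 0 ->
  rep m T (wmem m PROBE 0) (rmem m PROBE_OFF 0) ->
  runs w search_loop m (fun m' => rmem m' LOW 0 =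
      search (below (rmem m B0 0) (rmem m B1 0) T1 T2) T (rmem m LOW 0))
    ((height T).+1 * search_cost H).
Proof.
elim: T m => [|l IHl p e r IHr] m ok h1 h2 /=.
  move=> q0; apply: runs_weaken; [apply: runs_while_done|move=> m'; exact: id|].
  - exact: w_gt0.
  - by split.
  - by rewrite /= q0.
  - by [].
  - by rewrite mul1n ltnS leq_addr.
move=> [[/andP[q0 ltq] _] Ep Ee _ [hl hr]].
apply: runs_weaken; last first.
- rewrite mulSn {1}/search_cost addSn; exact: leqnn.
- by move=> m'; exact: id.
apply: (runs_while_step w_gt0) => //; first by rewrite /= -ltnNge.
pose lo' := if rmem m LOW 0 <= p then p else rmem m LOW 0.
apply: runs_weaken; [apply: (runs_frame (k := cost search_body + both_cost H)
    (Q := fun m1 =>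
   if below (rmem m B0 0) (rmem m B1 0) T1 T2 p then
     [/\ rmem m1 LOW 0 = lo', wmem m1 PROBE 0 = wmem m RP (wmem m PROBE 0) &
         rmem m1 PROBE_OFF 0 = rmem m PROBE_OFF 0 + rmem m RO (wmem m PROBE 0)]
   else
     [/\ rmem m1 LOW 0 = rmem m LOW 0, wmem m1 PROBE 0 = wmem m LP (wmem m PROBE 0) &
         rmem m1 PROBE_OFF 0 = rmem m PROBE_OFF 0 + rmem m LO (wmem m PROBE 0)]))| |exact: leqnn].
  eapply runs_weaken; [|by move=> ?; exact: id|shelve].
  eapply runs_seq_frame; first apply: (@runs_wp _ _ w_gt0 _ _ (fun m1 =>
    rmem m1 AT 0 = p)).
    by apply: wp_eta; wps; rewrite /update /= -Ep.
  move=> m1 Ex s1; have [//|//|g1 _] := grows_same s1.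
  have ok1 := nil_ok_grows ok g1; have [w1 r1] := s1.
  eapply runs_seq_frame; first apply: (@eval_both_runs _ T1 T2 H ok1) => //.
  - by rewrite w1 //; exact: rep_grows g1 h1.
  - by rewrite w1 //; exact: rep_grows g1 h2.
  move=> m2 [E0 E1 _] s2; have [//|//|g2 _] := grows_same s2.
  have ok2 := nil_ok_grows ok1 g2; have [w2 r2] := s2.
  have g12 := grows_trans g1 g2.
  have [hq1 hq2] : wmem m2 PROBE 0 = wmem m PROBE 0 /\ rmem m2 PROBE_OFF 0 = rmem m PROBE_OFF 0.
    by rewrite (w2 PROBE) // (w1 PROBE) // (r2 PROBE_OFF) // (r1 PROBE_OFF).
  have Ex2 : rmem m2 AT 0 = p by rewrite (r2 AT).
  have El2 : rmem m2 LOW 0 = rmem m LOW 0 by rewrite (r2 LOW) // (r1 LOW).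
  have [_ gw gr] := g12.
  apply: (@runs_wp _ _ w_gt0); apply: wp_eta; eapply wp_if; [ev|sf| |];
    rewrite E0 E1 Ex2 Ex (r1 B0) // (r1 B1) // -/(below _ _ _ _ _).
  - move=> ->; rewrite /go_right; apply: wp_seq; eapply wp_if; [ev|sf| |];
      rewrite El2 Ex2 /lo'.
    + by move=> ->; wps; wps; wps; rewrite /update /= hq1 hq2 Ex2 gw // gr.
    + move/negbTE=> ->; apply: wp_skip.
      by wps; wps; rewrite /update /= El2 hq1 hq2 gw // gr.
  - by move/negbTE=> ->; rewrite /go_left; wps; wps; rewrite /update /= El2 hq1 hq2 gw // gr.
move=> m1 [hif s1]; have [//|//|g1 _] := grows_same s1.
have ok1 := nil_ok_grows ok g1; have [w1 r1] := s1.
have h1' : rep m1 T1 (wmem m1 RA 0) 0 by rewrite w1 //; exact: rep_grows g1 h1.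
have h2' : rep m1 T2 (wmem m1 RB 0) 0 by rewrite w1 //; exact: rep_grows g1 h2.
move: hif; case: ifP => _ [El Es Eso].
  apply: runs_weaken; [apply: IHr ok1 h1' h2' _| |].
  - by rewrite Es Eso; exact: rep_grows g1 hr.
  - by move=> m'; rewrite El (r1 B0) // (r1 B1).
  - by rewrite leq_mul2r ltnS leq_maxr orbT.
apply: runs_weaken; [apply: IHl ok1 h1' h2' _| |].
- by rewrite Es Eso; exact: rep_grows g1 hl.
- by move=> m'; rewrite El (r1 B0) // (r1 B1).
- by rewrite leq_mul2r ltnS leq_maxl orbT.
Unshelve.
by move: (both_cost H) => K; rewrite /search_body /=; lia.
Qed.

Definition find_cost :=
  (cost find_code + (2 * (H.+1 * search_cost H) + both_cost H))%N.

(** The banks [B0], [B1], [B2] are consecutive, whence [B0 + j]. On exit [C0], [C1], [C2] describe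
    the piece containing the zero: [C0] becomes the weight of the new hinges, and [C1] and [C2] give
    the cost of a peak. *)
Lemma find_code_runs m :
  nil_ok m -> rep m T1 (wmem m RA 0) 0 -> rep m T2 (wmem m RB 0) 0 ->
  runs w find_code m (fun m' =>
    let b j := rmem m (B0 + j) 0 in
    let x := lower (b 0) (b 1) T1 T2 in
    [/\ rmem m' ROOT 0 = minimizer (b 0) (b 1) T1 T2,
        rmem m' C0 0 = accum 0 (b 0) T1 T2 x,
        rmem m' C1 0 = accum 1 (b 1) T1 T2 x &
        rmem m' C2 0 = accum 2 (b 2) T1 T2 x]%N)
    find_cost.
Proof.
move=> ok h1 h2.
eapply runs_weaken; [|by move=> ?; exact: id|shelve].
eapply runs_seq_frame; first apply: (@runs_wp _ _ w_gt0 _ _ (fun m1 =>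
  [/\ rmem m1 LOW 0 = rmem m B1 0 / rmem m B0 0, wmem m1 PROBE 0 = wmem m RA 0 &
      rmem m1 PROBE_OFF 0 = 0])).
  by apply: wp_eta; do 3 wps.
move=> m1 [El Es Eso] s1; have [//|//|g1 _] := grows_same s1.
have ok1 := nil_ok_grows ok g1; have [w1 r1] := s1.
have h11 : rep m1 T1 (wmem m1 RA 0) 0 by rewrite w1 //; exact: rep_grows g1 h1.
have h21 : rep m1 T2 (wmem m1 RB 0) 0 by rewrite w1 //; exact: rep_grows g1 h2.
eapply runs_seq_frame; first apply: (@search_loop_runs _ T1 ok1 h11 h21).
  by rewrite Es Eso -(w1 RA).
move=> m2; rewrite El (r1 B0) // (r1 B1) // => El2 s2; have [//|//|g2 _] := grows_same s2.
have ok2 := nil_ok_grows ok1 g2; have [w2 r2] := s2.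
eapply runs_seq_frame; first apply: (@runs_wp _ _ w_gt0 _ _ (fun m3 =>
  wmem m3 PROBE 0 = wmem m2 RB 0 /\ rmem m3 PROBE_OFF 0 = 0)).
  by apply: wp_eta; do 2 wps.
move=> m3 [Es3 Eso3] s3; have [//|//|g3 _] := grows_same s3.
have ok3 := nil_ok_grows ok2 g3; have [w3 r3] := s3.
have g13 := grows_trans g2 g3.
have h13 : rep m3 T1 (wmem m3 RA 0) 0.
  by rewrite w3 // w2 //; exact: rep_grows g13 h11.
have h23 : rep m3 T2 (wmem m3 RB 0) 0.
  by rewrite w3 // w2 //; exact: rep_grows g13 h21.
eapply runs_seq_frame; first apply: (@search_loop_runs _ T2 ok3 h13 h23).
  by rewrite Es3 Eso3 -(w3 RB).
move=> m4; rewrite (r3 LOW) // El2 (r3 B0) // (r2 B0) // (r1 B0) // (r3 B1) // (r2 B1) //.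
rewrite (r1 B1) // -/(lower _ _ _ _) => El4 s4.
have [//|//|g4 _] := grows_same s4.
have ok4 := nil_ok_grows ok3 g4; have [w4 r4] := s4.
eapply runs_seq_frame; first apply: (@runs_wp _ _ w_gt0 _ _ (fun m5 =>
  rmem m5 AT 0 = rmem m4 LOW 0)).
  by apply: wp_eta; wps.
move=> m5; rewrite El4 => Ex s5; have [//|//|g5 _] := grows_same s5.
have ok5 := nil_ok_grows ok4 g5; have [w5 r5] := s5.
have g15 := grows_trans g4 g5.
eapply runs_seq_frame; first apply: (@eval_both_runs _ T1 T2 H ok5) => //.
- by rewrite w5 // w4 //; exact: rep_grows g15 h13.
- by rewrite w5 // w4 //; exact: rep_grows g15 h23.
move=> m6; rewrite Ex (r5 B0) // (r4 B0) // (r3 B0) // (r2 B0) // (r1 B0) //.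
rewrite (r5 B1) // (r4 B1) // (r3 B1) // (r2 B1) // (r1 B1) //.
rewrite (r5 B2) // (r4 B2) // (r3 B2) // (r2 B2) // (r1 B2) //.
move=> [E0 E1 E2] _; apply: (@runs_wp _ _ w_gt0); apply: wp_eta.
by wps; rewrite /update /= E0 E1 E2.
Unshelve.
have := leq_mul (leH1 : (height T1).+1 <= H.+1)%N (leqnn (search_cost H)).
have := leq_mul (leH2 : (height T2).+1 <= H.+1)%N (leqnn (search_cost H)).
rewrite /find_cost; move: (both_cost H) (search_cost H) => K K'.
by rewrite /find_code /=; lia.
Qed.

End Find.

End Searching.

(** * Inserting a hinge *)

(** The machine has no recursion: the branch is recorded on a stack, together with the offsets, and
    its copy is rebuilt from the bottom. *)
Definition push_body : cmd :=
  CWSet STK (wr SP) (wr NODE) ;; CRSet STKO (wr SP) (rr NODE_OFF) ;;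
  setw SP (WAdd (wr SP) (WLit 1)) ;;
  CIf (BRealLe (point_of (wr NODE) (rr NODE_OFF)) (rr ROOT)) (go_right NODE NODE_OFF) (go_left NODE NODE_OFF).

Definition pop_load : cmd :=
  setw SP (WSub (wr SP) (WLit 1)) ;;
  setw NODE (WGet STK (wr SP)) ;; setr NODE_OFF (RGet STKO (wr SP)) ;;
  setr BE (RGet EE (wr NODE)) ;;
  CIf (BRealLe (point_of (wr NODE) (rr NODE_OFF)) (rr ROOT))
    (setw BL (left_of (wr NODE)) ;; setr BLO (left_off (wr NODE) (rr NODE_OFF)) ;;
     setr BP (point_of (wr NODE) (rr NODE_OFF)) ;;
     setw BR (wr RES) ;; setr BRO rzero)
    (setw BL (wr RES) ;; setr BLO rzero ;;
     setr BP (RAdd (point_of (wr NODE) (rr NODE_OFF)) (rr IG)) ;;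
     setw BR (right_of (wr NODE)) ;;
     setr BRO (RAdd (right_off (wr NODE) (rr NODE_OFF)) (rr IG))).

Definition pop_body : cmd := pop_load ;; balance_code.

Definition insert_code : cmd :=
  (setw NODE (wr RA) ;; setr NODE_OFF rzero ;; setw SP (WLit 0)) ;;
  CWhile (nonzero NODE) push_body ;;
  mk_with (WLit 0) rzero (rr IP) (rr IE) (WLit 0) rzero ;;
  CWhile (nonzero SP) pop_body.

Section Insertion.
Variables (R : realType) (w : nat).
Hypothesis w_gt0 : (0 < w)%N.
Implicit Types (m : memory R) (T t l r : tree R) (ctx : seq (tree R)).

(** One level of [insert] whose recursive result [t] is already available; [insert] is a fold of it
    over the stack. *)
Definition refill (z g : R) t T : tree R :=
  if T is Node l q f r then
    if q <= z then balance l q f t else balance t (q + g) f (translate g r)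
  else t.

Fixpoint stack_rep m ctx (d : nat) : Prop :=
  if ctx is T :: ctx' then
    [/\ (0 < d)%N, (0 < height T)%N, rep m T (wmem m STK d.-1) (rmem m STKO d.-1) &
        stack_rep m ctx' d.-1]
  else d = 0%N.

Lemma stack_size m ctx d : stack_rep m ctx d -> d = size ctx.
Proof.
by elim: ctx d => //= T ctx IH d [d0 _ _ /IH <-]; rewrite prednK.
Qed.

Lemma stack_rep_grows m m' ctx d : grows m m' ->
  (forall k, (k < d)%N -> wmem m' STK k = wmem m STK k /\ rmem m' STKO k = rmem m STKO k) ->
  stack_rep m ctx d -> stack_rep m' ctx d.
Proof.
move=> g; elim: ctx d => //= T ctx IH d hs [d0 hT rT sT].
have [-> ->] := hs d.-1 ltac:(by rewrite prednK).
split=> //; first exact: rep_grows g rT.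
by apply: IH => // k lt; apply: hs; exact: leq_trans lt (leq_pred _).
Qed.

Definition push_cost := (bcost (nonzero NODE) + cost push_body).+1.
Definition pop_cost := (bcost (nonzero SP) + (cost pop_load + cost balance_code)).+1.

(** What remains to be done is invariant: inserting into [T] and then folding over [ctx]. The new
    leaf is built only after the descent, hence the quantification over [p], [e] and [g]. *)
Lemma push_loop_runs m T ctx H :
  nil_ok m -> rep m T (wmem m NODE 0) (rmem m NODE_OFF 0) ->
  stack_rep m ctx (wmem m SP 0) -> (height T <= H)%N ->
  all (fun T' => height T' <= H)%N ctx ->
  (size ctx + height T < 2 ^ w)%N ->
  runs w (CWhile (nonzero NODE) push_body) m (fun m' => exists ctx',
    [/\ stack_rep m' ctx' (wmem m' SP 0), (size ctx' <= size ctx + height T)%N,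
        all (fun T' => height T' <= H)%N ctx' &
        forall p e g, foldl (refill (rmem m ROOT 0) g) (Node Leaf p e Leaf) ctx' =
          foldl (refill (rmem m ROOT 0) g) (insert (rmem m ROOT 0) p e g T) ctx])
    ((height T).+1 * push_cost).
Proof.
elim: T m ctx => [|l IHl p e r IHr] m ctx ok.
  move=> q0 st _ al _; apply: runs_weaken; [apply: runs_while_done|move=> m'; exact: id|].
  - exact: w_gt0.
  - by split.
  - by rewrite /= q0.
  - by exists ctx; split=> //; rewrite addn0.
  - by rewrite mul1n ltnS leq_addr.
move=> rT st leT al lt; have /= [[/andP[q0 ltq] _] Ep Ee _ [hl hr]] := rT.
have Esp := stack_size st.
apply: runs_weaken; last first.
- rewrite mulSn /push_cost addSn; exact: leqnn.
- by move=> m'; exact: id.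
apply: (runs_while_step w_gt0) => //; first by rewrite /= -ltnNge.
apply: runs_weaken; [apply: runs_frame| |exact: leqnn].
  apply: (@runs_wp _ _ w_gt0 _ _ (fun m1 =>
    [/\ wmem m1 SP 0 = (wmem m SP 0).+1,
        wmem m1 STK (wmem m SP 0) = wmem m NODE 0,
        rmem m1 STKO (wmem m SP 0) = rmem m NODE_OFF 0,
        (forall k, (k < wmem m SP 0)%N -> wmem m1 STK k = wmem m STK k /\
           rmem m1 STKO k = rmem m STKO k) &
    if p <= rmem m ROOT 0 then
     wmem m1 NODE 0 = wmem m RP (wmem m NODE 0) /\
     rmem m1 NODE_OFF 0 = rmem m NODE_OFF 0 + rmem m RO (wmem m NODE 0)
   else
     wmem m1 NODE 0 = wmem m LP (wmem m NODE 0) /\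
     rmem m1 NODE_OFF 0 = rmem m NODE_OFF 0 + rmem m LO (wmem m NODE 0)])).
  apply: wp_eta; rewrite /push_body; wps; wps; wps.
    by rewrite Esp; move: lt => /=; lia.
  rewrite addn1; eapply wp_if; [ev|sf| |]; rewrite Ep /go_left /go_right => h;
    wps; wps; rewrite /update /= ?eqxx ?h ?(negbTE h); split=> //= k ltk;
    by rewrite (ltn_eqF ltk).
move=> m1 [[Esp1 Es Eso hs hif] s1]; have [//|//|g1 _] := grows_same s1.
have ok1 := nil_ok_grows ok g1; have [_ r1] := s1; have Ez := r1 ROOT 0%N isT.
have st1 : stack_rep m1 (Node l p e r :: ctx) (wmem m1 SP 0).
  by rewrite Esp1 /stack_rep -/stack_rep Es Eso; split=> //;
    [exact: rep_grows g1 rT|exact: stack_rep_grows g1 hs st].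
have al1 : all (fun T' => height T' <= H)%N (Node l p e r :: ctx) by rewrite /= leT.
move: hif; rewrite -Ez.
have [lel ler] : (height l < height (Node l p e r))%N /\ (height r < height (Node l p e r))%N.
  by rewrite /= !ltnS leq_maxl leq_maxr.
case: ifP => hle [Eq Eo].
  apply: runs_weaken; [apply: (IHr _ _ ok1 _ st1 _ al1)| |].
  - by rewrite Eq Eo; exact: rep_grows g1 hr.
  - exact: leq_trans (ltnW ler) leT.
  - by move: lt ler => /=; lia.
  - move=> m' [ctx' [a b c d]]; exists ctx'; split=> //; first by move: b ler => /=; lia.
    by move=> p' e' g'; rewrite d /= hle.
  - by rewrite leq_mul2r ltnS leq_maxr orbT.
apply: runs_weaken; [apply: (IHl _ _ ok1 _ st1 _ al1)| |].
- by rewrite Eq Eo; exact: rep_grows g1 hl.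
- exact: leq_trans (ltnW lel) leT.
- by move: lt lel => /=; lia.
- move=> m' [ctx' [a b c d]]; exists ctx'; split=> //; first by move: b lel => /=; lia.
  by move=> p' e' g'; rewrite d /= hle.
- by rewrite leq_mul2r ltnS leq_maxl orbT.
Qed.

Lemma height_balance l p e r :
  (height (balance l p e r) <= (maxn (height l) (height r)).+1)%N.
Proof.
rewrite /balance; case: ifP => h1.
  case: l h1 => //= a q f b h1; case: ifP => h2 /=; first by lia.
  by case: b h1 h2 => //= *; lia.
case: ifP => h2 //; case: r h1 h2 => //= b q f a h1 h2; case: ifP => h3 /=; first by lia.
by case: b h1 h2 h3 => //= *; lia.
Qed.

(** The height bound rises by one per level, by [height_balance], so no balance condition on the
    trees enters. Each level allocates at most three nodes. *)
Lemma pop_loop_runs m t ctx H N :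
  nil_ok m -> rep m t (wmem m RES 0) 0 ->
  stack_rep m ctx (wmem m SP 0) -> (height t <= N)%N ->
  all (fun T' => height T' <= H)%N ctx ->
  (maxn H N + size ctx + 3 < 2 ^ w)%N ->
  (wmem m HP 0 + 3 * size ctx < 2 ^ w)%N ->
  runs w (CWhile (nonzero SP) pop_body) m (fun m' =>
    [/\ grows m m', (wmem m' HP 0 <= wmem m HP 0 + 3 * size ctx)%N &
        rep m' (foldl (refill (rmem m ROOT 0) (rmem m IG 0)) t ctx) (wmem m' RES 0) 0])
    ((size ctx).+1 * pop_cost).
Proof.
elim: ctx m t N => [|T ctx IH] m t N ok rt st lt al ltw lth.
  apply: runs_weaken; [apply: runs_while_done|move=> m'; exact: id|].
  - exact: w_gt0.
  - by split.
  - by rewrite /= st.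
  - by split=> //=; rewrite ?muln0 ?addn0.
  - by rewrite mul1n ltnS leq_addr.
have [d0 hT rT sT] := st.
case: T hT rT al ltw lth {st} => // l p e r _ rT /andP[alT al] ltw lth.
have /= [[/andP[q0 ltq] _] Ep Ee _ [hl hr]] := rT.
apply: runs_weaken; last first.
- rewrite mulSn /pop_cost addSn; exact: leqnn.
- by move=> m'; exact: id.
apply: (runs_while_step w_gt0) => //; first by rewrite /= -ltnNge.
pose t' := refill (rmem m ROOT 0) (rmem m IG 0) t (Node l p e r).
have ht' : (height t' <= (maxn H N).+1)%N.
  rewrite /t' /refill; case: ifP => _; apply: leq_trans (height_balance _ _ _ _) _;
    rewrite ?height_translate; move: alT lt => /=; lia.
apply: runs_weaken; [apply: (runs_frame (Q := fun m2 =>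
   [/\ grows m m2, (wmem m2 HP 0 <= wmem m HP 0 + 3)%N,
       rep m2 t' (wmem m2 RES 0) 0 & wmem m2 SP 0 = (wmem m SP 0).-1]))| |exact: leqnn].
  eapply runs_seq_frame; first apply: (@runs_wp _ _ w_gt0 _ _ (fun m1 =>
    [/\ rmem m1 BE 0 = e, wmem m1 SP 0 = (wmem m SP 0).-1 &
    if p <= rmem m ROOT 0 then
      [/\ wmem m1 BL 0 = wmem m LP (wmem m STK (wmem m SP 0).-1),
          rmem m1 BLO 0 = rmem m STKO (wmem m SP 0).-1
             + rmem m LO (wmem m STK (wmem m SP 0).-1),
          rmem m1 BP 0 = p, wmem m1 BR 0 = wmem m RES 0 & rmem m1 BRO 0 = 0]
    else
      [/\ wmem m1 BL 0 = wmem m RES 0, rmem m1 BLO 0 = 0,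
          rmem m1 BP 0 = p + rmem m IG 0,
          wmem m1 BR 0 = wmem m RP (wmem m STK (wmem m SP 0).-1) &
          rmem m1 BRO 0 = rmem m STKO (wmem m SP 0).-1
             + rmem m RO (wmem m STK (wmem m SP 0).-1) + rmem m IG 0]])).
    apply: wp_eta; rewrite /pop_load; wps; wps; wps; wps; rewrite subn1.
    eapply wp_if; [ev|sf| |]; rewrite Ep => h; wps; wps; wps; wps; wps;
      by rewrite /update /= ?Ep ?Ee ?h ?(negbTE h).
  move=> m1 [Ebe Esp hif] s1; have [//|//|g1 Eh1] := grows_same s1.
  have ok1 := nil_ok_grows ok g1.
  have rt1 := rep_grows g1 rt; have hl1 := rep_grows g1 hl; have hr1 := rep_grows g1 hr.
  have bound : forall l0 p0 r0, t' = balance l0 p0 e r0 ->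
      rep m1 l0 (wmem m1 BL 0) (rmem m1 BLO 0) -> rep m1 r0 (wmem m1 BR 0) (rmem m1 BRO 0) ->
      rmem m1 BP 0 = p0 -> (height l0 <= maxn H N)%N -> (height r0 <= maxn H N)%N ->
      runs w balance_code m1 (fun m2 =>
        [/\ grows m m2, (wmem m2 HP 0 <= wmem m HP 0 + 3)%N,
          rep m2 t' (wmem m2 RES 0) 0 & wmem m2 SP 0 = (wmem m SP 0).-1])
      (cost balance_code).
    move=> l0 p0 r0 -> hl0 hr0 Ep0 b1 b2.
    apply: runs_weaken;
      [apply: runs_frame (balance_runs w_gt0 ok1 hl0 hr0 Ep0 Ebe _ _ _)| |exact: leqnn].
    - by rewrite Eh1; move: lth => /=; lia.
    - by move: ltw => /=; lia.
    - by move: ltw => /=; lia.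
    - move=> m2 [[g2 rm2 le2] [w2 _]]; rewrite -Eh1 (w2 SP) //; split=> //.
      exact: grows_trans g1 g2.
  move: hif; case: ifP => hle [E1 E2 E3 E4 E5].
    apply: (bound l p t) => //.
    - by rewrite /t' /= hle.
    - by rewrite E1 E2.
    - by rewrite E4 E5.
    - by move: alT => /=; lia.
    - by lia.
  apply: (bound t (p + rmem m IG 0) (translate (rmem m IG 0) r)) => //.
  - by rewrite /t' /= hle.
  - by rewrite E1 E2.
  - by rewrite E4 E5; exact: rep_translate.
  - by lia.
  - by rewrite height_translate; move: alT => /=; lia.
move=> m2 [[g2 le2 rm2 Esp2] [w2 r2]].
have ok2 := nil_ok_grows ok g2.
have sT2 : stack_rep m2 ctx (wmem m2 SP 0).
  by rewrite Esp2; apply: stack_rep_grows g2 _ sT => k _; rewrite w2 // r2.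
apply: runs_weaken; [apply: (IH _ t' (maxn H N).+1 ok2 rm2 sT2 ht' al)| |exact: leqnn].
- by move: ltw => /=; lia.
- by move: lth le2 => /=; lia.
- move=> m' [g' le' rm']; split; first exact: grows_trans g2 g'.
    by move: le' le2 => /=; lia.
  by move: rm'; rewrite (r2 ROOT) // (r2 IG).
Qed.

Definition insert_cost H :=
  (cost insert_code + (H.+1 * push_cost + H.+1 * pop_cost))%N.

Lemma insert_code_runs m T H :
  nil_ok m -> rep m T (wmem m RA 0) 0 -> (height T <= H)%N -> (0 < H)%N ->
  (2 * H + 4 < 2 ^ w)%N -> (wmem m HP 0 + 3 * H + 1 < 2 ^ w)%N ->
  runs w insert_code m (fun m' =>
    [/\ grows m m', (wmem m' HP 0 <= wmem m HP 0 + 3 * H + 1)%N &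
        rep m' (insert (rmem m ROOT 0) (rmem m IP 0) (rmem m IE 0) (rmem m IG 0) T)
          (wmem m' RES 0) 0])
    (insert_cost H).
Proof.
move=> ok rT leT H0 ltw lth.
eapply runs_weaken; [|by move=> ?; exact: id|shelve].
eapply runs_seq_frame; first apply: (@runs_wp _ _ w_gt0 _ _ (fun m1 =>
  [/\ wmem m1 NODE 0 = wmem m RA 0, rmem m1 NODE_OFF 0 = 0 & wmem m1 SP 0 = 0%N])).
  by apply: wp_eta; wps; wps; wps.
move=> m1 [Eq Eo Esp] s1; have [//|//|g1 Eh1] := grows_same s1.
have ok1 := nil_ok_grows ok g1; have [w1 r1] := s1.
eapply runs_seq_frame; first apply: (@push_loop_runs m1 T [::] H ok1) => //.
- by rewrite Eq Eo; exact: rep_grows g1 rT.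
- by move: leT ltw; rewrite add0n; lia.
move=> m2 [ctx [st2 sz2 al2 E2]] s2; have [//|//|g2 Eh2] := grows_same s2.
have ok2 := nil_ok_grows ok1 g2; have [w2 r2] := s2.
eapply runs_seq_frame; first apply: (@mk_with_runs _ _ w_gt0 m2 _ _ _ _ _ _ 0%N 0
    (rmem m IP 0) (rmem m IE 0) 0%N 0 Leaf Leaf) => //.
- by args => //; rewrite ?(r2 IP) ?(r2 IE) ?(r1 IP) ?(r1 IE).
- by rewrite Eh2 Eh1; lia.
- by rewrite /=; lia.
move=> m3 [g3 rm3 Eh3] [w3 r3].
have ok3 := nil_ok_grows ok2 g3.
have st3 : stack_rep m3 ctx (wmem m3 SP 0).
  by rewrite (w3 SP) //; apply: stack_rep_grows g3 _ st2 => k _; rewrite w3 // r3.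
have szH : (size ctx <= H)%N by exact: leq_trans sz2 leT.
apply: runs_weaken; [apply: (@pop_loop_runs m3 _ ctx H 1 ok3 rm3 st3 _ al2)| |].
- by [].
- by move: ltw; lia.
- by rewrite Eh3 Eh2 Eh1; lia.
- move=> m4 [g4 le4 rm4]; split.
  + exact: grows_trans g1 (grows_trans g2 (grows_trans g3 g4)).
  + by move: le4; rewrite Eh3 Eh2 Eh1; lia.
  + move: rm4; rewrite (r3 ROOT) // (r2 ROOT) // (r3 IG) // (r2 IG) // (r1 IG) // E2 /=.
    by rewrite (r1 ROOT).
- apply: leq_trans (leqnn (H.+1 * pop_cost)); by rewrite leq_mul2r ltnS szH orbT.
Unshelve.
have := leq_mul (leT : (height T).+1 <= H.+1)%N (leqnn push_cost).
rewrite /insert_cost; move: push_cost pop_cost => K K'.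
by rewrite /insert_code /=; lia.
Qed.

End Insertion.

(** * One pass along the path *)

Notation IDX := 7%N (only parsing).
Notation ROOTS := 19%N (only parsing).
Notation BI := 21%N (only parsing).
Notation POS := 22%N (only parsing).
Notation BASE := 23%N (only parsing).
Notation TI := 24%N (only parsing).
Notation OUT := 2%N (only parsing).
Notation MIN := 34%N (only parsing).
Notation BEST := 36%N (only parsing).
Notation BX := 37%N (only parsing).
Notation VAL := 38%N (only parsing).

(* The forward pass has BASE = 0 and the backward pass BASE = n, so that both
   fill the same banks ROOTS and MIN. *)
Definition slot := WAdd (wr BASE) (wr IDX).
Definition mirror i := WSub (WSub (wr 0) (WLit 1)) (wr i).

(** The base sums receive the target of the current vertex before the search, as F_k contains its
    square. [RA] still holds the tree of A_k, which is recorded before any hinge is added. *)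
Definition pass_load : cmd :=
  CIf (BWordLe (wr BASE) (WLit 0)) (setw TI (wr IDX)) (setw TI (mirror IDX)) ;;
  CWSet ROOTS slot (wr RA) ;;
  setr B0 (RAdd (rr B0) (ROfWord (WLit 1))) ;;
  setr B1 (RAdd (rr B1) (RGet 0 (wr TI))) ;;
  setr B2 (RAdd (rr B2) (RMul (RGet 0 (wr TI)) (RGet 0 (wr TI)))).

(** [pass_first] and [pass_second] prepare the two insertions of [insert_hinge]; [ROOT] and [C0]
    survive the first of them. *)
Definition pass_first : cmd :=
  CRSet MIN slot (rr ROOT) ;;
  setr IG rzero ;; setr IP (rr ROOT) ;; setr IE (RSub rzero (rr C0)).

Definition pass_second : cmd :=
  setw RA (wr RES) ;;
  setr IG (rr 1) ;; setr IP (RAdd (rr ROOT) (rr 1)) ;; setr IE (rr C0).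

Definition pass_last : cmd :=
  setw RA (wr RES) ;; setw IDX (WAdd (wr IDX) (WLit 1)).

Definition pass_body : cmd :=
  pass_load ;; find_code ;; pass_first ;; insert_code ;; pass_second ;;
  insert_code ;; pass_last.

Definition below_n := BNot (BWordLe (wr 0) (wr IDX)).

Definition pass_init : cmd :=
  setw IDX (WLit 0) ;; setw RA (WLit 0) ;; setw RB (WLit 0) ;;
  setr B0 rzero ;; setr B1 rzero ;; setr B2 rzero.

Definition pass_code : cmd := pass_init ;; CWhile below_n pass_body.

Section Passes.
Variables (R : realType) (w n : nat) (t : 'I_n -> R) (g : R) (H : nat).
Hypothesis w_gt0 : (0 < w)%N.
Implicit Types (m : memory R) (T l r : tree R).

Hypothesis g_ge0 : 0 <= g.
Hypothesis n_gt0 : (0 < n)%N.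
Hypothesis word_n : (n + n < 2 ^ w)%N.
Hypothesis word_H : (2 * H + 4 < 2 ^ w)%N.
Hypothesis trees_H : forall u k, (k <= n)%N -> (height (trees g u k) < H)%N.

Definition input_ok m : Prop :=
  [/\ wmem m 0 0 = n, forall j, (j < n)%N -> rmem m 0 j = target t j & rmem m 1 0 = g].

Definition tables m (u : nat -> R) off k : Prop :=
  forall j, (j < k)%N ->
    rep m (trees g u j) (wmem m ROOTS (off + j)) 0 /\
    rmem m MIN (off + j) = minimizers g u j.

Definition bases m (u : nat -> R) k : Prop :=
  [/\ rmem m B0 0 = base u 0 k, rmem m B1 0 = base u 1 k & rmem m B2 0 = base u 2 k].

Section OnePass.
Variables (u : nat -> R) (off : nat).
Hypothesis off_le : (off <= n)%N.
Hypothesis uE : forall j, (j < n)%N ->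
  target t (if (off <= 0)%N then j else n.-1 - j)%N = u j.

(** [6 * H + 2] is twice the [3 * H + 1] nodes of one insertion. The last clause protects the
    entries of the forward pass during the backward one. *)
Definition pass_inv m0 k m : Prop :=
  [/\ [/\ input_ok m, wmem m BASE 0 = off, wmem m IDX 0 = k & wmem m RB 0 = 0%N],
      [/\ nil_ok m, grows m0 m & (wmem m HP 0 <= wmem m0 HP 0 + k * (6 * H + 2))%N],
      rep m (trees g u k) (wmem m RA 0) 0,
      bases m u k & tables m u off k /\
      forall i, (i < off)%N -> wmem m ROOTS i = wmem m0 ROOTS i /\
        rmem m MIN i = rmem m0 MIN i].

Definition pass_body_cost := (cost pass_body + (find_cost H + 2 * insert_cost H))%N.

Lemma input_ok_same ws rs m m' : same_off ws rs m m' ->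
  0%N \notin ws -> 0%N \notin rs -> 1%N \notin rs -> input_ok m -> input_ok m'.
Proof.
move=> [hw hr] n0 n1 n2 [h1 h2 h3]; split; rewrite ?hw ?hr // => j lt.
by rewrite hr // h2.
Qed.

Lemma tables_same m m' k off' u' : tables m u' off' k -> grows m m' ->
  (forall j, (j < k)%N -> wmem m' ROOTS (off' + j) = wmem m ROOTS (off' + j) /\
     rmem m' MIN (off' + j) = rmem m MIN (off' + j)) -> tables m' u' off' k.
Proof.
move=> h gr E j lt; have [-> ->] := E j lt; have [h1 h2] := h j lt.
by split=> //; exact: rep_grows gr h1.
Qed.

Lemma pass_body_runs m0 m k : (k < n)%N ->
  (wmem m0 HP 0 + n * (6 * H + 2) < 2 ^ w)%N -> pass_inv m0 k m ->
  runs w pass_body m (pass_inv m0 k.+1) pass_body_cost.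
Proof.
move=> ltk ltw [[inp Eb Ei Erb] [ok g0 lehp] rT [b0 b1 b2] [tab old]].
have leH := trees_H u (ltnW ltk).
have step : (k.+1 * (6 * H + 2) <= n * (6 * H + 2))%N by rewrite leq_mul2r ltk orbT.
have [inn int ing] := inp.
eapply runs_weaken; [|by move=> ?; exact: id|shelve].
eapply runs_seq_frame; first apply: (@runs_wp _ _ w_gt0 _ _ (fun m1 =>
  [/\ bases m1 u k.+1, wmem m1 ROOTS (off + k) = wmem m RA 0 &
      forall i, i != (off + k)%N -> wmem m1 ROOTS i = wmem m ROOTS i])).
  have fin (ti : nat) : target t ti = u k -> (ti < n)%N -> wp w
     (CWSet ROOTS slot (wr RA) ;;
      setr B0 (RAdd (rr B0) (ROfWord (WLit 1))) ;;
      setr B1 (RAdd (rr B1) (RGet 0 (wr TI))) ;;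
      setr B2 (RAdd (rr B2) (RMul (RGet 0 (wr TI)) (RGet 0 (wr TI)))))
     (fun m1 : memory R =>
      [/\ bases m1 u k.+1, wmem m1 ROOTS (off + k) = wmem m RA 0 &
       forall i, i != (off + k)%N -> wmem m1 ROOTS i = wmem m ROOTS i])
     (Memory (update (wmem m) TI 0 ti) (rmem m)).
    move=> Et lt; wps; first by rewrite Eb Ei; lia.
    wps; wps; wps; rewrite /bases /update /= Eb Ei !baseS b0 b1 b2 !eqxx int // Et.
    by rewrite expr0 expr1 expr2; split=> // i /negbTE ->.
  apply: wp_eta; rewrite /pass_load; apply: wp_seq; eapply wp_if; [ev|sf| |]; rewrite Eb => ho.
    by wps; apply: fin; rewrite Ei // -uE // ho.
  wps; rewrite Ei inn; apply: fin; last by lia.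
  by rewrite -uE // (negbTE ho) subn1.
move=> m1 [bs1 Er1 old1] s1; have [//|//|g1 Eh1] := grows_same s1.
have ok1 := nil_ok_grows ok g1; have [w1 r1] := s1.
have Tleaf m' : wmem m' RB 0 = 0%N -> rep m' (@Leaf R) (wmem m' RB 0) 0 by [].
eapply runs_seq_frame; first apply: (@find_code_runs _ _ w_gt0 (trees g u k) Leaf H _ _ m1 ok1) => //.
- exact: ltnW leH.
- by rewrite (w1 RA) //; exact: rep_grows g1 rT.
- by rewrite /= (w1 RB).
have [b10 b11 b12] := bs1.
move=> m2 /=; rewrite b10 b11 -/(minimizers g u k) => -[Ez Ec0 _ _] s2.
have [//|//|g2 Eh2] := grows_same s2.
have ok2 := nil_ok_grows ok1 g2; have [w2 r2] := s2.
eapply runs_seq_frame; first apply: (@runs_wp _ _ w_gt0 _ _ (fun m3 =>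
  [/\ rmem m3 MIN (off + k) = rmem m2 ROOT 0,
      forall i, i != (off + k)%N -> rmem m3 MIN i = rmem m2 MIN i,
      rmem m3 IG 0 = 0, rmem m3 IP 0 = rmem m2 ROOT 0 & rmem m3 IE 0 = - rmem m2 C0 0])).
  have e1 : wmem m2 BASE 0 = off by rewrite (w2 BASE) // (w1 BASE).
  have e2 : wmem m2 IDX 0 = k by rewrite (w2 IDX) // (w1 IDX).
  apply: wp_eta; rewrite /pass_first; wps; first by rewrite e1 e2; lia.
  by wps; wps; wps; rewrite /update /= e1 e2 eqxx sub0r; split=> // i /negbTE ->.
move=> m3 [Em3 old3 Eg3 Ep3 Ee3] s3; have [//|//|g3 Eh3] := grows_same s3.
have ok3 := nil_ok_grows ok2 g3; have [w3 r3] := s3.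
have rT3 := rep_grows g3 (rep_grows g2 (rep_grows g1 rT)).
eapply runs_seq_frame; first apply: (@insert_code_runs _ _ w_gt0 m3 (trees g u k) H ok3) => //.
- by rewrite (w3 RA) // (w2 RA) // (w1 RA).
- exact: ltnW leH.
- exact: leq_ltn_trans leH.
- by rewrite Eh3 Eh2 Eh1; move: lehp step ltw; lia.
move=> m4 [g4 le4 rT4] s4; have ok4 := nil_ok_grows ok3 g4; have [w4 r4] := s4.
eapply runs_seq_frame; first apply: (@runs_wp _ _ w_gt0 _ _ (fun m5 =>
  [/\ wmem m5 RA 0 = wmem m4 RES 0, rmem m5 IG 0 = g,
      rmem m5 IP 0 = rmem m4 ROOT 0 + g & rmem m5 IE 0 = rmem m4 C0 0])).
  have e1 : rmem m4 1 0 = g by rewrite (r4 1%N) // (r3 1%N) // (r2 1%N) // (r1 1%N).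
  by apply: wp_eta; rewrite /pass_second; wps; wps; wps; wps; rewrite /update /= e1.
move=> m5 [Era5 Eg5 Ep5 Ee5] s5; have [//|//|g5 Eh5] := grows_same s5.
have ok5 := nil_ok_grows ok4 g5; have [w5 r5] := s5.
have Z5 : rmem m5 ROOT 0 = minimizers g u k by rewrite (r5 ROOT) // (r4 ROOT) // (r3 ROOT).
have C5 : rmem m5 IE 0 = accum 0 (base u 0 k.+1) (trees g u k) Leaf
    (lower (base u 0 k.+1) (base u 1 k.+1) (trees g u k) Leaf).
  by rewrite Ee5 (r4 C0) // (r3 C0).
rewrite (r3 ROOT) // Ez Eg3 Ep3 Ez Ee3 Ec0 in rT4.
have [_ av _ _ _] := trees_correct u k g_ge0.
eapply runs_seq_frame; first apply: (@insert_code_runs _ _ w_gt0 m5 _ H ok5 _ _ _ word_H) => //.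
- by rewrite Era5; exact: rep_grows g5 rT4.
(* The strict inequality in [trees_H] leaves room for the level that the first insertion may add. *)
- have [_ /andP[_ le]] := avl_insert (minimizers g u k) (minimizers g u k)
    (- accum 0 (base u 0 k.+1) (trees g u k) Leaf
      (lower (base u 0 k.+1) (base u 1 k.+1) (trees g u k) Leaf)) 0 av.
  exact: leq_trans le leH.
- exact: leq_ltn_trans leH.
- by rewrite Eh5; move: le4; rewrite Eh3 Eh2 Eh1; move: lehp step ltw; lia.
rewrite Z5 Ep5 Eg5 (r4 ROOT) // (r3 ROOT) // Ez C5.
move=> m6 [g6 le6 rT6] s6; have ok6 := nil_ok_grows ok5 g6; have [w6 r6] := s6.
apply: runs_weaken; [apply: runs_frame; apply: (@runs_wp _ _ w_gt0 _ _ (fun m7 =>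
  wmem m7 RA 0 = wmem m6 RES 0 /\ wmem m7 IDX 0 = k.+1))| |exact: leqnn].
  have e1 : wmem m6 IDX 0 = k.
    by rewrite (w6 IDX) // (w5 IDX) // (w4 IDX) // (w3 IDX) // (w2 IDX) // (w1 IDX).
  apply: wp_eta; rewrite /pass_last; wps; wps; first by rewrite e1; lia.
  by rewrite /update /= e1 addn1.
move=> m7 [[Era7 Ei7] s7]; have [//|//|g7 Eh7] := grows_same s7.
have [w7 r7] := s7.
have gm7 : grows m m7.
  apply: grows_trans g1 (grows_trans g2 (grows_trans g3 (grows_trans g4 _))).
  exact: grows_trans g5 (grows_trans g6 g7).
have s37 := same_off_seq s4 (same_off_seq s5 (same_off_seq s6 s7)).
have s17 := same_off_seq (c1 := find_code) s2 (same_off_seq s3 s37).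
have s07 := same_off_seq s1 s17.
have [w37 r37] := s37; have [w17 r17] := s17; have [w07 r07] := s07.
have ok7 := nil_ok_grows ok gm7.
split; first by split; [exact: (input_ok_same s07 _ _ _ inp)|rewrite w07|exact: Ei7|rewrite w07].
- split=> //; first exact: grows_trans g0 gm7.
  by rewrite Eh7; move: le6 le4 lehp; rewrite Eh5 Eh3 Eh2 Eh1 mulSn; lia.
- by rewrite Era7; exact: rep_grows g7 rT6.
- by rewrite /bases !r17.
split.
  move=> j; rewrite ltnS leq_eqVlt => /predU1P[->|ltjk].
    rewrite w17 // Er1 r37 // Em3 Ez; split=> //; exact: rep_grows gm7 rT.
  have [h1 h2] := tab j ltjk.
  have ne : (off + j != off + k)%N by rewrite eqn_add2l ltn_eqF.
  rewrite w17 // old1 // r37 // old3 // (r2 MIN) // (r1 MIN) //; split=> //.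
  exact: rep_grows gm7 h1.
move=> i lti; have ne : (i != off + k)%N by rewrite ltn_eqF // (leq_trans lti) // leq_addr.
by rewrite w17 // old1 // r37 // old3 // (r2 MIN) // (r1 MIN) //; exact: old.
Unshelve.
rewrite /pass_body_cost; move: (find_cost H) (insert_cost H) => K K'.
by rewrite /pass_body /=; lia.
Qed.

Definition pass_cost := (cost pass_init +
  (n * (bcost below_n + pass_body_cost).+1 + (bcost below_n).+1))%N.

Lemma pass_code_runs m :
  input_ok m -> wmem m BASE 0 = off -> nil_ok m ->
  (wmem m HP 0 + n * (6 * H + 2) < 2 ^ w)%N ->
  runs w pass_code m (fun m' =>
    [/\ input_ok m' /\ (wmem m' HP 0 <= wmem m HP 0 + n * (6 * H + 2))%N,
        nil_ok m', grows m m', bases m' u n & tables m' u off n /\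
        forall i, (i < off)%N -> wmem m' ROOTS i = wmem m ROOTS i /\
          rmem m' MIN i = rmem m MIN i])
    pass_cost.
Proof.
move=> inp Eb ok ltw.
eapply runs_seq_frame; first apply: (@runs_wp _ _ w_gt0 _ _ (fun m1 =>
  [/\ wmem m1 IDX 0 = 0%N, wmem m1 RA 0 = 0%N, wmem m1 RB 0 = 0%N &
     [/\ rmem m1 B0 0 = 0, rmem m1 B1 0 = 0 & rmem m1 B2 0 = 0]])).
  by apply: wp_eta; rewrite /pass_init; wps; wps; wps; wps; wps; wps.
move=> m1 [Ei Era Erb [e0 e1 e2]] s1; have [//|//|g1 Eh1] := grows_same s1.
have ok1 := nil_ok_grows ok g1; have [w1 r1] := s1.
apply: runs_weaken; [apply: (@runs_for _ _ w_gt0 below_n pass_body (pass_inv m1) n 0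
  m1 pass_body_cost)| |by rewrite subn0; exact: leqnn].
- move=> j m2 lejn [[[En _ _] _ Ej _] _ _ _ _].
  by rewrite /= En Ej -ltnNge.
- by move=> j m2 ltjn; apply: pass_body_runs => //; rewrite Eh1.
- by [].
- split; first by split; [exact: (input_ok_same s1 _ _ _ inp)|rewrite w1| |].
  + by split=> //; rewrite ?mul0n ?addn0 //; exact: grows_refl.
  + by rewrite /= Era.
  + by rewrite /bases /base !big_ord0.
  + by [].
move=> m2 [[inp2 _ _ _] [ok2 g2 le2] _ b2 [tab2 old2]].
split=> //; first by rewrite Eh1 in le2.
- exact: grows_trans g1 g2.
- by split=> // i lti; have [-> ->] := old2 i lti; rewrite (w1 ROOTS) // (r1 MIN).
Qed.

End OnePass.
End Passes.

(** * Choosing the peak and tracing the regression *)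

(** Peak i has n - 1 - i vertices on its right, and the backward pass stored its trees from index n
    on. *)
Definition combine_load : cmd :=
  setw RA (WGet ROOTS (wr IDX)) ;;
  setw RB (WGet ROOTS (WAdd (wr 0) (mirror IDX))).

(** The value is c2 - c1 z, as in [root_correct]. At index 0 no cost has been recorded yet, and the
    test on [IDX] keeps the initial content of [BEST] from deciding. *)
Definition combine_record : cmd :=
  setr VAL (RSub (rr C2) (RMul (rr C1) (rr ROOT))) ;;
  CIf (BAnd (BWordLe (WLit 1) (wr IDX)) (BRealLe (rr BEST) (rr VAL)))
    CSkip
    (setr BEST (rr VAL) ;; setr BX (rr ROOT) ;; setw BI (wr IDX)) ;;
  setw IDX (WAdd (wr IDX) (WLit 1)).

Definition combine_body : cmd := combine_load ;; find_code ;; combine_record.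

Definition clamp_code : cmd :=
  CIf (BRealLe (rr ROOT) (RSub (rr VAL) (rr 1)))
    (setr AT (RSub (rr VAL) (rr 1)))
    (CIf (BRealLe (rr VAL) (rr ROOT)) (setr AT (rr VAL)) (setr AT (rr ROOT))).

Definition trace_left : cmd :=
  setr VAL (RGet OUT (wr POS)) ;; setw POS (WSub (wr POS) (WLit 1)) ;;
  setr ROOT (RGet MIN (wr POS)) ;; clamp_code ;; CRSet OUT (wr POS) (rr AT).

Definition trace_right : cmd :=
  setr VAL (RGet OUT (wr POS)) ;; setw POS (WAdd (wr POS) (WLit 1)) ;;
  setr ROOT (RGet MIN (WAdd (wr 0) (mirror POS))) ;; clamp_code ;;
  CRSet OUT (wr POS) (rr AT).

Definition right_test := BNot (BWordLe (wr 0) (WAdd (wr POS) (WLit 1))).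

Definition regression_code : cmd :=
  (setw HP (WLit 1) ;; setw BASE (WLit 0)) ;;
  pass_code ;;
  setw BASE (wr 0) ;;
  pass_code ;;
  setw IDX (WLit 0) ;;
  CWhile below_n combine_body ;;
  (CRSet OUT (wr BI) (rr BX) ;; setw POS (wr BI)) ;;
  CWhile (nonzero POS) trace_left ;;
  setw POS (wr BI) ;;
  CWhile right_test trace_right.

Section Combination.
Variables (R : realType) (w n : nat) (t : 'I_n -> R) (g : R) (H : nat).
Hypothesis w_gt0 : (0 < w)%N.
Implicit Types (m : memory R) (T l r : tree R).

Hypothesis g_ge0 : 0 <= g.
Hypothesis n_gt0 : (0 < n)%N.
Hypothesis word_n : (n + n < 2 ^ w)%N.
Hypothesis word_H : (2 * H + 4 < 2 ^ w)%N.
Hypothesis trees_H : forall (u : nat -> R) k, (k <= n)%N -> (height (trees g u k) < H)%N.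

Let u := target t.
Let u' := target_rev t.

Definition ready m : Prop :=
  [/\ input_ok t g m, nil_ok m, bases m u n, tables g m u 0 n & tables g m u' n n].

Definition combine_inv m0 k m : Prop :=
  [/\ wmem m IDX 0 = k, same_off (wbanks combine_body) (rbanks combine_body) m0 m &
      (0 < k)%N -> exists i, [/\ (i < k)%N, wmem m BI 0 = i,
        rmem m BX 0 = peak_value t g i, rmem m BEST 0 = peak_cost t g i &
        forall j, (j < k)%N -> peak_cost t g i <= peak_cost t g j]].

Definition combine_cost := (cost combine_body + find_cost H)%N.

Lemma combine_body_runs m0 k m : ready m0 -> (k < n)%N -> combine_inv m0 k m ->
  runs w combine_body m (combine_inv m0 k.+1) combine_cost.
Proof.
move=> [inp0 ok0 bs0 tab0 tab0'] ltk [Ei s0 best].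
have [//|//|g0 Eh0] := grows_same s0; have [w0 r0] := s0.
have ok := nil_ok_grows ok0 g0.
have [inn _ _] := inp0.
eapply runs_weaken; [|by move=> ?; exact: id|shelve].
eapply runs_seq_frame; first apply: (@runs_wp _ _ w_gt0 _ _ (fun m1 =>
  wmem m1 RA 0 = wmem m0 ROOTS k /\ wmem m1 RB 0 = wmem m0 ROOTS (n + (n.-1 - k)))).
  have E0 : wmem m 0 0 = n by rewrite w0.
  apply: wp_eta; rewrite /combine_load; wps; wps; first by rewrite E0 Ei; lia.
  by rewrite /update /= E0 Ei !w0 // subn1.
move=> m1 [Era Erb] s1; have [//|//|g1 Eh1] := grows_same s1.
have ok1 := nil_ok_grows ok g1; have [w1 r1] := s1.
have gr := grows_trans g0 g1.
have lt' : (n.-1 - k < n)%N by lia.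
eapply runs_seq_frame; first apply: (@find_code_runs _ _ w_gt0 (trees g u k)
    (trees g u' (n.-1 - k)) H _ _ m1 ok1).
- by apply: ltnW; apply: trees_H; exact: ltnW.
- by apply: ltnW; apply: trees_H; exact: ltnW.
- by rewrite Era; apply: rep_grows gr _; have [] := tab0 k ltk.
- by rewrite Erb; apply: rep_grows gr _; have [] := tab0' _ lt'.
have [b0 b1 b2] := bs0.
move=> m2 /=; rewrite (r1 B0) // (r0 B0) // (r1 B1) // (r0 B1) // (r1 B2) // (r0 B2) //.
rewrite b0 b1 b2 -/(peak_value t g k) => -[Ez _ Ec1 Ec2] s2'.
have s2 : same_off (wbanks find_code) (rbanks find_code) m1 m2 := s2'.
have [w2 r2] := s2.
have [_ Ev] := peak_correct t g_ge0 ltk.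
have Ek : wmem m2 IDX 0 = k by rewrite (w2 IDX) // (w1 IDX).
apply: runs_weaken; [apply: runs_frame; apply: (@runs_wp _ _ w_gt0 _ _ (fun m3 =>
  wmem m3 IDX 0 = k.+1 /\
  (exists i, [/\ (i < k.+1)%N, wmem m3 BI 0 = i,
        rmem m3 BX 0 = peak_value t g i, rmem m3 BEST 0 = peak_cost t g i &
        forall j, (j < k.+1)%N -> peak_cost t g i <= peak_cost t g j])))| |exact: leqnn].
  apply: wp_eta; rewrite /combine_record; wps.
  rewrite Ec2 Ec1 Ez Ev; apply: wp_seq; eapply wp_if; [ev|sf| |].
    rewrite Ek (r2 BEST) // (r1 BEST) // => /andP[k0 le].
    apply: wp_skip; wps; first by rewrite Ek; lia.
    have [i [lti Ebi Ebx Ebest min]] := best k0.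
    rewrite /update /= Ek addn1; split=> //; exists i; rewrite ?(w2 BI) ?(w1 BI) //.
    rewrite (r2 BX) // (r1 BX) // (r2 BEST) // (r1 BEST) //; split=> //; first exact: ltnW.
    move=> j; rewrite ltnS leq_eqVlt => /predU1P[->|]; last exact: min.
    by rewrite -Ebest.
  rewrite Ek (r2 BEST) // (r1 BEST) // negb_and => h.
  wps; wps; wps; wps; first by rewrite Ek; lia.
  rewrite /update /= Ek addn1 Ez; split=> //; exists k; split=> // j.
  rewrite ltnS leq_eqVlt => /predU1P[->//|ltj].
  have k0 : (0 < k)%N by exact: leq_ltn_trans ltj.
  have [i [lti Ebi Ebx Ebest min]] := best k0.
  apply: le_trans (min j ltj); rewrite -Ebest; move: h; rewrite k0 /= -ltNge => /ltW.
  done.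
move=> m3 [[Ei3 best3] s3]; split=> //.
exact: same_off_trans s0 (same_off_seq s1 (same_off_seq s2 s3)).
Unshelve.
rewrite /combine_cost; move: (find_cost H) => K.
by rewrite /combine_body /=; lia.
Qed.

Lemma clamp_code_wp m (Q : memory R -> Prop) f h :
  m = Memory f h ->
  Q (Memory f (update h AT 0 (clamp (h 1%N 0%N) (h ROOT 0%N) (h VAL 0%N)))) ->
  wp w clamp_code Q m.
Proof.
move=> -> q; eapply wp_if; [ev|sf| |] => h1.
  by wps; move: q; rewrite /clamp h1.
eapply wp_if; [ev|sf| |] => h2; wps; by move: q; rewrite /clamp (negbTE h1) ?h2 ?(negbTE h2).
Qed.

(** After [d] steps the [d] vertices just left of the peak [k] have their values; [m0] is the memory
    at the start of the loop. *)
Definition left_inv m0 k d m : Prop :=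
  [/\ same_off (wbanks trace_left) (rbanks trace_left) m0 m,
      wmem m POS 0 = (k - d)%N, rmem m OUT k = rmem m0 OUT k &
      forall j, (k - d <= j)%N -> (j < k)%N ->
        rmem m OUT j = clamp g (rmem m0 MIN j) (rmem m OUT j.+1)].

Lemma trace_left_runs m0 k d m : rmem m0 1 0 = g -> (d < k)%N ->
  left_inv m0 k d m -> runs w trace_left m (left_inv m0 k d.+1) (cost trace_left).
Proof.
move=> Eg ltd [s0 Ej Ek hj]; have [w0 r0] := s0.
apply: runs_weaken; [apply: runs_frame; apply: (@runs_wp _ _ w_gt0 _ _ (fun m1 =>
  [/\ wmem m1 POS 0 = (k - d.+1)%N,
     rmem m1 OUT (k - d.+1) = clamp g (rmem m0 MIN (k - d.+1)) (rmem m OUT (k - d)) &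
     forall i, i != (k - d.+1)%N -> rmem m1 OUT i = rmem m OUT i]))| |exact: leqnn].
  apply: wp_eta; rewrite /trace_left; wps; wps; wps; apply: wp_seq.
  apply: clamp_code_wp; first by [].
  wps; rewrite /update /= Ej subn1 -subnS eqxx (r0 1%N) // (r0 MIN) // Eg; split=> //.
  by move=> i /negbTE ->.
move=> m1 [[Ej1 Eo old] s1].
have s01 := same_off_trans s0 s1; split=> //.
  by rewrite old //; move: ltd; lia.
move=> j lej ltj; case: (eqVneq j (k - d.+1)%N) => [->|ne].
  by rewrite Eo (_ : (k - d.+1).+1 = k - d)%N ?old //; lia.
have ne' : j.+1 != (k - d.+1)%N by apply/eqP; lia.
rewrite (old _ ne) (old _ ne'); apply: hj => //.
by move/eqP: ne; lia.
Qed.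

Definition right_inv m0 k d m : Prop :=
  [/\ same_off (wbanks trace_right) (rbanks trace_right) m0 m,
      wmem m POS 0 = (k + d)%N,
      forall j, (j <= k)%N -> rmem m OUT j = rmem m0 OUT j &
      forall j, (k <= j)%N -> (j < k + d)%N ->
        rmem m OUT j.+1 = clamp g (rmem m0 MIN (n + (n.-1 - j.+1))) (rmem m OUT j)].

Lemma trace_right_runs m0 k d m : rmem m0 1 0 = g -> wmem m0 0 0 = n ->
  ((k + d).+1 < n)%N -> right_inv m0 k d m ->
  runs w trace_right m (right_inv m0 k d.+1) (cost trace_right).
Proof.
move=> Eg En ltd [s0 Ej Ek hj]; have [w0 r0] := s0.
apply: runs_weaken; [apply: runs_frame; apply: (@runs_wp _ _ w_gt0 _ _ (fun m1 =>
  [/\ wmem m1 POS 0 = (k + d).+1,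
     rmem m1 OUT (k + d).+1 = clamp g (rmem m0 MIN (n + (n.-1 - (k + d).+1)))
       (rmem m OUT (k + d)) &
     forall i, i != (k + d).+1 -> rmem m1 OUT i = rmem m OUT i]))| |exact: leqnn].
  have En' : wmem m 0 0 = n by rewrite w0.
  apply: wp_eta; rewrite /trace_right; wps; wps; first by rewrite Ej; lia.
  wps; first by rewrite En' Ej; lia.
  apply: wp_seq; apply: clamp_code_wp; first by [].
  wps; rewrite /update /= Ej En' addn1 subn1 eqxx (r0 1%N) // (r0 MIN) // Eg; split=> //.
  by move=> i /negbTE ->.
move=> m1 [[Ej1 Eo old] s1].
have s01 := same_off_trans s0 s1; split=> //.
- by rewrite Ej1 addnS.
- by move=> j le; rewrite old ?Ek //; lia.
move=> j lej ltj; case: (eqVneq j (k + d)%N) => [->|ne].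
  by rewrite Eo old //; lia.
have ne1 : j.+1 != (k + d).+1 by rewrite eqSS.
have ne2 : j != (k + d).+1 by apply/eqP; lia.
rewrite (old _ ne1) (old _ ne2); apply: hj => //.
by move/eqP: ne; lia.
Qed.

Definition regression_cost :=
  (cost regression_code + (pass_cost n H + pass_cost n H +
   (n * (bcost below_n + combine_cost).+1 + (bcost below_n).+1) +
   (n * (bcost (nonzero POS) + cost trace_left).+1 + (bcost (nonzero POS)).+1) +
   (n * (bcost right_test + cost trace_right).+1 + (bcost right_test).+1)))%N.

(** The backward pass leaves the sums over the reversed path in [B0], [B1], [B2]; the combination
    reads them as sums over the path itself. *)
Lemma base_rev j : base u' j n = base u j n.
Proof.
rewrite /base (reindex_inj rev_ord_inj) /=; apply: eq_bigr => i _.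
by congr (_ ^+ _); rewrite /u' /target_rev; congr target; have := ltn_ord i; lia.
Qed.

(** The hypothesis keeps addresses within a word: the heap pointer starts at 1, and each of the two
    passes allocates at most n (6 H + 2) nodes. *)
Lemma regression_code_runs :
  (1 + 2 * (n * (6 * H + 2)) < 2 ^ w)%N ->
  runs w regression_code (input_memory t g)
    (fun m => unimodal_regression g t (output n m)) regression_cost.
Proof.
move=> ltw.
eapply runs_weaken; [|by move=> ?; exact: id|shelve].
eapply runs_seq_frame; first apply: (@runs_wp _ _ w_gt0 _ _ (fun m1 =>
  [/\ input_ok t g m1, wmem m1 BASE 0 = 0%N, nil_ok m1 & wmem m1 HP 0 = 1%N])).
  apply: wp_eta; wps; wps; split=> //.
move=> m1 [inp1 Eb1 ok1 Eh1] _.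
eapply runs_seq_frame; first apply: (@pass_code_runs _ w n t g H w_gt0 g_ge0 n_gt0
    word_n word_H trees_H u 0 _ _ m1 inp1 Eb1 ok1) => //.
- by rewrite Eh1; move: ltw; lia.
move=> m2 [[inp2 le2] ok2 g2 bs2 [tab2 _]] _.
have [En2 _ _] := inp2.
eapply runs_seq_frame; first apply: (@runs_wp _ _ w_gt0 _ _ (fun m3 =>
  wmem m3 BASE 0 = n)).
  by apply: wp_eta; wps.
move=> m3 Eb3 s3; have [//|//|g3 Eh3] := grows_same s3; have [w3 r3] := s3.
have ok3 := nil_ok_grows ok2 g3.
have inp3 : input_ok t g m3 by exact: (input_ok_same s3 _ _ _ inp2).
eapply runs_seq_frame; first apply: (@pass_code_runs _ w n t g H w_gt0 g_ge0 n_gt0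
    word_n word_H trees_H u' n _ _ m3 inp3 Eb3 ok3) => //.
- by move=> j ltj; rewrite leqNgt n_gt0.
- by rewrite Eh3; move: le2 ltw; rewrite Eh1; lia.
move=> m4 [[inp4 _] ok4 g4 [b40 b41 b42] [tab4 old4]] _.
have tab4' : tables g m4 u 0 n.
  apply: (tables_same tab2 (grows_trans g3 g4)) => j ltj.
  by have [-> ->] := old4 j ltj; rewrite (w3 ROOTS) // (r3 MIN).
eapply runs_seq_frame; first apply: (@runs_wp _ _ w_gt0 _ _ (fun m5 =>
  wmem m5 IDX 0 = 0%N)).
  by apply: wp_eta; wps.
move=> m5 Ei5 s5; have [//|//|g5 Eh5] := grows_same s5; have [w5 r5] := s5.
have ready5 : ready m5.
  split; first exact: (input_ok_same s5 _ _ _ inp4).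
  - exact: nil_ok_grows ok4 g5.
  - by split; rewrite r5 // -base_rev.
  - by apply: (tables_same tab4' g5) => j _; rewrite w5 // r5.
  - by apply: (tables_same tab4 g5) => j _; rewrite w5 // r5.
have [inp5 ok5 _ tab5 tab5'] := ready5; have [En5 _ Eg5] := inp5.
eapply runs_seq_frame; first apply: (@runs_for _ _ w_gt0 below_n combine_body
  (combine_inv m5) n 0 m5 combine_cost) => //.
- by move=> j m lej [Ej [wj _] _]; rewrite /= wj // En5 Ej -ltnNge.
- by move=> j m ltj; exact: combine_body_runs.
move=> m6 [Ei6 s6 best6] _; have [k [ltk Ebi Ebx _ min]] := best6 n_gt0.
have [w6 r6] := s6.
eapply runs_seq_frame; first apply: (@runs_wp _ _ w_gt0 _ _ (fun m7 =>
  rmem m7 OUT k = peak_value t g k /\ wmem m7 POS 0 = k)).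
  by apply: wp_eta; wps; wps; rewrite /update /= Ebi eqxx Ebx.
move=> m7 [Ek7 Ej7] s7; have [w7 r7] := s7.
have Eg7 : rmem m7 1 0 = g by rewrite r7 // r6.
eapply runs_seq_frame; first apply: (runs_weaken (@runs_for _ _ w_gt0 (nonzero POS)
  trace_left (left_inv m7 k) k 0 m7 (cost trace_left) _ _ _ _) (fun _ x => x)
  (k' := (n * (bcost (nonzero POS) + cost trace_left).+1 + (bcost (nonzero POS)).+1)%N)) => //.
- by move=> j m lej [_ Ej _ _]; rewrite /= Ej -ltnNge subn_gt0.
- by move=> j m ltj; exact: trace_left_runs.
- by split=> //; rewrite ?subn0 // => j; lia.
- by rewrite subn0 leq_add2r leq_mul2r (ltnW ltk) orbT.
move=> m8 [s8 _ Ek8 hl8] _; have [w8 r8] := s8.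
eapply runs_seq_frame; first apply: (@runs_wp _ _ w_gt0 _ _ (fun m9 =>
  wmem m9 POS 0 = k)).
  by apply: wp_eta; wps; rewrite /update /= (w8 BI) // (w7 BI).
move=> m9 Ej9 s9; have [w9 r9] := s9.
have Eg9 : rmem m9 1 0 = g by rewrite r9 // r8.
have En9 : wmem m9 0 0 = n by rewrite w9 // w8 // w7 // w6.
apply: (runs_weaken (@runs_for _ _ w_gt0 right_test
  trace_right (right_inv m9 k) (n.-1 - k) 0 m9 (cost trace_right) _ _ _ _)
  (k' := (n * (bcost right_test + cost trace_right).+1 + (bcost right_test).+1)%N)) => //.
- move=> j m lej [[wj _] Ej _ _]; rewrite /= (wj 0%N) // En9 Ej addn1 -ltnNge; split.
    by split=> //; split=> //; lia.
  by apply/idP/idP; lia.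
- by move=> j m ltj; apply: trace_right_runs => //; lia.
- by split=> //; rewrite ?addn0 // => j; lia.
- move=> m10 [s10 _ Eo10 hr10]; have [w10 r10] := s10.
  have EM (i : nat) : rmem m9 MIN i = rmem m5 MIN i by rewrite r9 // r8 // r7 // r6.
  apply: (traced_regression g_ge0 (k := k) (s := rmem m10 OUT) ltk) => //; split.
  + by rewrite Eo10 // (r9 OUT) // Ek8.
  + move=> j ltj; rewrite !Eo10 //; last exact: ltnW.
    rewrite !(r9 OUT) // hl8 ?subnn //; congr clamp.
    have [_ <-] := tab5 j (ltn_trans ltj ltk).
    by rewrite r7 // r6 // add0n.
  + move=> j lej ltj; rewrite hr10 //; last by lia.
    by rewrite EM; have [|_ ->] := tab5' (n.-1 - j.+1)%N; first by lia.
- by rewrite subn0 leq_add2r leq_mul2r; apply/orP; right; lia.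
Unshelve.
rewrite subn0 /regression_cost; move: (pass_cost n H) combine_cost => K K'.
by rewrite /regression_code /=; lia.
Qed.

End Combination.

(** * Running time *)

(** There are 2 k hinges, so with L = [(trunc_log 2 n).+1] the height h satisfies 2^(h/2) <= 2 n + 1
    < 2^(L + 1), where h/2 is rounded down. *)
Lemma trees_height (R : realType) (g : R) (u : nat -> R) n k : 0 <= g -> (0 < n)%N ->
  (k <= n)%N -> (height (trees g u k) < 2 * (trunc_log 2 n).+1 + 2)%N.
Proof.
move=> g0 n0 lekn; have [_ /avl_size + size_k _ _] := trees_correct u k g0.
rewrite size_k; set L := (trunc_log 2 n).+1 => le1.
have ltn : (n < 2 ^ L)%N by exact: trunc_log_ltn.
have : (2 ^ (height (trees g u k))./2 < 2 ^ L.+1)%N.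
  by apply: leq_ltn_trans le1 _; rewrite expnS; lia.
by rewrite ltn_exp2l //; lia.
Qed.

(** The factor [n.+1] covers both the loops over the path and the code outside them. *)
Lemma regression_cost_le : exists K, forall n H,
  (regression_cost n H <= K * n.+1 * H.+1 ^ 2)%N.
Proof.
pose quadratic (f : nat -> nat) := exists K, forall H, (f H <= K * H.+1 ^ 2)%N.
have qC c : quadratic (fun=> c).
  by exists c => H; rewrite leq_pmulr // expn_gt0.
have qD f f' : quadratic f -> quadratic f' -> quadratic (fun H => f H + f' H)%N.
  move=> [K hK] [K' hK']; exists (K + K')%N => H; rewrite mulnDl leq_add //.
have qM c f : quadratic f -> quadratic (fun H => c * f H)%N.
  by move=> [K hK]; exists (c * K)%N => H; rewrite -mulnA leq_mul2l hK orbT.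
have qL c : quadratic (fun H => H.+1 * c)%N.
  exists c => H; rewrite mulnC leq_mul2l; apply/orP; right.
  by rewrite -{1}(expn1 H.+1) leq_pexp2l.
have qLL (f : nat -> nat) c c' : (forall H, f H = c + H.+1 * c')%N ->
    quadratic (fun H => H.+1 * f H)%N.
  move=> Ef; exists (c + c')%N => H; rewrite Ef expnS expn1 mulnCA.
  rewrite leq_mul2l; apply/orP; right.
  rewrite mulnDl leq_add // ?leq_pmulr //; by rewrite mulnC.
have q_both : quadratic both_cost.
  by apply: (qD _ _) => //; apply: (qM _ _).
have q_search : quadratic (fun H => H.+1 * search_cost H)%N.
  apply: (qLL _ (bcost (nonzero PROBE) + cost search_body + cost eval_both).+1
    (2 * eval_cost)%N) => H.
  by rewrite /search_cost /both_cost; move: eval_cost (cost _) (cost _) => *; nia.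
have q_find : quadratic find_cost.
  by apply: (qD _ _) => //; apply: (qD _ _) => //; exact: (qM _ _).
have q_insert : quadratic insert_cost by apply: (qD _ _) => //; exact: (qD _ _).
have q_pass : quadratic pass_body_cost.
  by apply: (qD _ _) => //; apply: (qD _ _) => //; exact: (qM _ _).
have q_combine : quadratic combine_cost by exact: (qD _ _).
(* A generous bound on all contributions that do not depend on [H]. *)
pose a := (5 + cost regression_code + cost pass_init + cost pass_init
  + bcost below_n * 6 + bcost (nonzero POS) * 2 + bcost right_test * 2
  + cost trace_left + cost trace_right + 5)%N.
have [K hK] : quadratic (fun H => pass_body_cost H + pass_body_cost H + combine_cost H + a)%N.
  by apply: (qD _ _) => //; apply: (qD _ _) => //; exact: (qD _ _).
exists K => n H; rewrite mulnAC.
have := leq_mul (hK H) (leqnn n.+1); apply: leq_trans.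
rewrite /regression_cost /pass_cost /a.
move: (pass_body_cost H) (combine_cost H) (bcost below_n) (bcost (nonzero POS))
  (bcost right_test) (cost trace_left) (cost trace_right) (cost pass_init)
  (cost regression_code) => x1 x2 x3 x4 x5 x6 x7 x8 x9.
by nia.
Qed.

Lemma nlog2_bigO (R : realType) (T : nat -> nat) K :
  (forall n, (T n <= K * n.+1 * (2 * (trunc_log 2 n).+1 + 3) ^ 2)%N) ->
  (fun n => (T n)%:R : R^o) =O_\oo (fun n => n%:R * ln (n%:R : R) ^+ 2 : R^o).
Proof.
move=> hT; apply/eqO_exP.
have ln2_gt0 : 0 < ln (2 : R) by apply: ln_gt0; rewrite ltr1n.
(* For n >= 2 the logarithm to base 2 is at least 1, so 2 (log n + 1) + 3 = 2 log n + 5 is at most 7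
   log n; the factor 2 comes from n + 1 <= 2 n, and [K.+1] keeps the constant positive. *)
exists (K.+1%:R * (2 * (7 / ln 2) ^+ 2)).
  by rewrite mulr_gt0 ?ltr0n // mulr_gt0 // exprn_gt0 // divr_gt0.
near=> n.
have n2 : (2 <= n)%N by near: n; exact: nbhs_infty_ge.
set l := ln (n%:R : R).
have n0 : 0 < n%:R :> R by rewrite ltr0n; lia.
have l2 : ln 2 <= l by rewrite ler_ln ?posrE // ler_nat.
have lt : (trunc_log 2 n)%:R * ln 2 <= l.
  have -> : (trunc_log 2 n)%:R * ln (2 : R) = ln (2 ^+ trunc_log 2 n).
    by rewrite lnXn // mulr_natl.
  rewrite ler_ln ?posrE ?exprn_gt0 // -natrX ler_nat.
  by apply: trunc_logP => //; lia.
have l0 : 0 < l by exact: lt_le_trans l2.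
rewrite !ger0_norm ?ler0n //; last by rewrite mulr_ge0 ?sqr_ge0 ?ler0n.
have h1 : (2 * (trunc_log 2 n).+1 + 3)%:R <= 7 / ln 2 * l.
  rewrite mulrAC ler_pdivlMr // natrD natrM -addn1 natrD.
  by move: lt l2; set k := (trunc_log 2 n)%:R; lra.
have h2 : n.+1%:R <= 2 * n%:R :> R by rewrite -natrM ler_nat; lia.
apply: le_trans (_ : (K * n.+1 * (2 * (trunc_log 2 n).+1 + 3) ^ 2)%:R <= _).
  by rewrite ler_nat.
rewrite 2!natrM natrX.
apply: le_trans (_ : K.+1%:R * (2 * n%:R) * (7 / ln 2 * l) ^+ 2 <= _); last first.
  by rewrite le_eqVlt; apply/orP; left; apply/eqP; ring.
apply: ler_pM; rewrite ?mulr_ge0 ?ler0n ?sqr_ge0 //.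
  by apply: ler_pM; rewrite ?ler0n // ler_nat.
by rewrite ler_pXn2r // nnegrE ?ler0n // mulr_ge0 ?divr_ge0 // ltW.
Unshelve. all: by end_near.
Qed.

Theorem theorem3 (R : realType) :
  exists (p : cmd) (c : nat) (T : nat -> nat),
    (forall (n : nat) (t : 'I_n -> R) (gamma : R), (0 < n)%N -> 0 <= gamma ->
      exists (m : memory R) (k : nat),
        [/\ exec (word_size c n) p (input_memory t gamma) m k,
            (k <= T n)%N
          & unimodal_regression gamma t (output n m)]) /\
    (fun n => (T n)%:R : R^o) =O_\oo (fun n => n%:R * ln (n%:R : R) ^+ 2 : R^o).
Proof.
exists regression_code, 10%N,
  (fun n => regression_cost n (2 * (trunc_log 2 n).+1 + 2)); split.
  move=> n t g n0 g0; set L := (trunc_log 2 n).+1.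
  have ltn : (n < 2 ^ L)%N by exact: trunc_log_ltn.
  have ltL : (L < 2 ^ L)%N by exact: ltn_expl.
  have Ew : (2 ^ word_size 10 n = (2 ^ L) ^ 10)%N by rewrite /word_size mulnC expnM.
  have P2 : (2 <= 2 ^ L)%N by rewrite -{1}(expn1 2) leq_exp2l.
  (* With X = 2^L, both n and L are below X, and the word bounds needed for H = 2 L + 2 are at most
     256 X^2. Since X >= 2, this is at most X^10, which explains the factor 10. *)
  have big : ((2 ^ L) ^ 2 * 2 ^ 8 <= 2 ^ word_size 10 n)%N.
    rewrite Ew (expnD _ 2 8) leq_mul2l; apply/orP; right.
    by rewrite leq_exp2r.
  move: big; rewrite (_ : 2 ^ 8 = 256)%N // expnS expn1 => big.
  apply: (@regression_code_runs _ _ n t g (2 * L + 2)%N) => //.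
  - by apply: leq_trans big; nia.
  - by apply: leq_trans big; nia.
  - by move=> u k lekn; exact: trees_height.
  - by apply: leq_trans big; nia.
have [K hK] := regression_cost_le.
by apply: (@nlog2_bigO _ _ K) => n; apply: leq_trans (hK _ _) _; rewrite -addnS.
Qed.
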